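(* Let $u$ and $z$ satisfy the transport equation $$z_t(s,t)=z_s(s,t)\ \ ((s,t)\in(0,D)\times\mathbb R_+),\qquad z(D,t)=U(t),\qquad z(0,t)=U(t-D),$$ and the shoreline equation $$\dot u(t)=A_nu(t)+Bz(0,t)+\mathfrak d(t).$$ Then the predictor state $$Y(t)=e^{A_nD}u(t)+\int_0^De^{A_n(D-s)}Bz(s,t)\,ds$$ satisfies $$\dot Y(t)=A_nY(t)+BU(t)+e^{A_nD}\mathfrak d(t).$$ The identity holds classically for sufficiently regular solutions and extends to energy solutions in the mild sense, i.e. $$Y(t)=e^{A_nt}Y(0)+\int_0^te^{A_n(t-s)}\left[BU(s)+e^{A_nD}\mathfrak d(s)\right]ds,\qquad t\ge0.$$
   Context: Let $\ell,d,D>0$, $I=(0,\ell)$, $\Omega=I\times(0,d)$, $X=L^2(I)$, $\epsilon_1,\epsilon_2,\bar\epsilon_2>0$. The coefficients $\alpha_1,\lambda_2\in L^\infty(I\times\mathbb R_+)$ and $\alpha_2,\lambda_1\in L^\infty(\Omega\times\mathbb R_+)$ are real-valued; $g\in L^\infty(I)$ with $|\{g\ne0\}|>0$. The underlying system is $$\partial_tu=\epsilon_1\partial_{xx}u+\alpha_1u-\int_0^d\lambda_1\partial_xv\,dy+g\,U(\cdot,t-D)\ \text{ on } I,\qquad \partial_tv=\epsilon_2\partial_{xx}v+\bar\epsilon_2\partial_{yy}v+\alpha_2v-\lambda_2\partial_xu\ \text{ on }\Omega,$$ with $u(0,t)=u(\ell,t)=0$, homogeneous Neumann conditions for $v$ on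 $\partial\Omega$, $(u,v)(0)=(u_0,v_0)\in\mathcal H:=L^2(I)\times L^2(\Omega)$, and $U=U_0\in L^2(-D,0;X)$ on $(-D,0)$. Let $(C_{12}(t)v)(x)=\int_0^d\lambda_1(x,y,t)\partial_xv(x,y)\,dy$. With $\bar\alpha_1\in L^\infty(I;\mathbb R)$ fixed, $A_n\phi=\epsilon_1\phi_{xx}+\bar\alpha_1\phi$ on $X$, $D(A_n)=H^2(I)\cap H_0^1(I)$ (generator of an analytic semigroup), $(B\psi)(x)=g(x)\psi(x)$, and $$\mathfrak d(t)=(\alpha_1(\cdot,t)-\bar\alpha_1)u(t)-C_{12}(t)v(t),$$ the first equation of the system reads $\dot u=A_nu+BU(t-D)+\mathfrak d$. The transport state is $z(s,t)=U(t-D+s)$, $s\in(0,D)$. Energy solutions are those with $U\in L^2_{\rm loc}([-D,\infty);X)$ and, for every $T>0$, $(u,v)\in L^2(0,T;\mathcal V)\cap H^1(0,T;\mathcal V')\cap C([0,T];\mathcal H)$, where $\mathcal V=H^1_0(I)\times H^1(\Omega)$, satisfying the system with its boundary and initial conditions in the standard variational sense for the Gelfand triple $\mathcal V\hookrightarrow\mathcal H\hookrightarrow\mathcal V'$; for such solutions $z(s,t)=U(t-D+s)$ for a.e. $s$. *)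

(* Defs.v *)
From HB Require Import structures.
From mathcomp Require Import all_boot all_order all_algebra.
From mathcomp Require Import all_classical all_reals all_analysis.
From mathcomp Require Import measurable_realfun ess_sup_inf.

Set Implicit Arguments.
Unset Strict Implicit.
Unset Printing Implicit Defensive.
Import Order.TTheory GRing.Theory Num.Theory.
Import numFieldNormedType.Exports.

Local Open Scope classical_set_scope.
Local Open Scope ring_scope.

(* the normed space structure of the quotient type [LspaceType mu p1] *)
Section Lspace_normed.
Context d (T : measurableType d) (R : realType).
Variables (mu : {measure set T -> \bar R}) (p : \bar R) (p1 : (1 <= p)%E).
Implicit Types (F G : LfunType mu p1) (f g h : LspaceType mu p1).

Lemma Lnorm_ae_eq (f g : T -> R) :
  measurable_fun setT f -> measurable_fun setT g -> f = g %[ae mu] ->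
  Lnorm mu p (EFin \o f) = Lnorm mu p (EFin \o g).
Proof.
move=> mf mg fg; rewrite unlock /Lnorm.
case: p p1 => [r r1||//].
- have mh (h : T -> R) : measurable_fun setT h ->
    measurable_fun setT (fun x => `|(EFin \o h) x| `^ r)%E.
    move=> mh; apply: (@measurableT_comp _ _ _ _ _ _ (fun x => x `^ r)%E) => //=.
      exact: (measurableT_comp (measurable_poweR _)).
    by apply: measurableT_comp => //; apply: measurableT_comp => //; exact: mh.
  congr poweR; apply: ae_eq_integral => //; [exact: mh..|].
  by apply: filterS fg => x + _ => /(_ I) /= ->.
- move=> _; case: ifPn => // _; apply: eq_ess_sup.
  by apply: filterS fg => x /(_ I) /= ->.
Qed.

Lemma Lspace_Lfun f : (repr (LebesgueSpace.sort f) : T -> R) \in Lfun mu p.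
Proof.
rewrite inE /=; apply/andP; split; rewrite inE.
- exact: (@measurable_funPT _ _ _ _ (repr (LebesgueSpace.sort f))).
- exact: Lebesgue_finite.
Qed.

Definition Lrepr f : LfunType mu p1 := Lfun_Sub p1 (Lspace_Lfun f).

(* [R] and [measurableTypeR R] carry the same measurable sets, at different displays *)
Let mfunF F : {mfun T >-> measurableTypeR R} :=
  MeasurableFun.Pack (MeasurableFun.Class
    (isMeasurableFun.Build _ _ T (measurableTypeR R) F
      (@measurable_funPT _ _ _ _ (F : {mfun T >-> R})))).

Let cls F : {mfun_ mu, T >-> measurableTypeR R} :=
  \pi_({mfun_ mu, T >-> measurableTypeR R})%qT (mfunF F).

Let cls_ae F : repr (cls F) = F %[ae mu].
Proof.
have : (repr (cls F) == mfunF F %[mod {mfun_ mu, T >-> measurableTypeR R}])%qT.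
  by rewrite reprK.
by rewrite eqmodE => /asboolP.
Qed.

Let cls_finite F : finite_norm mu p (cls F).
Proof.
rewrite /finite_norm (@Lnorm_ae_eq _ F); last exact: cls_ae.
- exact: Lfunction_finite.
- exact: (@measurable_funPT _ _ _ _ (repr (cls F))).
- exact: measurable_funPT.
Qed.

Definition Lclass F : LspaceType mu p1 :=
  LebesgueSpace.Pack (LebesgueSpace.Class (isFinLebesgue.Build _ _ _ _ _ p1 _ (cls_finite F))).

Lemma LclassK F : Lrepr (Lclass F) = F %[ae mu].
Proof. exact: cls_ae. Qed.

Lemma Lspace_eqP f g : f = g <-> Lrepr f = Lrepr g %[ae mu].
Proof.
split=> [->|fg]; first exact: ae_eq_refl.
case: f g fg => [f [[f0]]] [g [[g0]]] /= fg.
have : f = g.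
  have : (repr f == repr g %[mod {mfun_ mu, T >-> measurableTypeR R}])%qT.
    by rewrite eqmodE; apply/asboolP.
  by rewrite !reprK => /eqP.
move=> fg'; subst g; by rewrite (Prop_irrelevance f0 g0).
Qed.

Lemma LreprK f : Lclass (Lrepr f) = f.
Proof. by apply/Lspace_eqP; exact: LclassK. Qed.

Lemma Lclass_eqP F G : Lclass F = Lclass G <-> F = G %[ae mu].
Proof.
split => [/Lspace_eqP FG|FG].
- apply: ae_eq_trans (ae_eq_sym (LclassK F)) _.
  exact: ae_eq_trans FG (LclassK G).
- apply/Lspace_eqP; apply: ae_eq_trans (LclassK F) _.
  exact: ae_eq_trans FG (ae_eq_sym (LclassK G)).
Qed.

HB.instance Definition _ := gen_eqMixin (LspaceType mu p1).
HB.instance Definition _ := gen_choiceMixin (LspaceType mu p1).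

Definition Ladd f g := Lclass (Lrepr f + Lrepr g).
Definition Lopp f := Lclass (- Lrepr f).
Definition Lscale (a : R) f := Lclass (a *: Lrepr f).

Lemma LaddE F G : Ladd (Lclass F) (Lclass G) = Lclass (F + G).
Proof.
apply/Lclass_eqP.
apply: filterS2 (LclassK F) (LclassK G) => x FE GE _.
by change (Lrepr (Lclass F) x + Lrepr (Lclass G) x = F x + G x); rewrite FE ?GE.
Qed.

Lemma LoppE F : Lopp (Lclass F) = Lclass (- F).
Proof.
apply/Lclass_eqP; apply: filterS (LclassK F) => x FE _.
by change (- Lrepr (Lclass F) x = - F x); rewrite FE.
Qed.

Lemma LscaleE a F : Lscale a (Lclass F) = Lclass (a *: F).
Proof.
apply/Lclass_eqP; apply: filterS (LclassK F) => x FE _.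
by change (a * Lrepr (Lclass F) x = a * F x); rewrite FE.
Qed.

Let LaddA : associative Ladd.
Proof.
by move=> f g h; rewrite -(LreprK f) -(LreprK g) -(LreprK h) !LaddE addrA.
Qed.
Let LaddC : commutative Ladd.
Proof. by move=> f g; rewrite /Ladd addrC. Qed.
Let Ladd0 : left_id (Lclass 0) Ladd.
Proof. by move=> f; rewrite -(LreprK f) LaddE add0r. Qed.
Let LaddN : left_inverse (Lclass 0) Lopp Ladd.
Proof. by move=> f; rewrite -(LreprK f) LoppE LaddE addNr. Qed.

HB.instance Definition _ :=
  GRing.isZmodule.Build (LspaceType mu p1) LaddA LaddC Ladd0 LaddN.

Let LscaleA a b f : Lscale a (Lscale b f) = Lscale (a * b) f.
Proof. by rewrite -(LreprK f) !LscaleE scalerA. Qed.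
Let Lscale1 : left_id 1 Lscale.
Proof. by move=> f; rewrite -(LreprK f) LscaleE scale1r. Qed.
Let LscaleDr : right_distributive Lscale +%R.
Proof.
move=> a f g; rewrite -(LreprK f) -(LreprK g).
by rewrite -[X in Lscale a X]/(Ladd _ _) -[RHS]/(Ladd _ _) LaddE !LscaleE LaddE scalerDr.
Qed.
Let LscaleDl f : {morph Lscale^~ f : a b / a + b}.
Proof.
move=> a b; rewrite -(LreprK f).
by rewrite -[RHS]/(Ladd _ _) !LscaleE LaddE scalerDl.
Qed.

HB.instance Definition _ := GRing.Zmodule_isLmodule.Build R (LspaceType mu p1)
  LscaleA Lscale1 LscaleDr LscaleDl.

Definition Lspace_norm f : R := fine (Lnorm mu p (EFin \o Lrepr f)).

Lemma Lspace_normE F :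
  Lspace_norm (Lclass F) = fine (Lnorm mu p (EFin \o F)).
Proof.
congr fine; apply: Lnorm_ae_eq; [exact: measurable_funPT..|exact: LclassK].
Qed.

Let LnormD f g : Lspace_norm (f + g) <= Lspace_norm f + Lspace_norm g.
Proof.
rewrite -(LreprK f) -(LreprK g) -[X in Lspace_norm X <= _]/(Ladd _ _) LaddE.
by rewrite !Lspace_normE; exact: ler_LnormD.
Qed.
Let LnormZ' a f : Lspace_norm (a *: f) = `|a| * Lspace_norm f.
Proof.
rewrite -(LreprK f) -[X in Lspace_norm X = _]/(Lscale _ _) LscaleE.
by rewrite !Lspace_normE; apply: EFin_inj;
   rewrite EFinM !finite_norm_fine; exact: LnormZ.
Qed.
Let Lnorm_eq0 f : Lspace_norm f = 0 -> f = 0.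
Proof.
rewrite -(LreprK f) Lspace_normE => /fine_Lnormr_eq0 f0.
by apply/Lclass_eqP.
Qed.

HB.instance Definition _ := Lmodule_isNormed.Build R (LspaceType mu p1)
  LnormD LnormZ' Lnorm_eq0.

End Lspace_normed.

Notation L2 mu := (LspaceType mu (lee1n 2)).

Section toL2.
Context d (T : measurableType d) (R : realType).
Variable mu : {measure set T -> \bar R}.

(* the class of a square-integrable function; by convention 0 on other functions *)
Definition toL2 (f : T -> R) : L2 mu :=
  match pselect (f \in Lfun mu 2%:R%:E) with
  | left h => Lclass (Lfun_Sub (lee1n 2) h)
  | right _ => 0
  end.

Definition ip (f h : L2 mu) : R := \int[mu]_x (Lrepr f x * Lrepr h x).

Definition mulL2 (a : T -> R) (f : L2 mu) : L2 mu :=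
  toL2 (fun x => a x * Lrepr f x).

End toL2.

Arguments mulL2 {d T R} mu a f.

Section leb.
Context (R : realType).

Definition leb (i : interval R) : set (measurableTypeR R) -> \bar R :=
  mrestr (@lebesgue_measure R) (measurable_itv i).

HB.instance Definition _ i := Measure.on (leb i).

Lemma leb_sigma_finite i : sigma_finite setT (leb i).
Proof.
have [F UF mF] := sigma_finiteT (@lebesgue_measure R).
exists F => // k; have [mFk Fk] := mF k; split => //.
apply: le_lt_trans Fk; apply: le_measure; rewrite ?inE //.
by apply: measurableI => //; exact: measurable_itv.
Qed.

HB.instance Definition _ i :=
  Measure_isSigmaFinite.Build _ _ _ (leb i) (leb_sigma_finite i).

End leb.

Section bochner.
Context d (T : measurableType d) (R : realType) (E : normedModType R).
Variable mu : {measure set T -> \bar R}.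

(* a list of pairs (A, c) stands for the simple function \sum \1_A *: c *)
Definition is_simple (s : seq (set T * E)) :=
  forall p, p \in s -> measurable p.1 /\ (mu p.1 < +oo)%E.

Definition simple_fun (s : seq (set T * E)) (t : T) : E :=
  \sum_(p <- s) (\1_(p.1) t : R) *: p.2.

Definition simple_integral (s : seq (set T * E)) : E :=
  \sum_(p <- s) fine (mu p.1) *: p.2.

(* the a.e. convergence is also part of [is_bochner]: the integral of a
   non-measurable nonnegative function is only a lower integral *)
Definition strongly_measurable (f : T -> E) :=
  exists s : nat -> seq (set T * E), (forall n, is_simple (s n)) /\
    \forall t \ae mu, (fun n => simple_fun (s n) t) @ \oo --> f t.

Definition is_bochner (f : T -> E) (w : E) :=
  exists s : nat -> seq (set T * E),
    [/\ forall n, is_simple (s n),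
        \forall t \ae mu, (fun n => simple_fun (s n) t) @ \oo --> f t,
        (fun n => \int[mu]_t (`|f t - simple_fun (s n) t|)%:E)%E @ \oo --> 0%E &
        (fun n => simple_integral (s n)) @ \oo --> w].

Definition bochner_integrable (f : T -> E) := exists w, is_bochner f w.

Definition bochner (f : T -> E) : E := xget 0 [set w | is_bochner f w].

Definition bochner_L2 (f : T -> E) :=
  strongly_measurable f /\ (\int[mu]_t (`|f t| ^+ 2)%:E < +oo)%E.

End bochner.

Section semigroup.
Context (R : realType) (E : normedModType R).

Record C0_semigroup (S : R -> E -> E) : Prop := {
  C0_linear : forall t, 0 <= t -> linear (S t);
  C0_bounded : forall t, 0 <= t -> continuous (S t);
  C0_id : forall x, S 0 x = x;
  C0_add : forall s t, 0 <= s -> 0 <= t -> forall x, S (s + t) x = S s (S t x);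
  C0_strong : forall x, (fun t => S t x) @ 0^'+ --> x }.

(* (dom, A) is the infinitesimal generator of S *)
Definition generator (S : R -> E -> E) (dom : set E) (A : E -> E) :=
  forall x y, ((fun h => h^-1 *: (S h x - x)) @ 0^'+ --> y) <->
              (dom x /\ y = A x).

End semigroup.

Section test_functions.
Context (R : realType).

Definition test1 (i : interval R) (f : R -> R) :=
  (forall n x, derivable (derive1n n f) x 1) /\
  exists K : set R, [/\ compact K, K `<=` [set` i] & forall x, ~ K x -> f x = 0].

(* the derivative in the first variable ([false]) or the second one ([true]) *)
Definition partial (b : bool) (f : R * R -> R) : R * R -> R :=
  fun p => 'D_(if b then (0, 1) else (1, 0)) f p.

Definition test2 (i j : interval R) (f : R * R -> R) :=
  (forall (s : seq bool) p, differentiable (foldr partial f s) p) /\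
  exists K : set (R * R),
    [/\ compact K, K `<=` [set` i] `*` [set` j] & forall p, ~ K p -> f p = 0].

End test_functions.

Section sobolev.
Context (R : realType) (ell d : R).

Definition muI : {measure set (measurableTypeR R) -> \bar R} :=
  leb `]0, ell[.
Definition muO : {measure
    set (measurableTypeR R * measurableTypeR R)%type -> \bar R} :=
  (leb `]0%R, ell[%R \x leb `]0%R, d[%R)%E.

Definition weak_deriv (w w' : L2 muI) := forall f, test1 `]0, ell[ f ->
  \int[muI]_x (Lrepr w x * derive1 f x) = - \int[muI]_x (Lrepr w' x * f x).

Definition H1I (w : L2 muI) := exists w', weak_deriv w w'.

(* the weak derivative is unique; it is used on H^1 only *)
Definition wD (w : L2 muI) : L2 muI := xget 0 [set w' | weak_deriv w w'].

(* closure of the test functions in H^1 *)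
Definition H10 (w : L2 muI) := H1I w /\
  exists f : nat -> R -> R,
    [/\ forall n, test1 `]0, ell[ (f n),
        (fun n => toL2 muI (f n)) @ \oo --> w &
        (fun n => toL2 muI (derive1 (f n))) @ \oo --> wD w].

Definition H2I (w : L2 muI) := H1I w /\ H1I (wD w).

Definition weak_partial (b : bool) (w w' : L2 muO) :=
  forall f, test2 `]0, ell[ `]0, d[ f ->
  \int[muO]_p (Lrepr w p * partial b f p) = - \int[muO]_p (Lrepr w' p * f p).

Definition H1O (w : L2 muO) := forall b, exists w', weak_partial b w w'.

Definition pD (b : bool) (w : L2 muO) : L2 muO :=
  xget 0 [set w' | weak_partial b w w'].

Definition inV (p : L2 muI * L2 muO) := H10 p.1 /\ H1O p.2.

Definition normV2 (p : L2 muI * L2 muO) : R :=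
  `|p.1| ^+ 2 + `|wD p.1| ^+ 2
  + `|p.2| ^+ 2 + `|pD false p.2| ^+ 2 + `|pD true p.2| ^+ 2.

(* strong measurability into V is that of the graph of the weak derivatives,
   V being isometric to a closed subspace of a product of L^2 spaces *)
Definition L2V (T : R) (u : R -> L2 muI) (v : R -> L2 muO) :=
  [/\ \forall t \ae leb `]0, T[, inV (u t, v t),
      bochner_L2 (leb `]0, T[) u,
      bochner_L2 (leb `]0, T[) (fun t => wD (u t)),
      bochner_L2 (leb `]0, T[) v &
      forall b, bochner_L2 (leb `]0, T[) (fun t => pD b (v t))].

(* elements of V' are functionals of which only the values on V matter *)
Definition linear_onV (w : L2 muI * L2 muO -> R) := forall (a : R) p q,
  inV p -> inV q -> w (a *: p + q) = a * w p + w q.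

Definition dual_norm (w : L2 muI * L2 muO -> R) : \bar R :=
  ereal_sup [set (`|w p|)%:E | p in [set p | inV p /\ normV2 p <= 1]].

(* square-integrable functions with values in V'; V' is separable, so that strong and weak measurability agree *)
Definition L2V' (T : R) (w : R -> L2 muI * L2 muO -> R) :=
  [/\ \forall t \ae leb `]0, T[, linear_onV (w t),
      forall p, inV p -> strongly_measurable (leb `]0, T[) (fun t => w t p) &
      (\int[leb `]0%R, T[%R]_t (dual_norm (w t) * dual_norm (w t)) < +oo)%E].

(* w is the distributional time derivative of (u, v), as a V'-valued function *)
Definition time_deriv (T : R) (u : R -> L2 muI) (v : R -> L2 muO)
    (w : R -> L2 muI * L2 muO -> R) :=
  forall p f, inV p -> test1 `]0, T[ f ->
  \int[leb `]0, T[]_t ((ip (u t) p.1 + ip (v t) p.2) * derive1 f t) =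
  - \int[leb `]0, T[]_t (w t p * f t).

End sobolev.

(* alpha1' and eps2' stand for \bar\alpha_1 and \bar\epsilon_2; the arguments of
   the coefficients are (x, t) for alpha1 and lambda2, and ((x, y), t) for alpha2
   and lambda1 *)
Section system.
Context (R : realType) (ell d D eps1 eps2 eps2' : R).
Context (alpha1 lambda2 : R * R -> R) (alpha2 lambda1 : R * R * R -> R).
Context (g alpha1' : R -> R).
Local Notation X := (L2 (muI ell)).
Local Notation Y := (L2 (muO ell d)).
Implicit Types (u : R -> X) (v : R -> Y) (U : R -> X) (z : R -> R -> X).

Definition C12 (t : R) (w : Y) : X := toL2 (muI ell)
  (fun x => \int[leb `]0, d[]_y (lambda1 (x, y, t) * Lrepr (pD false w) (x, y))).

Definition Bop : X -> X := mulL2 (muI ell) g.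

Definition domAn : set X := [set w | H2I w /\ H10 w].

Definition An (w : X) : X := eps1 *: wD (wD w) + mulL2 (muI ell) alpha1' w.

(* at the times t, of measure 0, for which the slice at t of a coefficient is not
   essentially bounded, the products below may be the default value of [toL2] *)
Definition dterm u v (t : R) : X :=
  mulL2 (muI ell) (fun x => alpha1 (x, t) - alpha1' x) (u t) - C12 t (v t).

(* obtained by testing the system with (p.1, p.2) in H^1_0(I) * H^1(Omega) and
   integrating by parts; the Neumann condition on v is the natural one *)
Definition energy_form (t : R) (u : X) (v : Y) (Ud : X) (p : X * Y) : R :=
  - eps1 * ip (wD u) (wD p.1)
  + \int[muI ell]_x (alpha1 (x, t) * Lrepr u x * Lrepr p.1 x)
  - ip (C12 t v) p.1
  + ip (Bop Ud) p.1
  - eps2 * ip (pD false v) (pD false p.2)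
  - eps2' * ip (pD true v) (pD true p.2)
  + \int[muO ell d]_q (alpha2 (q, t) * Lrepr v q * Lrepr p.2 q)
  - \int[muO ell d]_q (lambda2 (q.1, t) * Lrepr (wD u) q.1 * Lrepr p.2 q).

Record energy_solution (u0 : X) (v0 : Y) (U0 : R -> X) u v U : Prop := {
  energy_input : forall T, 0 < T -> bochner_L2 (leb `](- D), T[) U;
  energy_history : \forall t \ae leb `](- D), 0[, U t = U0 t;
  energy_L2V : forall T, 0 < T -> L2V T u v;
  energy_continuous : forall T, 0 < T ->
    {within `[0, T], continuous (fun t => (u t, v t))};
  energy_initial : u 0 = u0 /\ v 0 = v0;
  energy_equation : forall T, 0 < T -> exists w,
    [/\ L2V' T w, time_deriv T u v w &
        \forall t \ae leb `]0, T[, forall p, inV p ->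
          w t p = energy_form t (u t) (v t) (U (t - D)) p] }.

Record classical_transport z U : Prop := {
  transport_C1 : exists zs zt : R -> R -> X,
    [/\ {within `[0, D] `*` `]0, +oo[, continuous (fun q : R * R => z q.1 q.2)},
        {within `[0, D] `*` `]0, +oo[, continuous (fun q : R * R => zs q.1 q.2)},
        {within `[0, D] `*` `]0, +oo[, continuous (fun q : R * R => zt q.1 q.2)} &
        forall s t, 0 < s < D -> 0 < t ->
          [/\ is_derive s 1 (fun r => z r t) (zs s t),
              is_derive t 1 (fun r => z s r) (zt s t) &
              zt s t = zs s t]];
  transport_inflow : forall t, 0 < t -> z D t = U t;
  transport_outflow : forall t, 0 < t -> z 0 t = U (t - D) }.

Definition classical_shoreline u v z := forall t, 0 < t ->
  [/\ domAn (u t), H1O (v t) &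
      is_derive t 1 u (An (u t) + Bop (z 0 t) + dterm u v t)].

Definition predictor_integrand (S : R -> X -> X) z (t s : R) : X :=
  S (D - s) (Bop (z s t)).

Definition predictor (S : R -> X -> X) u z (t : R) : X :=
  S D (u t) + bochner (leb `]0, D[) (predictor_integrand S z t).

End system.

(* Main.v *)
Require Import Defs.
From mathcomp Require Import all_boot all_order all_algebra.
From mathcomp Require Import all_classical all_reals all_analysis.
From mathcomp Require Import measurable_realfun ess_sup_inf.
From HB Require Import structures.
From mathcomp Require Import ring lra.
Import Order.TTheory GRing.Theory Num.Theory.
Import numFieldNormedType.Exports.
Local Open Scope classical_set_scope.
Local Open Scope ring_scope.

(* [A_n] is symmetric on its domain, hence the semigroup it generates is
   self-adjoint and [A_n] is its own adjoint: [x] lies in the domain, with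
   [A_n x = y], as soon as [<x, A_n phi> = <y, phi>] for all [phi] in the domain.

   Classical solutions: the input part [J(t)] of [Y] satisfies
   [J' = \int_0^D e^{A_n(D-s)} B z_t = \int_0^D e^{A_n(D-s)} B z_s], and pairing [J]
   with [A_n phi] and integrating [d/ds <B z(s), e^{A_n(D-s)} phi>] over [(0, D)] gives
   [A_n J = J' - B z(D) + e^{A_n D} B z(0)].

   Energy solutions: testing the weak formulation with a function of [t] times
   [phi], in the limit of trapezoidal functions of [t], gives
   [<u(b) - u(a), phi> = \int_a^b <u, A_n phi> + <F, phi>], where
   [F = B U(. - D) + d]. Along [phi = e^{A_n(t-s)} psi] these increments telescope to
   the variation of constants formula for [u]. The formula for [Y] follows by
   translating the delayed input to [(-D, t-D)] and splitting the integral of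
   [e^{A_n(t-r)} B U(r)] over [(-D, t)] first at [t-D], then at [0]. *)

Set Implicit Arguments.
Unset Strict Implicit.
Unset Printing Implicit Defensive.

(** * Bochner integrals *)

(** Vector integrals are handled through [isB]: at every precision, one simple function close in an
    upper L^1 distance certifies the value. Existence comes from [AL1], the L^1-closure of the
    simple functions, and from the completeness of L^2. Two obstacles shape the rest. The
    coefficients are only bounded and measurable in time, so the multiplication operators need not
    depend continuously on time; integrability is proved for each fixed vector by a monotone class
    argument and carried to moving vectors by the uniform bound on the operators. And [u] is only
    weakly differentiable, so no product rule is at hand for [<u(s), e^{A_n(t-s)} psi>]; on short
    intervals one factor is frozen at a time, with an error of at most [e] times the length plus the
    integral of [|F|], up to constants, which survives summation and vanishes with [e].
    Self-adjointness takes the place of exchanging the unbounded [A_n] with a Bochner integral: all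
    unboundedness falls on a test vector in the domain. *)

Section simple.
Context d (T : measurableType d) (R : realType).
Variable mu : {measure set T -> \bar R}.
Implicit Types E : normedModType R.

(** The integral of a nonnegative function is a supremum over the simple functions below it,
    measurable or not; the norms integrated below are in general measurable only after a change on a
    null set. *)
Lemma ge0_le_lower_integral (f g : T -> \bar R) :
  (forall t, 0 <= f t)%E -> (forall t, f t <= g t)%E ->
  (\int[mu]_t f t <= \int[mu]_t g t)%E.
Proof.
move=> f0 fg.
have g0 t : (0 <= g t)%E by exact: le_trans (f0 t) (fg t).
rewrite !ge0_integralTE//; apply: le_ereal_sup => _ [h hf <-].
by exists h => // t; exact: le_trans (hf t) (fg t).
Qed.

Lemma simple_fun_cons E (p : set T * E) s t :
  simple_fun (p :: s) t = (\1_(p.1) t : R) *: p.2 + simple_fun s t.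
Proof. by rewrite /simple_fun big_cons. Qed.

Lemma simple_fun_cat E (s1 s2 : seq (set T * E)) t :
  simple_fun (s1 ++ s2) t = simple_fun s1 t + simple_fun s2 t.
Proof. by rewrite /simple_fun big_cat. Qed.

Lemma simple_integral_cat E (s1 s2 : seq (set T * E)) :
  simple_integral mu (s1 ++ s2) = simple_integral mu s1 + simple_integral mu s2.
Proof. by rewrite /simple_integral big_cat. Qed.

Lemma is_simple_cat E (s1 s2 : seq (set T * E)) :
  is_simple mu s1 -> is_simple mu s2 -> is_simple mu (s1 ++ s2).
Proof.
by move=> h1 h2 p; rewrite mem_cat => /orP[/h1|/h2].
Qed.

Lemma is_simple_cons E (p : set T * E) s :
  is_simple mu (p :: s) <-> [/\ measurable p.1, (mu p.1 < +oo)%E & is_simple mu s].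
Proof.
split=> [h|[mp fp h] q].
  have [] := h p (mem_head _ _); split=> // q qs.
  by apply: h; rewrite inE qs orbT.
by rewrite inE => /predU1P[->//|/h].
Qed.

Definition simple_map E E' (L : E -> E') (s : seq (set T * E)) :=
  [seq (p.1, L p.2) | p <- s].

Lemma is_simple_map E E' (L : E -> E') s :
  is_simple mu s -> is_simple mu (simple_map L s).
Proof. by move=> h p /mapP[q qs ->]; exact: h. Qed.

Lemma simple_fun_map E E' (L : {linear E -> E'}) s t :
  simple_fun (simple_map L s) t = L (simple_fun s t).
Proof.
rewrite /simple_fun big_map linear_sum; apply: eq_bigr => p _ /=.
by rewrite linearZ.
Qed.

Lemma simple_integral_map E E' (L : {linear E -> E'}) s :
  simple_integral mu (simple_map L s) = L (simple_integral mu s).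
Proof.
rewrite /simple_integral big_map linear_sum; apply: eq_bigr => p _ /=.
by rewrite linearZ.
Qed.

Definition simple_restr E (B : set T) (s : seq (set T * E)) :=
  [seq (p.1 `&` B, p.2) | p <- s].

Lemma is_simple_restr E B (s : seq (set T * E)) : measurable B ->
  is_simple mu s -> is_simple mu (simple_restr B s).
Proof.
move=> mB h p /mapP[q /h[mq fq] ->] /=; split; first exact: measurableI.
apply: le_lt_trans fq; apply: le_measure; rewrite ?inE//.
exact: measurableI.
Qed.

Lemma simple_fun_restr E B (s : seq (set T * E)) t :
  simple_fun (simple_restr B s) t = (\1_B t : R) *: simple_fun s t.
Proof.
rewrite /simple_fun big_map scaler_sumr; apply: eq_bigr => p _ /=.
by rewrite indicI scalerA mulrC.
Qed.

(* no regularity of [G] is needed, a simple function taking finitely many values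
   on measurable sets *)
Lemma measurable_simple_fun E d' (T' : measurableType d') (G : E -> T') s :
  is_simple mu s -> measurable_fun setT (fun t => G (simple_fun s t)).
Proof.
elim: s G => [|p s IH] G.
  move=> _; rewrite (_ : (fun _ => _) = cst (G 0)); first exact: measurable_cst.
  by apply/funext => t; rewrite /simple_fun big_nil.
move/is_simple_cons => [mp _ hs].
rewrite (_ : (fun _ => _) =
    (fun t => if t \in p.1 then G (p.2 + simple_fun s t) else G (simple_fun s t))).
  apply: measurable_fun_if => //.
  - apply: (measurable_fun_bool true).
    by rewrite setTI (_ : _ @^-1` _ = p.1)//; apply/seteqP; split => t /=;
      [move=> /set_mem|move=> /mem_set].
  - apply: (measurable_funS (E := setT)) => //.
    exact: (IH (fun x => G (p.2 + x))).
  - by apply: (measurable_funS (E := setT)) => //; exact: (IH G).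
apply/funext => t; rewrite simple_fun_cons indicE.
by case: ifPn => _; rewrite ?scale1r// scale0r add0r.
Qed.

(** The sets of the list may overlap, so the triangle inequality cannot be applied term by term. In
    the induction [x] is the value already accumulated on [B]: the head splits [B] into its part in
    [p.1], where [p.2] joins [x], and its part outside, where [x] is unchanged. *)
Lemma simple_integral_le_on E (s : seq (set T * E)) x B :
  is_simple mu s -> measurable B -> (mu B < +oo)%E ->
  ((`|fine (mu B) *: x + simple_integral mu (simple_restr B s)|)%:E <=
   \int[mu]_(t in B) (`|x + simple_fun s t|)%:E)%E.
Proof.
elim: s x B => [|p s IH] x B.
  move=> _ mB fB; rewrite /simple_integral big_nil addr0.
  under eq_integral do rewrite /simple_fun big_nil addr0.
  rewrite integral_cst// normrZ ger0_norm ?fine_ge0// muleC EFinM fineK//.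
  by rewrite ge0_fin_numE.
move=> /is_simple_cons [mp fp hs] mB fB.
have fin A : measurable A -> (mu (B `&` A) < +oo)%E.
  move=> mA; apply: le_lt_trans fB; apply: le_measure; rewrite ?inE//.
  exact: measurableI.
have mBp : measurable (B `&` p.1) by exact: measurableI.
have mBp' : measurable (B `&` ~` p.1).
  by apply: measurableI => //; exact: measurableC.
have BE : B = (B `&` p.1) `|` (B `&` ~` p.1) by rewrite -setIUr setUCr setIT.
have dB : (B `&` p.1) `&` (B `&` ~` p.1) = set0.
  by rewrite setIACA setIid setICr setI0.
have fmu (A : set T) : measurable A ->
    fine (mu (A `&` B)) = fine (mu (A `&` (B `&` p.1)))
                        + fine (mu (A `&` (B `&` ~` p.1))).
  move=> mA; rewrite -fineD; last 2 first.
  - rewrite ge0_fin_numE//; apply: le_lt_trans (fin _ mp).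
    by apply: le_measure; rewrite ?inE//; exact: measurableI.
  - rewrite ge0_fin_numE//; apply: le_lt_trans (fin _ (measurableC mp)).
    by apply: le_measure; rewrite ?inE//; exact: measurableI.
  congr fine; rewrite {1}BE setIUr measureU//; try exact: measurableI.
  by rewrite setIACA dB setI0.
rewrite [in leRHS]BE ge0_integral_setU//; last 2 first.
- rewrite -BE; apply/measurable_EFinP; apply: (measurable_funS (E := setT)) => //.
  apply: (measurable_simple_fun (fun y => `|x + y|)).
  exact/is_simple_cons.
- by rewrite disj_set2E; apply/eqP.
have -> : (\int[mu]_(t in B `&` p.1) (`|x + simple_fun (p :: s) t|)%:E =
           \int[mu]_(t in B `&` p.1) (`|(x + p.2) + simple_fun s t|)%:E)%E.
  apply: eq_integral => t; rewrite inE => -[_ pt].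
  by rewrite simple_fun_cons indicE mem_set// scale1r addrA.
have -> : (\int[mu]_(t in B `&` ~` p.1) (`|x + simple_fun (p :: s) t|)%:E =
           \int[mu]_(t in B `&` ~` p.1) (`|x + simple_fun s t|)%:E)%E.
  apply: eq_integral => t; rewrite inE => -[_ pt].
  by rewrite simple_fun_cons indicE memNset// scale0r add0r.
apply: le_trans (leeD (IH (x + p.2) _ hs mBp (fin _ mp))
  (IH x _ hs mBp' (fin _ (measurableC mp)))).
rewrite -EFinD lee_fin; apply: le_trans (ler_normD _ _); rewrite le_eqVlt.
apply/orP; left; apply/eqP; congr (`| _ |).
have -> : simple_integral mu (simple_restr B (p :: s)) =
    fine (mu (B `&` p.1)) *: p.2 + simple_integral mu (simple_restr B s).
  by rewrite /simple_integral big_cons /= setIC.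
have -> : simple_integral mu (simple_restr B s) =
    simple_integral mu (simple_restr (B `&` p.1) s) +
    simple_integral mu (simple_restr (B `&` ~` p.1) s).
  rewrite /simple_integral !big_map -big_split /= big_seq [RHS]big_seq.
  apply: eq_bigr => q qs.
  by rewrite fmu ?scalerDl//; have [] := hs q qs.
have -> : fine (mu B) = fine (mu (B `&` p.1)) + fine (mu (B `&` ~` p.1)).
  by have := fmu _ measurableT; rewrite !setTI.
rewrite scalerDl scalerDr addrA [RHS]addrACA; congr (_ + _).
exact: addrAC.
Qed.

Lemma norm_simple_integral E (s : seq (set T * E)) : (mu setT < +oo)%E ->
  is_simple mu s ->
  ((`|simple_integral mu s|)%:E <= \int[mu]_t (`|simple_fun s t|)%:E)%E.
Proof.
move=> mufin hs; have := simple_integral_le_on 0 hs measurableT mufin.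
under eq_integral do rewrite add0r.
congr (_ <= _)%E; rewrite scaler0 add0r /simple_restr /simple_integral big_map.
by under eq_bigr do rewrite /= setIT.
Qed.

End simple.

Section bochner_theory.
Context d (T : measurableType d) (R : realType).
Variable mu : {measure set T -> \bar R}.
Implicit Types E : normedModType R.

(** [h] bounds the norm from above because the norm itself may fail to be measurable; being
    extended-valued, it can be infinite on a null set. *)
Definition l1close E (f g : T -> E) (e : R) := exists h : T -> \bar R,
  [/\ measurable_fun setT h, forall t, ((`|f t - g t|)%:E <= h t)%E &
      (\int[mu]_t h t <= e%:E)%E].

(* unlike [is_bochner], this measures the distance to simple functions by upper
   integrals, which makes it insensitive to null sets and to measurability *)
Definition isB E (f : T -> E) (w : E) := forall e, 0 < e ->
  exists s : seq (set T * E), [/\ is_simple mu s, l1close f (simple_fun s) e &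
    `|simple_integral mu s - w| <= e].

(** The L^1-closure of the simple functions: over a finite measure and with values in a complete
    space, the integrable functions. This form passes to limits, restrictions and time-dependent
    operators. *)
Definition AL1 E (f : T -> E) := forall e, 0 < e ->
  exists2 s : seq (set T * E), is_simple mu s & l1close f (simple_fun s) e.

Lemma l1close_refl E (f : T -> E) e : 0 <= e -> l1close f f e.
Proof.
move=> e0; exists (cst 0%E); split; first exact: measurable_cst.
  by move=> t; rewrite subrr normr0.
by rewrite integral0 lee_fin.
Qed.

Lemma l1close_sym E (f g : T -> E) e : l1close f g e -> l1close g f e.
Proof. by move=> [h [mh hfg ih]]; exists h; split=> // t; rewrite distrC. Qed.

Lemma l1close_le E (f g : T -> E) e e' : e <= e' -> l1close f g e -> l1close f g e'.
Proof.
by move=> ee [h [mh hfg ih]]; exists h; split=> //; apply: le_trans ih _; rewrite lee_fin.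
Qed.

Lemma l1close_ge0 E (f g : T -> E) h :
  (forall t, ((`|f t - g t|)%:E <= h t)%E) -> forall t, (0 <= h t)%E.
Proof. by move=> H t; apply: le_trans (H t); rewrite lee_fin. Qed.

Lemma l1closeD E (f g f' g' : T -> E) e e' :
  l1close f g e -> l1close f' g' e' ->
  l1close (fun t => f t + f' t) (fun t => g t + g' t) (e + e').
Proof.
move=> [h [mh hfg ih]] [h' [mh' hfg' ih']].
exists (fun t => h t + h' t)%E; split.
- exact: emeasurable_funD.
- move=> t; apply: le_trans (leeD (hfg t) (hfg' t)).
  by rewrite -EFinD lee_fin opprD addrACA ler_normD.
- rewrite ge0_integralD//; last 2 first.
  + by move=> t _; exact: l1close_ge0 hfg t.
  + by move=> t _; exact: l1close_ge0 hfg' t.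
  by rewrite EFinD leeD.
Qed.

Lemma l1close_trans E (f g k : T -> E) e e' :
  l1close f g e -> l1close g k e' -> l1close f k (e + e').
Proof.
move=> fg gk; have [h [mh hfg ih]] := l1closeD fg gk.
exists h; split=> // t; apply: le_trans (hfg t).
by rewrite opprD addrA addrK.
Qed.

Lemma l1close_comp E E' (f g : T -> E) (f' g' : T -> E') M e : 0 <= M ->
  (forall t, `|f' t - g' t| <= M * `|f t - g t|) ->
  l1close f g e -> l1close f' g' (M * e).
Proof.
move=> M0 H [h [mh hfg ih]]; exists (fun t => M%:E * h t)%E; split.
- exact: measurable_funeM.
- move=> t; apply: le_trans (lee_wpmul2l _ (hfg t)); rewrite ?lee_fin//.
- rewrite ge0_integralZl_EFin//; last by move=> t _; exact: l1close_ge0 hfg t.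
  by rewrite EFinM lee_wpmul2l.
Qed.

(** Where the almost everywhere bound may fail, the majorant is raised to [+oo]; this happens on a
    null set and leaves the integral unchanged. *)
Lemma l1close_bound E (f g : T -> E) h e :
  measurable_fun setT h -> (forall t, 0 <= h t)%E ->
  (\forall t \ae mu, (`|f t - g t|)%:E <= h t)%E ->
  (\int[mu]_t h t <= e%:E)%E -> l1close f g e.
Proof.
move=> mh h0 [N [mN muN subN]] ih.
exists (fun t => if t \in N then +oo else h t)%E.
have mN' : measurable_fun setT (fun t => t \in N).
  apply: (measurable_fun_bool true).
  by rewrite setTI (_ : _ @^-1` _ = N)//; apply/seteqP; split => t /=;
      [move=> /set_mem|move=> /mem_set].
have mh' : measurable_fun setT (fun t => if t \in N then +oo else h t)%E.
  by apply: measurable_fun_if => //; exact: (measurable_funS (E := setT)).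
split => //.
- move=> t; case: ifPn => [_|]; first by rewrite leey.
  rewrite notin_setE => Nt; apply: contrapT => H; apply: Nt; exact: subN.
- apply: le_trans ih; rewrite le_eqVlt; apply/orP; left; apply/eqP.
  apply: ge0_ae_eq_integral => //; first by move=> t _; case: ifP.
  exists N; split=> // t /= H; apply: contrapT => Nt; apply: H => _.
  by rewrite memNset.
Qed.

Lemma l1close_ae E (f f' g : T -> E) e : (\forall t \ae mu, f t = f' t) ->
  l1close f g e -> l1close f' g e.
Proof.
move=> ff' [h [mh hfg ih]]; apply: (@l1close_bound _ _ _ h) => //.
- exact: l1close_ge0 hfg.
- by apply: filterS ff' => t <-.
Qed.

Lemma isB_ae E (f f' : T -> E) w : (\forall t \ae mu, f t = f' t) ->
  isB f w -> isB f' w.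
Proof.
move=> ff' H e /H [s [hs fs sw]]; exists s; split=> //.
exact: l1close_ae ff' fs.
Qed.

Lemma AL1_ae E (f f' : T -> E) : (\forall t \ae mu, f t = f' t) ->
  AL1 f -> AL1 f'.
Proof.
move=> ff' H e /H [s hs fs]; exists s => //.
exact: l1close_ae ff' fs.
Qed.

Lemma AL1_lim E (f : T -> E) :
  (forall e, 0 < e -> exists2 g, AL1 g & l1close f g e) -> AL1 f.
Proof.
move=> H e e0; have e2 : 0 < e / 2 by rewrite divr_gt0.
have [g /(_ _ e2)[s hs gs] fg] := H _ e2.
by exists s => //; rewrite [e]splitr; exact: l1close_trans fg gs.
Qed.

Lemma AL1_simple E (s : seq (set T * E)) : is_simple mu s -> AL1 (simple_fun s).
Proof. by move=> hs e e0; exists s => //; apply: l1close_refl; exact: ltW. Qed.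

Lemma isB_simple E (s : seq (set T * E)) : is_simple mu s ->
  isB (simple_fun s) (simple_integral mu s).
Proof.
move=> hs e /ltW e0; exists s; split => //; first exact: l1close_refl.
by rewrite subrr normr0.
Qed.

Lemma isBD E (f g : T -> E) w w' : isB f w -> isB g w' ->
  isB (fun t => f t + g t) (w + w').
Proof.
move=> fw gw e e0; have e2 : 0 < e / 2 by rewrite divr_gt0.
have [s [hs fs sw]] := fw _ e2; have [s' [hs' fs' sw']] := gw _ e2.
exists (s ++ s'); split.
- exact: is_simple_cat.
- rewrite [e]splitr (_ : simple_fun _ = fun t => simple_fun s t + simple_fun s' t).
    exact: l1closeD.
  by apply/funext => t; rewrite simple_fun_cat.
- rewrite simple_integral_cat opprD addrACA [e]splitr.
  by apply: le_trans (ler_normD _ _) _; exact: lerD.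
Qed.

Lemma isB_linear E E' (L : {linear E -> E'}) M (f : T -> E) w :
  (forall x, `|L x| <= M * `|x|) -> isB f w -> isB (fun t => L (f t)) (L w).
Proof.
move=> LM fw e e0; pose M' := `|M| + 1.
have M0 : 0 < M' by rewrite ltr_wpDl.
have LM' x : `|L x| <= M' * `|x|.
  apply: le_trans (LM x) _; rewrite ler_wpM2r//.
  by apply: le_trans (ler_norm _) _; rewrite lerDl.
have [|s [hs fs sw]] := fw (e / M'); first by rewrite divr_gt0.
have eE : e = M' * (e / M') by rewrite mulrC divfK// gt_eqF.
exists (simple_map L s); split.
- exact: is_simple_map.
- rewrite eE; apply: l1close_comp fs; first exact: ltW.
  by move=> t; rewrite simple_fun_map -linearB; exact: LM'.
- rewrite simple_integral_map -linearB eE.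
  by apply: le_trans (LM' _) _; rewrite ler_wpM2l// ltW.
Qed.

Lemma AL1D E (f g : T -> E) : AL1 f -> AL1 g -> AL1 (fun t => f t + g t).
Proof.
move=> fw gw e e0; have e2 : 0 < e / 2 by rewrite divr_gt0.
have [s hs fs] := fw _ e2; have [s' hs' fs'] := gw _ e2.
exists (s ++ s'); first exact: is_simple_cat.
rewrite [e]splitr (_ : simple_fun _ = fun t => simple_fun s t + simple_fun s' t).
  exact: l1closeD.
by apply/funext => t; rewrite simple_fun_cat.
Qed.

Lemma AL1_restr E (B : set T) (f : T -> E) : measurable B -> AL1 f ->
  AL1 (fun t => (\1_B t : R) *: f t).
Proof.
move=> mB fw e e0; have [s hs fs] := fw _ e0.
exists (simple_restr B s); first exact: is_simple_restr.
rewrite -[e]mul1r; apply: l1close_comp fs => // t.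
rewrite simple_fun_restr -scalerBr normrZ ler_wpM2r// ger0_norm//.
Qed.

Hypothesis mufin : (mu setT < +oo)%E.

(** The source of uniqueness and of the norm bounds. For [s'] near [f], the list made of [s'] and of
    the opposite of [s] has a function of norm at most [h + h'], with [h'] of small integral, and
    its integral is the difference of the two integrals. *)
Lemma isB_close E (f : T -> E) w s h : isB f w -> is_simple mu s ->
  measurable_fun setT h -> (forall t, ((`|f t - simple_fun s t|)%:E <= h t)%E) ->
  ((`|w - simple_integral mu s|)%:E <= \int[mu]_t h t)%E.
Proof.
move=> fw hs mh fsh; apply/lee_addgt0Pr => _/posnumP[e].
have e2 : 0 < e%:num / 2 by rewrite divr_gt0.
have [s' [hs' [h' [mh' fsh' ih']] sw']] := fw _ e2.
have nonneg := l1close_ge0 fsh; have nonneg' := l1close_ge0 fsh'.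
pose op : {linear E -> E} := -%R.
have hs2 : is_simple mu (s' ++ simple_map op s).
  by apply: is_simple_cat => //; exact: is_simple_map.
have := norm_simple_integral mufin hs2.
rewrite simple_integral_cat simple_integral_map /=.
move=> H.
have {H} : ((`|simple_integral mu s' - simple_integral mu s|)%:E <=
    \int[mu]_t h t + (e%:num / 2)%:E)%E.
  apply: le_trans H _.
  apply: (@le_trans _ _ (\int[mu]_t (h t + h' t))%E); last first.
    by rewrite ge0_integralD//; apply: leeD.
  apply: ge0_le_lower_integral => [t|t]; first by rewrite lee_fin.
  rewrite simple_fun_cat simple_fun_map /= addeC.
  apply: le_trans (leeD (fsh' t) (fsh t)); rewrite -EFinD lee_fin.
  have -> : simple_fun s' t - simple_fun s t =
      (f t - simple_fun s t) - (f t - simple_fun s' t).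
    by rewrite opprB [RHS]addrC addrA subrK.
  by rewrite [leRHS]addrC; exact: ler_normB.
move=> H; rewrite [e%:num]splitr EFinD addeA.
apply: le_trans (leeD H (_ : ((`|simple_integral mu s' - w|)%:E <= (e%:num / 2)%:E)%E)).
  rewrite -EFinD lee_fin.
  have -> : w - simple_integral mu s = (simple_integral mu s' - simple_integral mu s) -
     (simple_integral mu s' - w) by rewrite opprB [RHS]addrC addrA subrK.
  exact: ler_normB.
by rewrite lee_fin.
Qed.

Lemma isB_unique E (f : T -> E) w w' : isB f w -> isB f w' -> w = w'.
Proof.
move=> fw fw'; apply/eqP; rewrite -subr_eq0 -normr_le0; apply/ler_addgt0Pl => e e0.
have e2 : 0 < e / 2 by rewrite divr_gt0.
have [s [hs [h [mh fsh ih]] sw]] := fw' _ e2.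
have := isB_close fw hs mh fsh => /le_trans/(_ ih); rewrite lee_fin => H.
rewrite addr0 [e]splitr -(subrK (simple_integral mu s) w) -addrA.
by apply: le_trans (ler_normD _ _) _; apply: lerD.
Qed.

Lemma isB_norm_le E (f : T -> E) w h : isB f w -> measurable_fun setT h ->
  (forall t, ((`|f t|)%:E <= h t)%E) -> ((`|w|)%:E <= \int[mu]_t h t)%E.
Proof.
move=> fw mh fh; have := @isB_close _ f w [::] h fw.
rewrite /simple_integral big_nil subr0; apply => //.
by move=> t; rewrite /simple_fun big_nil subr0.
Qed.

Lemma isB_norm_cst E (f : T -> E) w C : isB f w -> 0 <= C ->
  (\forall t \ae mu, `|f t| <= C) -> `|w| <= C * fine (mu setT).
Proof.
move=> fw C0 fC; have : l1close f (cst 0) (C * fine (mu setT)).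
  apply: (@l1close_bound _ _ _ (cst C%:E)) => //.
    by apply: filterS fC => t; rewrite subr0 lee_fin.
  by rewrite integral_cst// EFinM fineK// ge0_fin_numE.
move=> [h [mh fh ih]]; rewrite -lee_fin; apply: le_trans ih.
by apply: isB_norm_le fw mh _ => t; have := fh t; rewrite subr0.
Qed.

End bochner_theory.

Section complete.
Context d (T : measurableType d) (R : realType).
Variable mu : {measure set T -> \bar R}.
Hypothesis mufin : (mu setT < +oo)%E.

(** Simple approximations at distance [1 / (n + 1)] have integrals that form a Cauchy sequence, by
    [isB_close]. *)
Lemma AL1_isB (E : completeNormedModType R) (f : T -> E) :
  AL1 mu f -> exists w, isB mu f w.
Proof.
move=> fA.
have /choice[s Hs] : forall n : nat, exists s : seq (set T * E),
   is_simple mu s /\ l1close mu f (simple_fun s) (n.+1%:R^-1).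
  by move=> n; have [|s hs fs] := fA n.+1%:R^-1; [rewrite invr_gt0|exists s].
have dist n m : `|simple_integral mu (s n) - simple_integral mu (s m)| <=
    n.+1%:R^-1 + m.+1%:R^-1.
  have [hn fn] := Hs n; have [hm fm] := Hs m.
  have [h [mh nmh ih]] := l1close_trans (l1close_sym fn) fm.
  rewrite -lee_fin; apply: le_trans ih.
  have H := isB_close mufin (isB_simple hn); exact: H hm mh nmh.
have cau : cvg ((fun n => simple_integral mu (s n)) @ \oo).
  apply: cauchy_cvg; apply: cauchy_exP => e e0.
  have e2 : 0 < e / 2 by rewrite divr_gt0.
  have [N _ HN] := near_infty_natSinv_lt (PosNum e2).
  exists (simple_integral mu (s N)); exists N => // n /= Nn.
  rewrite -ball_normE /=; apply: le_lt_trans (dist N n) _.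
  by rewrite [e]splitr ltrD// HN//=.
exists (lim ((fun n => simple_integral mu (s n)) @ \oo)) => e e0.
have [N _ HN] := near_infty_natSinv_lt (PosNum e0).
have [M _ HM] := (@cvgr_distC_le _ _ _ _ _ _ _ cau) e e0.
exists (s (maxn N M)); have [hn fn] := Hs (maxn N M); split => //.
- apply: l1close_le fn; apply/ltW/HN; exact: leq_maxl.
- by apply: HM; exact: leq_maxr.
Qed.

End complete.

(** * Comparison with the sequential Bochner integral *)

Section bochner_link.
Context d (T : measurableType d) (R : realType).
Variable mu : {measure set T -> \bar R}.
Implicit Types E : normedModType R.

(** The errors [2^-(n+1)] are summable, so the sum of the majorants [h n] is integrable, hence
    finite almost everywhere; [h n t], bounded by a tail of it, tends to 0. This yields the
    pointwise convergence demanded by [is_bochner]. *)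
Lemma isB_is_bochner E (f : T -> E) w : isB mu f w -> is_bochner mu f w.
Proof.
move=> fw; pose e n : R := 1 / (2 ^ (n + 1))%:R.
have e0 n : 0 < e n by rewrite divr_gt0// ltr0n expn_gt0.
have e_sum : series e @ \oo --> (1 : R).
  by have := cvg_geometric_series_half (1 : R) 0; rewrite expr0 divr1.
have e_cvg : e @ \oo --> 0 by apply: cvg_series_cvg_0; apply/cvg_ex; exists 1.
have /choice[s Hs] : forall n : nat, exists s : seq (set T * E),
   [/\ is_simple mu s, l1close mu f (simple_fun s) (e n) &
       `|simple_integral mu s - w| <= e n] by move=> n; exact: fw.
have /choice[h Hh] : forall n : nat, exists h : T -> \bar R,
  [/\ measurable_fun setT h, forall t, ((`|f t - simple_fun (s n) t|)%:E <= h t)%E &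
      (\int[mu]_t h t <= (e n)%:E)%E] by move=> n; have [_ [h H] _] := Hs n; exists h.
have mh n : measurable_fun setT (h n) by have [] := Hh n.
have fh n t : ((`|f t - simple_fun (s n) t|)%:E <= h n t)%E by have [] := Hh n.
have h0 n t : (0 <= h n t)%E by apply: le_trans (fh n t); rewrite lee_fin.
exists s; split.
- by move=> n; have [] := Hs n.
- have : mu.-integrable setT (fun t => \sum_(n <oo) h n t)%E.
    apply/integrableP; split.
      by apply: ge0_emeasurable_sum.
    under eq_integral do rewrite gee0_abs ?nneseries_ge0//.
    rewrite integral_nneseries//.
    apply: (@le_lt_trans _ _ (\sum_(n <oo) (e n)%:E)%E).
      by apply: lee_nneseries => [n _ _|n _]; [exact: integral_ge0|have [] := Hh n].
    have : (fun n => \sum_(0 <= k < n) (e k)%:E)%E @ \oo --> (1%:E : \bar R).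
      under eq_cvg do rewrite sumEFin.
      by apply: cvg_EFin; [exact: nearW|exact: e_sum].
    by move/cvg_lim => ->//; rewrite ltry.
  move/integrable_ae => /(_ measurableT); apply: filterS => t /(_ I) fin.
  have lt : (\sum_(0 <= n <oo) h n t < +oo)%E.
    by move: fin; rewrite ge0_fin_numE// nneseries_ge0.
  have := nneseries_tail_cvg lt (fun n _ => h0 n t).
  move=> tail; apply/cvgrPdist_le => eps eps0.
  have /fine_cvgP [tfin /cvgrPdist_le/(_ _ eps0) tle] := tail.
  apply: filterS2 tfin tle => n tf; rewrite sub0r normrN => tl.
  rewrite -lee_fin; apply: le_trans (fh n t) _.
  apply: (@le_trans _ _ (\sum_(n <= k <oo) h k t)%E).
    by rewrite (@nneseries_split _ _ n 1)// addn1 big_nat1 leeDl// nneseries_ge0.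
  by rewrite -(fineK tf) lee_fin; apply: le_trans tl; exact: ler_norm.
- apply: (@squeeze_cvge _ _ _ _ (cst 0%E) _ (fun n => (e n)%:E)) => //.
  + apply: nearW => n; apply/andP; split; first exact: integral_ge0.
    have [_ _] := Hh n; apply: le_trans.
    by apply: ge0_le_lower_integral => // t; rewrite lee_fin.
  + exact: cvg_cst.
  + by apply: cvg_EFin => //; exact: nearW.
- apply/cvgrPdist_le => eps eps0.
  have /cvgrPdist_le/(_ _ eps0) := e_cvg; apply: filterS => n.
  rewrite sub0r normrN => H; rewrite distrC.
  by have [_ _ /le_trans] := Hs n; apply; apply: le_trans H; exact: ler_norm.
Qed.

(** Off [N] the norm is a limit of norms of simple functions; the value 0 on [N] makes it measurable
    everywhere. *)
Lemma strongly_measurable_norm E (f : T -> E) (g : seq (set T * E)) :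
  strongly_measurable mu f -> is_simple mu g ->
  exists N (h : T -> R), [/\ measurable N, mu N = 0%E, measurable_fun setT h,
    forall t, N t -> h t = 0 & forall t, ~ N t -> h t = `|f t - simple_fun g t|].
Proof.
move=> [s [hs [N [mN muN subN]]]] hg.
exists N, (fun t => if t \in N then 0 else `|f t - simple_fun g t|); split => //.
- have mN' : measurable_fun setT (fun t => t \in N).
    apply: (measurable_fun_bool true).
    by rewrite setTI (_ : _ @^-1` _ = N)//; apply/seteqP; split => t /=;
        [move=> /set_mem|move=> /mem_set].
  apply: (measurable_fun_cvg (h := fun n t => if t \in N then 0 else
      `|simple_fun (s n) t - simple_fun g t|)).
    move=> n; apply: measurable_fun_if => //.
    apply: (measurable_funS (E := setT)) => //.
    have := measurable_simple_fun (fun x : E => `|x|)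
      (is_simple_cat (hs n) (is_simple_map (L := -%R) hg)).
    congr (measurable_fun _ _); apply/funext => t.
    pose op : {linear E -> E} := -%R.
    by rewrite simple_fun_cat (simple_fun_map op).
  move=> t _; case: ifPn => [_|]; first exact: cvg_cst.
  rewrite notin_setE => Nt; apply: cvg_norm; apply: cvgB; last exact: cvg_cst.
  by apply: contrapT => H; apply: Nt; exact: subN.
- by move=> t Nt; rewrite mem_set.
- by move=> t Nt; rewrite memNset.
Qed.

(** For non-measurable integrands the integrals in [is_bochner] are lower ones. The measurable
    representative of the norm never exceeds it and agrees with it off a null set, so it is a
    majorant almost everywhere and its integral is small. *)
Lemma is_bochner_isB E (f : T -> E) w : is_bochner mu f w -> isB mu f w.
Proof.
move=> [s [hs fs ils iw]] e e0.
have /fine_cvgP [ilf /cvgrPdist_le/(_ _ e0) il] := ils.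
have /cvgrPdist_le/(_ _ e0) iwe := iw.
have [n [fn [iln iwn]]] : exists n, [/\ (\int[mu]_t (`|f t - simple_fun (s n) t|)%:E)%E \is a fin_num,
   `|0 - fine (\int[mu]_t (`|f t - simple_fun (s n) t|)%:E)%E| <= e &
   `|w - simple_integral mu (s n)| <= e].
  by near \oo => n; exists n; split; near: n.
have [N [h [mN muN mh hN hNn]]] := strongly_measurable_norm (ex_intro _ s (conj hs fs)) (hs n).
have h0 t : 0 <= h t.
  by have [/hN->//|/hNn->] := pselect (N t).
exists (s n); split => //; last by rewrite distrC.
apply: (@l1close_bound _ _ _ _ _ _ _ (EFin \o h)) => //.
- exact/measurable_EFinP.
- exists N; split => // t /= H; apply: contrapT => /hNn E0; apply: H.
  by rewrite E0.
- apply: (@le_trans _ _ (\int[mu]_t (`|f t - simple_fun (s n) t|)%:E)%E).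
    apply: ge0_le_lower_integral => t; rewrite ?lee_fin//=.
    by have [/hN->//|/hNn->] := pselect (N t).
  rewrite -(fineK fn) lee_fin; apply: le_trans (iln).
  by rewrite sub0r normrN; exact: ler_norm.
Unshelve. all: end_near. Qed.

Lemma isB_bochner E (f : T -> E) w : (mu setT < +oo)%E ->
  isB mu f w -> bochner mu f = w.
Proof.
move=> mufin fw; rewrite /bochner; case: xgetP => [y _ /= /is_bochner_isB fy|].
  by have H := isB_unique mufin fy fw; exact: H.
by move=> /(_ w) H; exfalso; apply: H; exact: isB_is_bochner.
Qed.

(** The simple functions converging to [f] need not be dominated. They are cut to the sets where
    they are at most [2 m]; dominated convergence then applies with the bound [3 m]. *)
Lemma dominated_AL1 E (f : T -> E) (m : T -> R) : strongly_measurable mu f ->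
  mu.-integrable setT (EFin \o m) ->
  (\forall t \ae mu, `|f t| <= m t) -> AL1 mu f.
Proof.
move=> smf im fm.
have [s [hs fs]] := smf.
have mm : measurable_fun setT m by have /integrableP[/measurable_EFinP] := im.
(* The factor 2 leaves room for convergence: where [f t] is nonzero, [simple_fun (s n) t] is
   eventually at most [2 |f t|] in norm; where [f t] vanishes, cutting only reduces the error. *)
pose B n := [set t | `|simple_fun (s n) t| <= 2 * m t].
have mB n : measurable (B n).
  rewrite (_ : B n = (fun t => `|simple_fun (s n) t| <= 2 * m t) @^-1` [set true])//.
  rewrite -[X in measurable X]setTI; apply: measurable_fun_ler => //.
  - exact: (measurable_simple_fun (fun x : E => `|x|)).
  - exact: measurable_funM.
pose g n := simple_restr (B n) (s n).
have hg n : is_simple mu (g n) by exact: is_simple_restr.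
have /choice[k Hk] : forall n, exists k : T -> R, measurable_fun setT k /\
    \forall t \ae mu, k t = `|f t - simple_fun (g n) t|.
  move=> n; have [N [h [mN muN mh hN hNn]]] := strongly_measurable_norm smf (hg n).
  by exists h; split => //; exists N; split => // t /= H; apply: contrapT => /hNn.
have kae : \forall t \ae mu, forall n, k n t = `|f t - simple_fun (g n) t|.
  by apply/ae_foralln => n; have [] := Hk n.
have k3 : \forall t \ae mu, forall n, `|k n t| <= 3 * m t.
  apply: filterS2 kae fm => t kt ft n; rewrite kt normr_id simple_fun_restr.
  apply: le_trans (ler_normB _ _) _.
  rewrite (_ : 3 = 1 + 2) ?nat1r// mulrDl mul1r lerD// normrZ indicE.
  case: (boolP (t \in B n)) => [/set_mem Bt|_]; first by rewrite normr1 mul1r.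
  by rewrite normr0 mul0r mulr_ge0//; exact: le_trans ft.
have kcvg : \forall t \ae mu, k ^~ t @ \oo --> 0.
  apply: filterS2 (filterI kae fm) fs => t [kt ft] st.
  have st0 : (fun n => `|f t - simple_fun (s n) t|) @ \oo --> 0.
    rewrite -(normr0 E) -(subrr (f t)); apply: cvg_norm.
    by apply: cvgB => //; exact: cvg_cst.
  apply: (squeeze_cvgr _ (cvg_cst 0) st0).
  have [f0|f0] := eqVneq (f t) 0.
    apply: nearW => n; rewrite kt normr_ge0/= f0 !sub0r !normrN simple_fun_restr normrZ.
    by rewrite ler_piMl// indicE; case: (_ \in _); rewrite ?normr1// normr0.
  have nf0 : 0 < `|f t| by rewrite normr_gt0.
  have /cvgrPdist_le/(_ _ nf0) := st; apply: filterS => n H.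
  rewrite kt normr_ge0 /= simple_fun_restr indicE mem_set ?scale1r//.
  rewrite /B /=; apply: (@le_trans _ _ (2 * `|f t|)); last by rewrite ler_pM2l.
  rewrite mulr_natl mulr2n -lerBlDr; apply: le_trans (lerB_dist _ _) _.
  by rewrite distrC.
have mk n : measurable_fun setT (EFin \o k n).
  by apply/measurable_EFinP; have [] := Hk n.
have kc0 : {ae mu, forall t, setT t -> (fun n => (EFin \o k n) t) @ \oo --> cst 0%E t}.
  by apply: filterS kcvg => t kt _; apply: cvg_EFin => //; exact: nearW.
have im3 : mu.-integrable setT (fun t => (3 * m t)%:E).
  by under eq_fun do rewrite EFinM; exact: integrableZl.
have km3 : {ae mu, forall t n, setT t -> (`|(EFin \o k n) t| <= (3 * m t)%:E)%E}.
  by apply: filterS k3 => t kt n _ /=; rewrite lee_fin.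
have [_ cv _] := dominated_convergence measurableT mk (measurable_cst _) kc0 im3 km3.
move=> e e0; have /fine_cvgP[cf /cvgrPdist_le/(_ _ e0) ce] := cv.
have [n [fn en]] : exists n, (\int[mu]_t `|(EFin \o k n) t - cst 0 t|)%E \is a fin_num /\
   `|0 - fine (\int[mu]_t `|(EFin \o k n) t - cst 0 t|)%E| <= e.
  by near \oo => n; exists n; split; near: n.
exists (g n) => //; apply: (@l1close_bound _ _ _ _ _ _ _ (fun t => `|(EFin \o k n) t|)%E).
- exact: measurableT_comp.
- by move=> t; exact: abse_ge0.
- by apply: filterS kae => t /(_ n) /= ->; rewrite normr_id.
- under eq_integral => t _ do rewrite -[X in `|X|%E]sube0.
  rewrite -(fineK fn) lee_fin; apply: le_trans en.
  by rewrite sub0r normrN; exact: ler_norm.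
Unshelve. all: end_near. Qed.

(** Over a finite measure, [1 + h^2] is an integrable majorant of [h]. *)
Lemma bochner_L2_AL1 E (f : T -> E) : (mu setT < +oo)%E ->
  bochner_L2 mu f -> AL1 mu f.
Proof.
move=> mufin [smf f2].
have hnil : is_simple mu ([::] : seq (set T * E)) by [].
have [N [h [mN muN mh hN hNn]]] := strongly_measurable_norm smf hnil.
have hE t : ~ N t -> h t = `|f t|.
  by move=> /hNn ->; rewrite /simple_fun big_nil subr0.
apply: (@dominated_AL1 _ _ (fun t => 1 + h t ^+ 2)) => //.
- apply/integrableP; split.
    by apply/measurable_EFinP; apply: measurable_funD => //; exact: measurable_funX.
  under eq_integral => t _ do rewrite /= ger0_norm ?addr_ge0 ?sqr_ge0// EFinD.
  rewrite ge0_integralD//; last 2 first.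
  + by move=> t _; rewrite lee_fin sqr_ge0.
  + by apply/measurable_EFinP; exact: measurable_funX.
  rewrite lte_add_pinfty// ?integral_cst ?mul1e//.
  apply: le_lt_trans f2; apply: ge0_le_lower_integral => t; rewrite lee_fin ?sqr_ge0//.
  by have [/hN->|/hE->//] := pselect (N t); rewrite expr0n sqr_ge0.
- exists N; split => // t /= H; apply: contrapT => /hE ht; apply: H.
  rewrite -ht; have := sqr_ge0 (h t - 1); nra.
Qed.

End bochner_link.

(** * Integrals over real intervals *)

Section measure_change.
Context d (T : measurableType d) (R : realType).
Implicit Types E : normedModType R.

Section mono.
Variables mu1 mu2 : {measure set T -> \bar R}.
Hypothesis mu12 : forall A, measurable A -> (mu1 A <= mu2 A)%E.

Lemma is_simple_mono E (s : seq (set T * E)) : is_simple mu2 s -> is_simple mu1 s.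
Proof.
move=> h p /h[mp fp]; split => //; exact: le_lt_trans (mu12 mp) fp.
Qed.

Lemma l1close_mono E (f g : T -> E) e : l1close mu2 f g e -> l1close mu1 f g e.
Proof.
move=> [h [mh fh ih]]; exists h; split => //; apply: le_trans ih.
apply: ge0_le_measure_integral => //; exact: l1close_ge0 fh.
Qed.

Lemma AL1_mono E (f : T -> E) : AL1 mu2 f -> AL1 mu1 f.
Proof.
move=> H e /H[s hs fs]; exists s; first exact: is_simple_mono.
exact: l1close_mono.
Qed.

Lemma ae_mono (P : T -> Prop) : (\forall t \ae mu2, P t) -> \forall t \ae mu1, P t.
Proof.
move=> [N [mN muN sub]]; exists N; split => //.
by apply/eqP; rewrite eq_le measure_ge0 andbT -muN mu12.
Qed.
End mono.

(** A simple function close to [f] for [mu] is close for both summands, by monotonicity in the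
    measure; its integral splits and the two errors add up to [e]. *)
Lemma isB_measureD (mu mu1 mu2 : {measure set T -> \bar R}) E (f : T -> E) w1 w2 :
  (mu setT < +oo)%E ->
  (forall A, measurable A -> mu A = (mu1 A + mu2 A)%E) ->
  AL1 mu f -> isB mu1 f w1 -> isB mu2 f w2 -> isB mu f (w1 + w2).
Proof.
move=> mufin muE fA f1 f2 e e0.
have le1 A : measurable A -> (mu1 A <= mu A)%E.
  by move=> mA; rewrite muE// leeDl.
have le2 A : measurable A -> (mu2 A <= mu A)%E.
  by move=> mA; rewrite muE// leeDr.
have [|s hs fs] := fA (e / 2); first by rewrite divr_gt0.
exists s; split => //.
  by apply: l1close_le fs; rewrite ler_pdivrMr// ler_peMr ?ler1n// ltW.
have -> : simple_integral mu s = simple_integral mu1 s + simple_integral mu2 s.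
  rewrite /simple_integral -big_split /= big_seq [RHS]big_seq.
  apply: eq_bigr => p /hs[mp fp]; rewrite muE// fineD ?scalerDl//.
    by rewrite ge0_fin_numE//; exact: le_lt_trans (le1 _ mp) fp.
  by rewrite ge0_fin_numE//; exact: le_lt_trans (le2 _ mp) fp.
rewrite opprD addrACA [e]splitr; apply: le_trans (ler_normD _ _) _.
apply: lerD; rewrite distrC -lee_fin.
- have [h [mh fh ih]] := l1close_mono le1 fs; apply: le_trans ih.
  apply: isB_close f1 _ mh fh; last exact: is_simple_mono hs.
  exact: le_lt_trans (le1 _ measurableT) mufin.
- have [h [mh fh ih]] := l1close_mono le2 fs; apply: le_trans ih.
  apply: isB_close f2 _ mh fh; last exact: is_simple_mono hs.
  exact: le_lt_trans (le2 _ measurableT) mufin.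
Qed.

End measure_change.

Section measure_image.
Context d d' (T : measurableType d) (T' : measurableType d') (R : realType).
Variables (mu : {measure set T -> \bar R}) (mu' : {measure set T' -> \bar R}).
Variable (phi : T -> T') (mphi : measurable_fun setT phi).
Hypothesis muE : forall A, measurable A -> mu' A = mu (phi @^-1` A).
Implicit Types E : normedModType R.

Let mpre A : measurable A -> measurable (phi @^-1` A).
Proof. by move=> mA; rewrite -[X in measurable X]setTI; exact: mphi. Qed.

Let pull E (s : seq (set T' * E)) := [seq (phi @^-1` p.1, p.2) | p <- s].

Let pull_simple E (s : seq (set T' * E)) : is_simple mu' s -> is_simple mu (pull s).
Proof.
by move=> h p /mapP[q /h[mq fq] ->]; split => /=; [exact: mpre|rewrite -muE].
Qed.

Let pull_funE E (s : seq (set T' * E)) : simple_fun (pull s) = simple_fun s \o phi.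
Proof. by apply/funext => t; rewrite /simple_fun big_map. Qed.

Let l1close_image E (f g : T' -> E) e :
  l1close mu' f g e -> l1close mu (f \o phi) (g \o phi) e.
Proof.
move=> [h [mh fh ih]]; exists (h \o phi); split.
- exact: measurableT_comp.
- by move=> t; exact: fh.
- apply: le_trans ih; rewrite le_eqVlt; apply/orP; left; apply/eqP.
  rewrite -[X in integral mu X]/(phi @^-1` setT) -ge0_integral_pushforward//.
    by apply: eq_measure_integral => A mA _; rewrite muE.
  by move=> y _; exact: l1close_ge0 fh y.
Qed.

Lemma AL1_image E (f : T' -> E) : AL1 mu' f -> AL1 mu (f \o phi).
Proof.
move=> H e /H[s hs fs]; exists (pull s); first exact: pull_simple.
by rewrite pull_funE; exact: l1close_image.
Qed.

Lemma isB_image E (f : T' -> E) w : isB mu' f w -> isB mu (f \o phi) w.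
Proof.
move=> H e /H[s [hs fs sw]]; exists (pull s); split; first exact: pull_simple.
  by rewrite pull_funE; exact: l1close_image.
congr (`| _ - _ | <= _) : sw; rewrite /simple_integral big_map big_seq [RHS]big_seq.
by apply: eq_bigr => p /hs[mp _]; rewrite /= muE.
Qed.

End measure_image.

Section leb_facts.
Context (R : realType).
Implicit Types E : normedModType R.

Lemma leb_le (i j : interval R) A : [set` i] `<=` [set` j] -> measurable A ->
  (leb i A <= leb j A)%E.
Proof.
move=> ij mA; rewrite /leb /mrestr; apply: le_measure; rewrite ?inE.
- by apply: measurableI => //; exact: measurable_itv.
- by apply: measurableI => //; exact: measurable_itv.
- exact: setIS.
Qed.

Lemma leb_setT (i : interval R) : leb i setT = lebesgue_measure [set` i].
Proof. by rewrite /leb /mrestr setTI. Qed.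

Lemma leb_itv_setT (a b : R) : a <= b -> leb `]a, b[ setT = (b - a)%:E.
Proof.
rewrite leb_setT lebesgue_measure_itv /= lte_fin le_eqVlt => /predU1P[->|->//].
by rewrite ltxx subrr.
Qed.

Lemma leb_fin (a b : R) : (leb `]a, b[ setT < +oo)%E.
Proof.
by rewrite leb_setT lebesgue_measure_itv /=; case: ifP => _; rewrite ltry.
Qed.

Lemma leb_ae_in (i : interval R) : \forall t \ae leb i, t \in i.
Proof.
exists (~` [set` i]); split => //.
- by apply: measurableC; exact: measurable_itv.
- by rewrite /leb /mrestr setICl measure0.
Qed.

(** Only the point [b] is missing from the union, and it is a null set. *)
Lemma leb_cat (a b c : R) A : a <= b <= c -> measurable A ->
  leb `]a, c[ A = (leb `]a, b[ A + leb `]b, c[ A)%E.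
Proof.
move=> /andP[ab bc] mA; rewrite /leb /mrestr -measureU; last 3 first.
- by apply: measurableI => //; exact: measurable_itv.
- by apply: measurableI => //; exact: measurable_itv.
- rewrite setIACA (_ : _ `&` [set` `]b, c[] = set0) ?setI0//.
  apply/seteqP; split => x //= []; rewrite !in_itv/= => /andP[_ xb] /andP[bx _].
  by have := lt_trans xb bx; rewrite ltxx.
rewrite -setIUr; have m1 (X : set R) : measurable X -> measurable (A `&` X).
  by move=> mX; exact: measurableI.
apply/eqP; rewrite eq_le; apply/andP; split.
  rewrite -[leRHS]adde0 -[in leRHS](lebesgue_measure_set1 b).
  apply: (@le_trans _ _ (lebesgue_measure
      (A `&` (`]a, b[ `|` `]b, c[) `|` [set b]))).
    apply: le_measure; rewrite ?inE.
    + by apply: m1; exact: measurable_itv.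
    + by apply: measurableU => //; apply: m1; apply: measurableU; exact: measurable_itv.
    + move=> x [Ax]; rewrite /= !in_itv/= => /andP[ax xc].
      have [xb|xb|->] := ltgtP x b; last by right.
        by left; split => //; left; rewrite ax.
      by left; split => //; right.
  by apply: measureU2 => //; apply: m1; apply: measurableU; exact: measurable_itv.
apply: le_measure; rewrite ?inE.
+ by apply: m1; apply: measurableU; exact: measurable_itv.
+ by apply: m1; exact: measurable_itv.
+ move=> x [Ax H]; split => //; move: H; rewrite /= !in_itv/=.
  by case=> /andP[h1 h2]; rewrite ?h1 ?h2/= ?(lt_le_trans h2 bc) ?(le_lt_trans ab h1).
Qed.

Lemma leb_shift (a b c : R) (A : set (measurableTypeR R)) : measurable A ->
  leb `](a + c), (b + c)[ A =
  leb `]a, b[ ((fun x : measurableTypeR R => x + c : measurableTypeR R) @^-1` A).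
Proof.
move=> mA; pose phi (x : measurableTypeR R) : measurableTypeR R := x + c.
have mphi : measurable_fun setT phi.
  by apply: measurable_funD.
rewrite /leb /mrestr.
have -> : phi @^-1` A `&` `]a, b[ = phi @^-1` (A `&` `](a + c), (b + c)[).
  rewrite preimage_setI; congr (_ `&` _); apply/seteqP; split => x;
    by rewrite /phi /= !in_itv/= !ltrD2r.
(* Translation invariance is checked on half-open intervals, which determine Lebesgue measure. *)
have E X : ocitv X -> lebesgue_measure X =
    pushforward (lebesgue_measure : {measure set (measurableTypeR R) -> \bar R}) phi X.
  move=> [[u v]] _ <-; rewrite /pushforward.
  have -> : phi @^-1` [set` `]u, v]] = [set` `](u - c), (v - c)]].
    by apply/seteqP; split => x; rewrite /phi /= !in_itv/= ltrBlDr lerBrDr.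
  rewrite lebesgue_measure_itv [RHS](lebesgue_measure_itv `](u - c), (v - c)])/= !lte_fin ltrD2r; case: ifP => // _.
  by rewrite -!EFinB; congr EFin; ring.
have mAI : measurable (A `&` [set` `](a + c), (b + c)[]).
  by apply: measurableI => //; exact: measurable_itv.
exact: (lebesgue_measure_unique E mAI).
Qed.

Lemma isB_shift E (a b c : R) (f : R -> E) w : isB (leb `](a + c), (b + c)[) f w ->
  isB (leb `]a, b[) (fun t => f (t + c)) w.
Proof.
apply: (@isB_image _ _ _ _ _ _ _ (fun x : measurableTypeR R => x + c : measurableTypeR R)).
  exact: measurable_funD.
by move=> A mA; exact: leb_shift.
Qed.

Lemma AL1_shift E (a b c : R) (f : R -> E) : AL1 (leb `](a + c), (b + c)[) f ->
  AL1 (leb `]a, b[) (fun t => f (t + c)).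
Proof.
apply: (@AL1_image _ _ _ _ _ _ _ (fun x : measurableTypeR R => x + c : measurableTypeR R)).
  exact: measurable_funD.
by move=> A mA; exact: leb_shift.
Qed.

Lemma isB_cat E (a b c : R) (f : R -> E) w1 w2 : a <= b <= c ->
  AL1 (leb `]a, c[) f -> isB (leb `]a, b[) f w1 -> isB (leb `]b, c[) f w2 ->
  isB (leb `]a, c[) f (w1 + w2).
Proof.
move=> abc; apply: isB_measureD; first exact: leb_fin.
by move=> A mA; exact: leb_cat.
Qed.

Lemma AL1_subitv E (i j : interval R) (f : R -> E) : [set` i] `<=` [set` j] ->
  AL1 (leb j) f -> AL1 (leb i) f.
Proof. by move=> ij; apply: AL1_mono => A mA; exact: leb_le. Qed.

Lemma ae_subitv (i j : interval R) (P : R -> Prop) : [set` i] `<=` [set` j] ->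
  (\forall t \ae leb j, P t) -> \forall t \ae leb i, P t.
Proof. by move=> ij; apply: ae_mono => A mA; exact: leb_le. Qed.

End leb_facts.

Section ae_tools.
Context d (T : measurableType d) (R : realType) (mu : {measure set T -> \bar R}).

Lemma aeS (P Q : T -> Prop) : (forall t, P t -> Q t) ->
  (\forall t \ae mu, P t) -> \forall t \ae mu, Q t.
Proof. exact: filterS. Qed.

Lemma aeS2 (P Q Q' : T -> Prop) : (forall t, P t -> Q t -> Q' t) ->
  (\forall t \ae mu, P t) -> (\forall t \ae mu, Q t) -> \forall t \ae mu, Q' t.
Proof. exact: filterS2. Qed.

Lemma aeS3 (P Q Q' Q'' : T -> Prop) : (forall t, P t -> Q t -> Q' t -> Q'' t) ->
  (\forall t \ae mu, P t) -> (\forall t \ae mu, Q t) ->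
  (\forall t \ae mu, Q' t) -> \forall t \ae mu, Q'' t.
Proof. exact: filterS3. Qed.

End ae_tools.

Lemma leb_aeW (R : realType) (i : interval R) (Q : R -> Prop) :
  (forall t, t \in i -> Q t) -> \forall t \ae leb i, Q t.
Proof. by move=> H; have := leb_ae_in i; apply: aeS => t; exact: H. Qed.

Section uniform_continuity.
Context (R : realType) (E : normedModType R).

(** Heine's theorem, over a pseudometric domain because it is applied both to intervals and to a
    compact rectangle of pairs [(s, t)]. *)
Lemma compact_unif_continuous (U : pseudoMetricType R) (K : set U) (f : U -> E) e :
  compact K -> {within K, continuous f} -> 0 < e ->
  exists2 dl, 0 < dl & forall x y, K x -> K y -> ball x dl y -> `|f x - f y| <= e.
Proof.
move=> /compact_near_coveringP Kc cf e0.
have := Kc R (0 : R)^'+ (fun dl x => K x -> forall y, K y -> ball x dl y -> `|f x - f y| <= e) _.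
move=> /(_ _).
have e2 : 0 < e / 2 by rewrite divr_gt0.
case.
  move=> x Kx; move/subspace_continuousP : cf => /(_ x Kx).
  move=> /cvgrPdist_le/(_ _ e2); rewrite near_withinE => /nbhs_ballP[r /= r0 Hr].
  have r2 : 0 < r / 2 by rewrite divr_gt0.
  near=> x' dl => Kx' y Ky x'y.
  have xx' : ball x (r / 2) x' by near: x'; exact: nbhsx_ballx.
  have dlr : dl <= r / 2 by near: dl; exact: nbhs_right_le.
  have h1 : `|f x - f x'| <= e / 2.
    by apply: Hr => //; apply: le_ball xx'; rewrite ler_pdivrMr// ler_peMr ?ler1n// ltW.
  have h2 : `|f x - f y| <= e / 2.
    apply: Hr => //; rewrite [r]splitr; apply: ball_triangle xx' _.
    exact: le_ball x'y.
  rewrite -(subrK (f x) (f x')) -addrA [e]splitr.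
  by apply: le_trans (ler_normD _ _) _; rewrite distrC lerD.
move=> dl /= dl0 H; exists (dl / 2); first by rewrite divr_gt0.
move=> x y Kx Ky xy; apply: (H (dl / 2)) => //=.
  by rewrite sub0r normrN ger0_norm ?divr_ge0 ?ltW// ltr_pdivrMr// ltr_pMr// ltr1n.
by rewrite divr_gt0.
Unshelve. all: end_near. Qed.

Lemma itv_unif_continuous (a b : R) (f : R -> E) e : {within `[a, b], continuous f} -> 0 < e ->
  exists2 dl, 0 < dl & forall x y, x \in `[a, b] -> y \in `[a, b] -> `|x - y| < dl ->
   `|f x - f y| <= e.
Proof.
move=> cf e0.
have [dl dl0 H] := compact_unif_continuous (@segment_compact R a b) cf e0.
by exists dl => // x y xab yab xy; apply: H => //; rewrite -ball_normE.
Qed.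

End uniform_continuity.

(** * Riemann sums and the fundamental theorem of calculus *)

Section steps.
Context (R : realType) (E : normedModType R).

(** The half-open cells are disjoint, so that a single value is active at each point; it is the
    value at the left end of the cell. *)
Definition step_seq (f : R -> E) (a h : R) (n : nat) : seq (set (measurableTypeR R) * E) :=
  [seq ([set` `](a + i%:R * h), (a + i.+1%:R * h)]], f (a + i%:R * h)) | i <- iota 0 n].

Lemma step_seqS f a h n t : simple_fun (step_seq f a h n.+1) t =
  simple_fun (step_seq f a h n) t +
  (\1_([set` `](a + n%:R * h), (a + n.+1%:R * h)]]) t : R) *: f (a + n%:R * h).
Proof.
rewrite /simple_fun /step_seq -[in iota _ _]addn1 iotaD map_cat big_cat /= add0n.
by rewrite big_cons big_nil addr0.
Qed.

Lemma step_seq_close (f : R -> E) a h e n : 0 < h ->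
  (forall x y, a <= y -> y <= x -> x <= a + n%:R * h -> x - y <= h ->
     `|f x - f y| <= e) ->
  forall t, (a < t <= a + n%:R * h -> `|f t - simple_fun (step_seq f a h n) t| <= e) /\
    (a + n%:R * h < t -> simple_fun (step_seq f a h n) t = 0).
Proof.
move=> h0; elim: n => [|n IH] H t.
  split; last by move=> _; rewrite /simple_fun big_nil.
  by rewrite mul0r addr0 => /andP[/lt_le_trans /[apply]]; rewrite ltxx.
have le1 : a + n%:R * h <= a + n.+1%:R * h by rewrite lerD2l ler_pM2r// ler_nat.
have [|IH1 IH2] := IH _ t.
  by move=> x y ay yx xn xy; apply: H => //; exact: le_trans le1.
rewrite step_seqS; split.
- move=> /andP[at' tn]; have [tn'|tn'] := leP t (a + n%:R * h).
    rewrite indicE memNset ?scale0r ?addr0; first by apply: IH1; rewrite at'.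
    by rewrite /= in_itv/= => /andP[]; rewrite ltNge tn'.
  rewrite IH2// add0r indicE mem_set ?scale1r; last by rewrite /= in_itv/= tn'.
  apply: H => //.
  - by rewrite lerDl mulr_ge0// ltW.
  - exact: ltW.
  - by rewrite lerBlDl; apply: le_trans tn _; rewrite -nat1r mulrDl mul1r [h + _]addrC addrA.
- move=> tn; rewrite IH2 ?add0r; last exact: le_lt_trans tn.
  rewrite indicE memNset ?scale0r//= in_itv/= => /andP[_].
  by rewrite leNgt tn.
Qed.

Lemma leb_step (a h : R) n (i : nat) : 0 < h -> (i < n)%N ->
  leb `]a, (a + n%:R * h)[ [set` `](a + i%:R * h), (a + i.+1%:R * h)]] = h%:E.
Proof.
move=> h0 ilt; pose b := a + n%:R * h.
have ai : a <= a + i%:R * h by rewrite lerDl mulr_ge0// ltW.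
have ib : a + i.+1%:R * h <= b by rewrite lerD2l ler_pM2r// ler_nat.
have hE : a + i.+1%:R * h - (a + i%:R * h) = h by rewrite -nat1r; ring.
have lti : a + i%:R * h < a + i.+1%:R * h by rewrite -subr_gt0 hE.
apply/eqP; rewrite eq_le; apply/andP; split.
- apply: (@le_trans _ _ (lebesgue_measure [set` `](a + i%:R * h), (a + i.+1%:R * h)]])).
    apply: le_measure; rewrite ?inE; [|exact: measurable_itv|exact: subIsetl].
    by apply: measurableI; exact: measurable_itv.
  by rewrite lebesgue_measure_itv/= lte_fin lti -EFinB hE.
- apply: (@le_trans _ _ (lebesgue_measure [set` `](a + i%:R * h), (a + i.+1%:R * h)[])).
    by rewrite lebesgue_measure_itv/= lte_fin lti -EFinB hE.
  apply: le_measure; rewrite ?inE.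
  + exact: measurable_itv.
  + by apply: measurableI; exact: measurable_itv.
  + move=> x; rewrite /= !in_itv/= => /andP[ix xi]; rewrite ix (ltW xi)/=.
    by rewrite (le_lt_trans ai ix)/= (lt_le_trans xi).
Qed.

Lemma simple_step_seq f a h n : 0 < h -> is_simple (leb `]a, (a + n%:R * h)[) (step_seq f a h n).
Proof.
move=> h0 p /mapP[i]; rewrite mem_iota add0n => /andP[_ ilt] -> /=; split.
  exact: measurable_itv.
by rewrite leb_step// ltry.
Qed.

Lemma step_seq_integral f a h n : 0 < h ->
  simple_integral (leb `]a, (a + n%:R * h)[) (step_seq f a h n) =
  \sum_(0 <= i < n) h *: f (a + i%:R * h).
Proof.
move=> h0; rewrite /simple_integral big_map /index_iota subn0 big_seq [RHS]big_seq.
apply: eq_bigr => i; rewrite mem_iota add0n => /andP[_ ilt].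
rewrite [(_, _).1]/= (_ : fine _ = h)//; exact: (congr1 fine (leb_step a h0 ilt)).
Qed.

(** The oscillation bound at the mesh size is returned as well, because [isB_FTC] compares the
    values at the left ends with mean values. *)
Lemma continuous_step (f : R -> E) a b e : a < b -> {within `[a, b], continuous f} ->
  0 < e -> exists n h, [/\ 0 < h, b = a + n%:R * h,
    forall x y, a <= y -> y <= x -> x <= b -> x - y <= h -> `|f x - f y| <= e
    & l1close (leb `]a, b[) f (simple_fun (step_seq f a h n)) (e * (b - a))].
Proof.
move=> ab cf e0; have [dl dl0 H] := itv_unif_continuous cf e0.
have ba : 0 < b - a by rewrite subr_gt0.
pose n := (Num.truncn ((b - a) / dl)).+1.
have nlt : (b - a) / dl < n%:R by exact: truncnS_gt.
pose h := (b - a) / n%:R.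
have h0 : 0 < h by rewrite divr_gt0.
have hdl : h < dl by rewrite /h ltr_pdivrMr// mulrC -ltr_pdivrMr.
have n0 : n%:R != 0 :> R by rewrite pnatr_eq0.
have bE : b = a + n%:R * h by rewrite /h mulrC divfK// addrC subrK.
have Hh x y : a <= y -> y <= x -> x <= b -> x - y <= h -> `|f x - f y| <= e.
  move=> ay yx xb xy; apply: H.
  - by rewrite in_itv/= xb (le_trans ay yx).
  - by rewrite in_itv/= ay (le_trans yx xb).
  - by rewrite ger0_norm ?subr_ge0//; exact: le_lt_trans hdl.
exists n, h; split => //.
have cl := @step_seq_close f a h e n h0.
apply: (@l1close_bound _ _ _ _ _ _ _ (cst e%:E)).
- exact: measurable_cst.
- by move=> t; rewrite lee_fin ltW.
- apply: leb_aeW => t; rewrite in_itv/= => /andP[at' tb].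
  have [|+ _] := cl _ t; first by rewrite -bE.
  by rewrite lee_fin; apply; rewrite at' -bE ltW.
- rewrite integral_cst// EFinM -(leb_itv_setT (ltW ab)); exact: lexx.
Qed.

Lemma continuous_AL1 (f : R -> E) a b : {within `[a, b], continuous f} ->
  AL1 (leb `]a, b[) f.
Proof.
move=> cf e e0; have [ab|ba] := ltP a b; last first.
  exists [::] => //; apply: (@l1close_bound _ _ _ _ _ _ _ (cst 0%E)) => //.
    apply: leb_aeW => t; rewrite in_itv/= => /andP[at' tb].
    by have := lt_le_trans (lt_trans at' tb) ba; rewrite ltxx.
  by rewrite integral0 lee_fin ltW.
have ba : 0 < b - a by rewrite subr_gt0.
have [n [h [h0 bE _ cl]]] := continuous_step ab cf (divr_gt0 e0 ba).
exists (step_seq f a h n); first by rewrite bE; exact: simple_step_seq.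
by move: cl; rewrite divfK// gt_eqF.
Qed.

End steps.

(** By the mean value theorem the increment of [F] over a cell is [h * f c], and [f] varies by at
    most [e / (b - a)] on the cell; the increments telescope to [F b - F a]. *)
Lemma isB_FTC (R : realType) (F f : R -> R) a b : a <= b ->
  {within `[a, b], continuous F} -> {within `[a, b], continuous f} ->
  (forall x, x \in `]a, b[ -> is_derive x 1 F (f x)) ->
  isB (leb `]a, b[) f (F b - F a).
Proof.
rewrite le_eqVlt => /predU1P[<- _ _ _ e e0|ab cF cf Ff e e0].
  exists [::]; rewrite /simple_integral big_nil subrr subr0 normr0; split => //.
  - apply: (@l1close_bound _ _ _ _ _ _ _ (cst 0%E)) => //.
      apply: leb_aeW => t; rewrite in_itv/= => /andP[at' ta].
      by have := lt_trans at' ta; rewrite ltxx.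
    by rewrite integral0 lee_fin ltW.
  - exact: ltW.
have ba : 0 < b - a by rewrite subr_gt0.
have [n [h [h0 bE Hh cl]]] := continuous_step ab cf (divr_gt0 e0 ba).
exists (step_seq f a h n); split.
- by rewrite bE; exact: simple_step_seq.
- by move: cl; rewrite divfK// gt_eqF.
rewrite {1}bE step_seq_integral// {1}bE.
have -> : F (a + n%:R * h) - F a =
    \sum_(0 <= i < n) (F (a + i.+1%:R * h) - F (a + i%:R * h)).
  by rewrite (telescope_sumr (fun i => F (a + i%:R * h)))// mul0r addr0.
rewrite -sumrB.
apply: (@le_trans _ _ (\sum_(0 <= i < n) h * (e / (b - a)))); last first.
  have nh : n%:R * h = b - a by rewrite [X in X - _]bE addrC addKr.
  by rewrite sumr_const_nat subn0 -mulr_natl mulrA nh mulrC divfK// gt_eqF.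
apply: le_trans (ler_norm_sum _ _ _) _.
rewrite big_seq [leRHS]big_seq; apply: ler_sum => i.
rewrite mem_iota subn0 add0n => /andP[_ ilt].
have ai : a <= a + i%:R * h by rewrite lerDl mulr_ge0// ltW.
have ib : a + i.+1%:R * h <= b by rewrite bE lerD2l ler_pM2r// ler_nat.
have hE : a + i.+1%:R * h - (a + i%:R * h) = h by rewrite -nat1r; ring.
have lti : a + i%:R * h < a + i.+1%:R * h by rewrite -subr_gt0 hE.
have dF x : x \in `](a + i%:R * h), (a + i.+1%:R * h)[ -> is_derive x 1 F (f x).
  rewrite in_itv/= => /andP[ix xi]; apply: Ff.
  by rewrite in_itv/= (le_lt_trans ai ix) (lt_le_trans xi ib).
have cF' : {within `[(a + i%:R * h), (a + i.+1%:R * h)], continuous F}.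
  apply: continuous_subspaceW cF => x; rewrite /= !in_itv/= => /andP[ix xi].
  by rewrite (le_trans ai ix) (le_trans xi ib).
have [c] := MVT lti dF cF'.
rewrite in_itv/= => /andP[ic ci] ->; rewrite hE -[_ *: _]/(h * _) [f c * _]mulrC -mulrBr normrM gtr0_norm//.
rewrite ler_pM2l// distrC; apply: Hh => //.
- exact: ltW.
- exact: le_trans (ltW ci) ib.
- by rewrite -[leRHS]hE; apply: lerB => //; exact: ltW.
Qed.

(** * Comparison with the Lebesgue integral of real functions *)

Section scalar_link.
Import HBNNSimple.
Context d (T : measurableType d) (R : realType).
Variable mu : {measure set T -> \bar R}.

(** A simple function below one integrand, multiplied by the indicator of the complement of [N],
    lies below the other and has the same integral. *)
Lemma ae_eq_lower_integral (f g : T -> \bar R) :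
  (forall t, 0 <= f t)%E -> (forall t, 0 <= g t)%E ->
  (\forall t \ae mu, f t = g t) -> (\int[mu]_t f t = \int[mu]_t g t)%E.
Proof.
move=> f0 g0 [N [mN muN subN]].
have fgN t : ~ N t -> f t = g t by move=> Nt; apply: contrapT => H; apply: Nt; exact: subN.
suff le (h k : T -> \bar R) : (forall t, 0 <= h t)%E -> (forall t, 0 <= k t)%E ->
    (forall t, ~ N t -> h t = k t) -> (\int[mu]_t h t <= \int[mu]_t k t)%E.
  by apply/eqP; rewrite eq_le !le// => t /fgN.
move=> {f0 g0 fgN subN} h0 k0 hk.
rewrite !ge0_integralTE//; apply: ge_ereal_sup => _ [s hs <-].
apply: ereal_sup_ubound; exists (proj_nnsfun s (measurableC mN)).
  move=> t /=; rewrite mindicE; case: (boolP (t \in ~` N)) => [/set_mem Nt|_].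
    by rewrite mulr1 -hk.
  by rewrite mulr0.
rewrite -!integralT_nnsfun//; apply: ge0_ae_eq_integral => //.
  by apply/measurable_EFinP; exact: measurable_funPT.
  by apply/measurable_EFinP; exact: measurable_funPT.
  by move=> t _; rewrite lee_fin.
  by move=> t _; rewrite lee_fin.
exists N; split => // t /= H; apply: contrapT => Nt; apply: H => _.
by rewrite mindicE mem_set// mulr1.
Qed.

(** The bridge to the integrals of the weak formulation. Setting [f] to 0 on a null set makes it
    measurable and integrable; both integrals are then compared with that of a simple function. *)
Lemma isB_Rintegral (f : T -> R) w : (mu setT < +oo)%E ->
  isB mu f w -> \int[mu]_t f t = w.
Proof.
move=> mufin fw.
have [s [hs fs _ _]] := isB_is_bochner fw.
have [N [mN muN subN]] := fs.
pose g t := if t \in N then 0 else f t.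
have fg t : ~ N t -> f t = g t by move=> Nt; rewrite /g memNset.
have fgae : \forall t \ae mu, f t = g t.
  by exists N; split => // t /= H; apply: contrapT => /fg.
have mN' : measurable_fun setT (fun t => t \in N).
  apply: (measurable_fun_bool true).
  by rewrite setTI (_ : _ @^-1` _ = N)//; apply/seteqP; split => t /=;
      [move=> /set_mem|move=> /mem_set].
have mg : measurable_fun setT g.
  apply: (measurable_fun_cvg (h := fun n t => if t \in N then 0 else
      simple_fun (s n) t)).
    move=> n; apply: measurable_fun_if => //.
    apply: (measurable_funS (E := setT)) => //.
    exact: (measurable_simple_fun (fun x : R => x)).
  move=> t _; rewrite /g; case: ifPn => [_|]; first exact: cvg_cst.
  rewrite notin_setE => Nt.
  by apply: contrapT => H; apply: Nt; exact: subN.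
have gw := isB_ae fgae fw.
have gint : mu.-integrable setT (EFin \o g).
  apply/integrableP; split; first exact/measurable_EFinP.
  have [s1 [hs1 [h [mh gh ih]] _]] := gw 1 ltr01.
  have h0 := l1close_ge0 gh.
  have ms1 : measurable_fun setT (fun t => `|simple_fun s1 t|).
    exact: (measurable_simple_fun (fun x : R => `|x|) hs1).
  apply: (@le_lt_trans _ _ (\int[mu]_t (h t + (`|simple_fun s1 t|)%:E))%E).
    apply: ge0_le_lower_integral => t /=; first by rewrite lee_fin.
    apply: le_trans (leeD (gh t) (lexx _)); rewrite -EFinD lee_fin.
    by rewrite -{1}(subrK (simple_fun s1 t) (g t)) ler_normD.
  rewrite ge0_integralD//; last exact/measurable_EFinP.
  rewrite lte_add_pinfty//; first by apply: le_lt_trans ih _; rewrite ltry.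
  have [C HC] : exists C, forall t, `|simple_fun s1 t| <= C.
    elim: s1 {hs1 gh ms1} => [|p s1 [C HC]].
      by exists 0 => t; rewrite /simple_fun big_nil normr0.
    exists (`|p.2| + C) => t; rewrite simple_fun_cons.
    apply: le_trans (ler_normD _ _) (lerD _ (HC t)).
    by rewrite normrZ indicE; case: (_ \in _); rewrite ?normr1 ?mul1r// normr0 mul0r.
  apply: (@le_lt_trans _ _ (\int[mu]_t (cst C%:E t))%E).
    by apply: ge0_le_lower_integral => t; rewrite lee_fin.
  rewrite integral_cst// lte_mul_pinfty//.
  by rewrite lee_fin; apply: le_trans (HC point).
have -> : \int[mu]_t f t = \int[mu]_t g t.
  rewrite /Rintegral integralE [in RHS]integralE; congr (fine (_ - _)%E).
    apply: ae_eq_lower_integral => //; apply: filterS fgae => t ft.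
    by rewrite !funeposE ft.
  apply: ae_eq_lower_integral => //; apply: filterS fgae => t ft.
  by rewrite !funenegE ft.
have sint s1 : is_simple mu s1 -> mu.-integrable setT (EFin \o simple_fun s1) /\
    \int[mu]_t (simple_fun s1 t) = simple_integral mu s1.
  elim: s1 => [|p s1 IH].
    move=> _; rewrite (_ : simple_fun [::] = cst (0 : R)); last first.
      by apply/funext => t; rewrite /simple_fun big_nil.
    split; first exact: integrable0.
    by rewrite /simple_integral big_nil Rintegral_cst ?mul0r.
  move=> /is_simple_cons[mp fp /IH[i1 e1]].
  have -> : simple_fun (p :: s1) = (fun t => \1_(p.1) t * p.2) \+ simple_fun s1.
    by apply/funext => t; rewrite simple_fun_cons.
  have i0 : mu.-integrable setT (EFin \o (\1_(p.1) : T -> R)).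
    apply/integrableP; split; first by apply/measurable_EFinP; exact: measurable_indic.
    under eq_integral => t _ do rewrite /= ger0_norm//.
    by rewrite integral_indic// setIT.
  have i2 : mu.-integrable setT (EFin \o (fun t => \1_(p.1) t * p.2)).
    rewrite (_ : _ \o _ = fun t => ((\1_(p.1) t)%:E * (p.2)%:E)%E)//.
    exact: integrableZr.
  split; first exact: (integrableD measurableT i2 i1).
  rewrite RintegralD// e1 /simple_integral big_cons; congr (_ + _).
  rewrite RintegralZr//.
  by rewrite /Rintegral integral_indic// setIT.
apply/eqP; rewrite -subr_eq0 -normr_le0; apply/ler_addgt0Pl => e e0; rewrite addr0.
have e2 : 0 < e / 2 by rewrite divr_gt0.
have [s1 [hs1 [h [mh gh ih]] sw]] := gw _ e2.
have [si se] := sint _ hs1.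
rewrite [e]splitr -(subrK (simple_integral mu s1) (\int[mu]_t g t)) -addrA.
apply: le_trans (ler_normD _ _) (lerD _ sw).
rewrite -se -RintegralB// -lee_fin; apply: le_trans ih.
apply: (@le_trans _ _ (\int[mu]_t `|(g t - simple_fun s1 t)%:E|)%E); last first.
  by apply: ge0_le_lower_integral => t /=; [rewrite lee_fin|exact: gh].
have ib : mu.-integrable setT (EFin \o (fun t => g t - simple_fun s1 t)).
  exact: (integrableB measurableT gint si).
rewrite EFin_normr_Rintegral//; apply: le_abse_integral => //.
by have /integrableP[] := ib.
Qed.

End scalar_link.

Section operators.
Context d (T : measurableType d) (R : realType).
Variable mu : {measure set T -> \bar R}.
Implicit Types E : normedModType R.

Lemma AL1_op E E' (K : T -> E -> E') M (w : T -> E) : AL1 mu w ->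
  (\forall t \ae mu, linear (K t) /\ forall x, `|K t x| <= M * `|x|) ->
  (forall c, AL1 mu (fun t => K t c)) -> AL1 mu (fun t => K t (w t)).
Proof.
move=> wA Kb Kc; apply: AL1_lim => e e0; pose M' := `|M| + 1.
have M0 : 0 < M' by rewrite ltr_wpDl.
have [|s hs [h [mh wh ih]]] := wA (e / M'); first by rewrite divr_gt0.
have h0 := l1close_ge0 wh.
exists (fun t => \sum_(p <- s) (\1_(p.1) t : R) *: K t p.2).
  elim: s hs {h mh wh ih h0} => [|p s IH].
    move=> _; rewrite (_ : (fun _ => _) = simple_fun [::]).
      exact: AL1_simple.
    by apply/funext => t; rewrite big_nil /simple_fun big_nil.
  move/is_simple_cons => [mp fp /IH sA].
  have := AL1D (AL1_restr mp (Kc p.2)) sA; congr (AL1 _ _).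
  by apply/funext => t; rewrite big_cons.
apply: (@l1close_bound _ _ _ _ _ _ _ (fun t => M'%:E * h t)%E).
- exact: measurable_funeM.
- by move=> t; apply: mule_ge0 => //; rewrite lee_fin ltW.
- apply: filterS Kb => t [lK bK].
  pose L : {linear E -> E'} := HB.pack (K t) (GRing.isLinear.Build _ _ _ _ _ lK).
  have -> : \sum_(p <- s) (\1_(p.1) t : R) *: K t p.2 = L (simple_fun s t).
    by rewrite /simple_fun linear_sum; apply: eq_bigr => p _; rewrite linearZ.
  rewrite -[K t]/(L : E -> E') -linearB.
  apply: le_trans (lee_wpmul2l _ (wh t)); last by rewrite lee_fin ltW.
  rewrite -EFinM lee_fin; apply: le_trans (bK _) _; rewrite ler_wpM2r//.
  by apply: le_trans (ler_norm _) _; rewrite lerDl.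
- rewrite ge0_integralZl_EFin//; last exact: ltW.
  apply: le_trans (lee_wpmul2l _ ih) _; first by rewrite lee_fin ltW.
  by rewrite -EFinM mulrC divfK// gt_eqF.
Qed.

End operators.

Lemma AL1_linear d (T : measurableType d) (R : realType)
    (mu : {measure set T -> \bar R}) (E E' : normedModType R)
    (L : {linear E -> E'}) M (f : T -> E) :
  (forall x, `|L x| <= M * `|x|) -> AL1 mu f -> AL1 mu (fun t => L (f t)).
Proof.
move=> LM fA e e0; pose M' := `|M| + 1.
have M0 : 0 < M' by rewrite ltr_wpDl.
have LM' x : `|L x| <= M' * `|x|.
  apply: le_trans (LM x) _; rewrite ler_wpM2r//.
  by apply: le_trans (ler_norm _) _; rewrite lerDl.
have [|s hs fs] := fA (e / M'); first by rewrite divr_gt0.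
have eE : e = M' * (e / M') by rewrite mulrC divfK// gt_eqF.
exists (simple_map L s); first exact: is_simple_map.
rewrite eE; apply: l1close_comp fs; first exact: ltW.
by move=> t; rewrite simple_fun_map -linearB; exact: LM'.
Qed.

(** * Inner products and square-integrable functions *)

Section inner_product.
Context (R : realType) (E : normedModType R).

Record inner_product (ip : E -> E -> R) : Prop := {
  inner_sym : forall x y, ip x y = ip y x;
  inner_lin : forall a x y z, ip (a *: x + y) z = a * ip x z + ip y z;
  inner_norm : forall x, ip x x = `|x| ^+ 2 }.

Variable ip : E -> E -> R.
Hypothesis ipP : inner_product ip.

Lemma inner0l z : ip 0 z = 0.
Proof.
have := inner_lin ipP 1 0 0 z.
by rewrite scale1r addr0 mul1r => /eqP; rewrite addrC -subr_eq subrr eq_sym => /eqP.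
Qed.

Lemma innerDl x y z : ip (x + y) z = ip x z + ip y z.
Proof. by have := inner_lin ipP 1 x y z; rewrite scale1r mul1r. Qed.

Lemma innerZl a x z : ip (a *: x) z = a * ip x z.
Proof. by have := inner_lin ipP a x 0 z; rewrite addr0 inner0l addr0. Qed.

Lemma innerNl x z : ip (- x) z = - ip x z.
Proof. by rewrite -scaleN1r innerZl mulN1r. Qed.

Lemma innerBl x y z : ip (x - y) z = ip x z - ip y z.
Proof. by rewrite innerDl innerNl. Qed.

Lemma inner0r z : ip z 0 = 0.
Proof. by rewrite (inner_sym ipP) inner0l. Qed.

Lemma innerDr x y z : ip z (x + y) = ip z x + ip z y.
Proof. by rewrite !(inner_sym ipP z) innerDl. Qed.

Lemma innerZr a x z : ip z (a *: x) = a * ip z x.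
Proof. by rewrite !(inner_sym ipP z) innerZl. Qed.

Lemma innerNr x z : ip z (- x) = - ip z x.
Proof. by rewrite !(inner_sym ipP z) innerNl. Qed.

Lemma innerBr x y z : ip z (x - y) = ip z x - ip z y.
Proof. by rewrite innerDr innerNr. Qed.

Lemma inner_CS x y : `|ip x y| <= `|x| * `|y|.
Proof.
have [->|y0] := eqVneq y 0; first by rewrite inner0r !normr0 mulr0.
have ny : 0 < `|y| by rewrite normr_gt0.
(* The square of this norm expands to [|y|^2 (|x|^2 |y|^2 - <x, y>^2)]. *)
have := sqr_ge0 `|(`|y| ^+ 2) *: x - ip x y *: y|.
rewrite -(inner_norm ipP (_ - _)) innerBl !innerBr !innerZl !innerZr (inner_sym ipP y x).
rewrite !(inner_norm ipP) => H.
rewrite -(@ler_pXn2r _ 2) ?nnegrE ?mulr_ge0// real_normK ?num_real// exprMn.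
rewrite -subr_ge0 -(pmulr_rge0 _ (exprn_gt0 2 ny)).
by apply: le_trans H _; rewrite le_eqVlt; apply/orP; left; apply/eqP; ring.
Qed.

Lemma inner_le_norm x C : 0 <= C -> (forall y, `|ip x y| <= C * `|y|) -> `|x| <= C.
Proof.
move=> C0 H; have [->|x0] := eqVneq x 0; first by rewrite normr0.
have := H x; rewrite (inner_norm ipP) normrX normr_id expr2 ler_pM2r//.
by rewrite normr_gt0.
Qed.

Lemma inner_le_norm_dense (D : set E) x C : 0 <= C ->
  (forall y e, 0 < e -> exists2 z, D z & `|y - z| <= e) ->
  (forall y, D y -> `|ip x y| <= C * `|y|) -> `|x| <= C.
Proof.
move=> C0 Dd H; apply: inner_le_norm => // y; apply/ler_addgt0Pl => e e0.
(* Replacing [y] by [z] in the inequality costs at most [(|x| + C) |y - z|]. *)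
have k0 : 0 < `|x| + C + 1 by rewrite ltr_wpDl// addr_ge0.
have [z Dz yz] := Dd y (e / (`|x| + C + 1)) (divr_gt0 e0 k0).
have -> : y = z + (y - z) by rewrite addrC subrK.
rewrite innerDr; apply: le_trans (ler_normD _ _) _.
have h1 := H z Dz; have h2 := inner_CS x (y - z).
have h3 : `|z| <= `|z + (y - z)| + `|y - z|.
  by rewrite -{1}(addrK (y - z) z); exact: ler_normB.
have h4 : (`|x| + C) * `|y - z| <= e.
  apply: le_trans (ler_wpM2l _ yz) _; first by rewrite addr_ge0.
  rewrite mulrCA; apply: ler_piMr; first exact: ltW.
  by rewrite ler_pdivrMr// mul1r lerDl.
have h5 : C * `|z| <= C * `|z + (y - z)| + C * `|y - z| by rewrite -mulrDr ler_wpM2l.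
by rewrite mulrDl in h4; lra.
Qed.

Lemma inner_dense_inj (D : set E) x y :
  (forall y e, 0 < e -> exists2 z, D z & `|y - z| <= e) ->
  (forall z, D z -> ip x z = ip y z) -> x = y.
Proof.
move=> Dd H; apply/eqP; rewrite -subr_eq0 -normr_le0.
apply: (inner_le_norm_dense _ Dd) => // z Dz.
by rewrite innerBl H// subrr normr0 mul0r.
Qed.

(** Polarization reduces joint continuity to the continuity of addition and of the norm. *)
Lemma cvg_inner (T : Type) (F : set_system T) (FF : Filter F) (u v : T -> E) x y :
  u @ F --> x -> v @ F --> y -> (fun t => ip (u t) (v t)) @ F --> ip x y.
Proof.
move=> ux vy; rewrite (_ : (fun t => _) =
    (fun t => (`|u t + v t| ^+ 2 - `|u t - v t| ^+ 2) / 4)); last first.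
  apply/funext => t; rewrite -!(inner_norm ipP).
  rewrite innerBl innerDl !innerBr !innerDr (inner_sym ipP (v t)).
  by field.
have -> : ip x y = (`|x + y| ^+ 2 - `|x - y| ^+ 2) / 4.
  rewrite -!(inner_norm ipP) innerBl innerDl !innerBr !innerDr (inner_sym ipP y).
  by field.
apply: cvgM; last exact: cvg_cst.
have h1 := cvg_norm (cvgD ux vy); have h2 := cvg_norm (cvgB ux vy).
have sq (w : T -> R) (l : R) : w @ F --> l -> (fun t => w t ^+ 2) @ F --> l ^+ 2.
  move=> H; rewrite (_ : (fun t => _) = (fun t => w t * w t)); first exact: cvgM.
  by apply/funext => t; rewrite expr2.
exact: cvgB (sq _ _ (h1 _ _)) (sq _ _ (h2 _ _)).
Qed.

Definition inner_fun y (x : E) : R := ip x y.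

Lemma inner_fun_linear y : linear (inner_fun y).
Proof. by move=> a x z; rewrite /inner_fun (inner_lin ipP). Qed.

Lemma isB_inner d (T : measurableType d) (mu : {measure set T -> \bar R})
  (f : T -> E) w y : isB mu f w -> isB mu (fun t => ip (f t) y) (ip w y).
Proof.
pose L : {linear E -> R^o} := HB.pack (inner_fun y)
  (GRing.isLinear.Build _ _ _ _ _ (inner_fun_linear y)).
move=> fw; apply: (@isB_linear _ _ _ _ _ _ L `|y|) fw => x.
by rewrite mulrC; exact: inner_CS.
Qed.

Lemma AL1_inner d (T : measurableType d) (mu : {measure set T -> \bar R})
  (f : T -> E) y : AL1 mu f -> AL1 mu (fun t => ip (f t) y).
Proof.
pose L : {linear E -> R^o} := HB.pack (inner_fun y)
  (GRing.isLinear.Build _ _ _ _ _ (inner_fun_linear y)).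
move=> fA; apply: (@AL1_linear _ _ _ _ _ _ L `|y|) fA => x.
by rewrite mulrC; exact: inner_CS.
Qed.

End inner_product.

Section L2_space.
Context d (T : measurableType d) (R : realType) (mu : {measure set T -> \bar R}).
Implicit Types f g h : L2 mu.

Lemma Lfun2P (F : T -> R) : F \in Lfun mu 2%:R%:E <->
  measurable_fun setT F /\ (\int[mu]_x (F x ^+ 2)%:E < +oo)%E.
Proof.
split=> [FL|[mF iF]].
  split; first by move: FL; rewrite inE => /andP[/[!inE]].
  have /integrableP[_] := Lfun2_integrable_sqr FL; apply: le_lt_trans.
  apply: ge0_le_lower_integral => t; rewrite ?lee_fin ?sqr_ge0//=.
  exact: ler_norm.
rewrite inE; apply/andP; split; rewrite inE//=.
rewrite /finite_norm unlock; apply: poweR_lty; apply: le_lt_trans iF.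
apply: ge0_le_lower_integral => t; first exact: poweR_ge0.
by rewrite /= lee_fin powR_mulrn// real_normK ?num_real.
Qed.

Lemma measurable_Lrepr f : measurable_fun setT (Lrepr f : T -> R).
Proof. by have /Lfun2P[] := Lspace_Lfun f. Qed.

Lemma Lrepr_mul_integrable f g : mu.-integrable setT (EFin \o (fun x => Lrepr f x * Lrepr g x)).
Proof.
by apply/Lfun1_integrable; exact: (Lfun2_mul_Lfun1 (Lspace_Lfun f) (Lspace_Lfun g)).
Qed.

Lemma normL2_sqr f : (`|f| ^+ 2)%:E = (\int[mu]_x (Lrepr f x ^+ 2)%:E)%E.
Proof.
have <- : (\int[mu]_x (`|(EFin \o Lrepr f) x| `^ 2)%E = \int[mu]_x (Lrepr f x ^+ 2)%:E)%E.
  apply: eq_integral => x _ /=.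
  by rewrite powR_mulrn// real_normK ?num_real.
rewrite -poweR_Lnorm ?pnatr_eq0// -(finite_norm_fine (Lrepr f)) poweR_EFin.
by rewrite powR_mulrn ?fine_ge0 ?Lnorm_ge0.
Qed.

Lemma Lrepr_lin a f g : \forall x \ae mu,
  Lrepr (a *: f + g) x = a * Lrepr f x + Lrepr g x.
Proof.
apply: filterS2 (LclassK (Lrepr (a *: f) + Lrepr g)) (LclassK (a *: Lrepr f)).
move=> x /(_ I) h1 /(_ I) h2.
rewrite [LHS]h1 -[X in X = _]/(Lrepr (a *: f) x + Lrepr g x); congr (_ + _).
exact: h2.
Qed.

Lemma ae_Rintegral_eq (F G : T -> R) :
  measurable_fun setT F -> measurable_fun setT G ->
  (\forall x \ae mu, F x = G x) -> \int[mu]_x F x = \int[mu]_x G x.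
Proof.
move=> mF mG FG; congr fine; apply: ae_eq_integral => //.
- exact/measurable_EFinP.
- exact/measurable_EFinP.
- by apply: filterS FG => x + _ /= => ->.
Qed.

Lemma ip_inner : inner_product (@ip _ _ _ mu).
Proof.
split.
- by move=> f g; apply: eq_Rintegral => x _; rewrite mulrC.
- move=> a f g h.
  rewrite /ip (@ae_Rintegral_eq _ (fun x => a * (Lrepr f x * Lrepr h x) + Lrepr g x * Lrepr h x)).
  + rewrite RintegralD//; last 2 first.
    * have := integrableZl measurableT a (Lrepr_mul_integrable f h).
      by [].
    * exact: Lrepr_mul_integrable.
    by rewrite RintegralZl//; exact: Lrepr_mul_integrable.
  + by apply: measurable_funM; exact: measurable_Lrepr.
  + by apply: measurable_funD; repeat apply: measurable_funM => //; exact: measurable_Lrepr.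
  + apply: filterS (Lrepr_lin a f g) => x ->; ring.
- move=> f; apply: EFin_inj; rewrite normL2_sqr /ip /Rintegral fineK.
    by apply: eq_integral => x _; rewrite expr2.
  by have /integrable_fin_num := Lrepr_mul_integrable f f; exact.
Qed.

Lemma toL2K (F : T -> R) : F \in Lfun mu 2%:R%:E ->
  \forall x \ae mu, Lrepr (toL2 mu F) x = F x.
Proof.
move=> FL; rewrite /toL2; case: pselect => // h.
by apply: filterS (LclassK (Lfun_Sub (lee1n 2) h)) => x /(_ I).
Qed.

Lemma L2_eq_ae f g : (\forall x \ae mu, Lrepr f x = Lrepr g x) -> f = g.
Proof. by move=> H; apply/Lspace_eqP; apply: filterS H => x + _. Qed.

Lemma toL2_ae (F G : T -> R) : F \in Lfun mu 2%:R%:E -> G \in Lfun mu 2%:R%:E ->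
  (\forall x \ae mu, F x = G x) -> toL2 mu F = toL2 mu G.
Proof.
move=> FL GL FG; apply: L2_eq_ae.
by apply: filterS3 FG (toL2K FL) (toL2K GL) => x -> -> ->.
Qed.

Lemma norm_toL2_sqr (F : T -> R) : F \in Lfun mu 2%:R%:E ->
  (`|toL2 mu F| ^+ 2)%:E = (\int[mu]_x (F x ^+ 2)%:E)%E.
Proof.
move=> FL; rewrite normL2_sqr; apply: ae_eq_integral => //.
- by apply/measurable_EFinP; apply: measurable_funX; exact: measurable_Lrepr.
- by apply/measurable_EFinP; apply: measurable_funX; have /Lfun2P[] := FL.
- by apply: filterS (toL2K FL) => x -> _.
Qed.

Lemma ip_toL2r f (F : T -> R) : F \in Lfun mu 2%:R%:E ->
  ip f (toL2 mu F) = \int[mu]_x (Lrepr f x * F x).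
Proof.
move=> FL; apply: ae_Rintegral_eq.
- by apply: measurable_funM; exact: measurable_Lrepr.
- by apply: measurable_funM; [exact: measurable_Lrepr|have /Lfun2P[] := FL].
- by apply: filterS (toL2K FL) => x ->.
Qed.

Lemma ip_toL2l f (F : T -> R) : F \in Lfun mu 2%:R%:E ->
  ip (toL2 mu F) f = \int[mu]_x (F x * Lrepr f x).
Proof.
move=> FL; rewrite (inner_sym ip_inner) ip_toL2r//.
by apply: eq_Rintegral => x _; rewrite mulrC.
Qed.

Lemma L2B_sqr f g : (`|f - g| ^+ 2)%:E = (\int[mu]_x ((Lrepr f x - Lrepr g x) ^+ 2)%:E)%E.
Proof.
rewrite normL2_sqr; apply: ae_eq_integral => //.
- by apply/measurable_EFinP; apply: measurable_funX; exact: measurable_Lrepr.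
- by apply/measurable_EFinP; apply: measurable_funX; apply: measurable_funB; exact: measurable_Lrepr.
- have -> : f - g = (-1) *: g + f by rewrite scaleN1r addrC.
  by apply: filterS (Lrepr_lin (-1) g f) => x -> _; rewrite mulN1r addrC.
Qed.

End L2_space.

(** * Completeness of L^2 *)

Section L2_complete.
Context d (T : measurableType d) (R : realType) (mu : {measure set T -> \bar R}).

Lemma summable_diff_cvg (u : nat -> R) K :
  (forall n, 4 ^+ n * (u n.+1 - u n) ^+ 2 <= K) -> cvg (u @ \oo).
Proof.
move=> H; pose v n := u n.+1 - u n.
have vK n : `|v n| <= (K + 1) * 2^-1 ^+ n.
  have K1 : `|2 ^+ n * v n| <= K + 1.
    have h := H n; have h2 : (`|2 ^+ n * v n|) ^+ 2 <= K.
      by rewrite real_normK ?num_real// exprMn -exprM mulnC exprM -natrX.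
    have := sqr_ge0 (`|2 ^+ n * v n| - 1); nra.
  move: K1; rewrite normrM ger0_norm ?exprn_ge0// => K1.
  by rewrite exprVn ler_pdivlMr ?exprn_gt0// mulrC.
have cv : cvgn (series v).
  apply: (@normed_cvg _ R^o).
  apply: (@series_le_cvg _ _ (geometric (K + 1) 2^-1)).
  - by move=> n; exact: normr_ge0.
  - by move=> n; apply: le_trans (vK n).
  - exact: vK.
  - by apply: is_cvg_geometric_series; rewrite ger0_norm// invf_lt1// ltr1n.
have -> : u = (fun n => u 0%N + series v n).
  by apply/funext => n; rewrite /series /= telescope_sumr// addrC subrK.
by apply: is_cvgD cv; exact: is_cvg_cst.
Qed.

(** Riesz-Fischer: the series of [4^n (F (n+1) - F n)^2] has finite integral, so it is finite almost
    everywhere, and there the sequence converges. Fatou's lemma turns mutual distances into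
    distances to the limit. *)
Lemma L2_rapid_cauchy_cvg (x : nat -> L2 mu) :
  (forall n m, (n <= m)%N -> `|x m - x n| <= 2 * 4^-1 ^+ n) ->
  exists y : L2 mu, forall n, `|y - x n| <= 2 * 4^-1 ^+ n.
Proof.
move=> Hx; pose F n := Lrepr (x n) : T -> R.
have mF n : measurable_fun setT (F n) by exact: measurable_Lrepr.
pose a n t := (4 ^+ n * (F n.+1 t - F n t) ^+ 2)%:E : \bar R.
have a0 n t : (0 <= a n t)%E by rewrite lee_fin; apply: mulr_ge0; [exact: exprn_ge0|exact: sqr_ge0].
have mD n m : measurable_fun setT (fun t => ((F m t - F n t) ^+ 2)%:E : \bar R).
  by apply/measurable_EFinP; apply: measurable_funX; exact: measurable_funB.
have iD n m : (n <= m)%N ->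
    (\int[mu]_t ((F m t - F n t) ^+ 2)%:E <= ((2 * 4^-1 ^+ n) ^+ 2)%:E)%E.
  by move=> nm; rewrite -L2B_sqr lee_fin ler_pXn2r ?nnegrE ?Hx// mulr_ge0// exprn_ge0.
have ma n : measurable_fun setT (a n).
  by rewrite /a; under eq_fun do rewrite EFinM; exact: measurable_funeM.
(* [4^n (2 4^-n)^2 = 4 4^-n <= 4 2^-n], written as the term of the geometric series summed below. *)
have ia n : (\int[mu]_t a n t <= (8 / (2 ^ (n + 1))%:R)%:E)%E.
  rewrite /a; under eq_integral do rewrite EFinM.
  rewrite ge0_integralZl_EFin ?exprn_ge0//; last by move=> t _; rewrite lee_fin sqr_ge0.
  apply: le_trans (lee_wpmul2l _ (iD _ _ (leqnSn n))) _; first by rewrite lee_fin exprn_ge0.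
  rewrite -EFinM lee_fin.
  have q1 : 4 ^+ n * 4^-1 ^+ n = 1 :> R by rewrite -exprMn divff ?expr1n.
  have -> : 4 ^+ n * (2 * 4^-1 ^+ n) ^+ 2 = 4 * 4^-1 ^+ n * (4 ^+ n * 4^-1 ^+ n) :> R by ring.
  have -> : 8 / (2 ^ (n + 1))%:R = 4 * 2^-1 ^+ n :> R.
    rewrite addn1 expnS natrM natrX exprVn; have : 2 ^+ n != 0 :> R by rewrite expf_neq0.
    by move=> n0; field.
  rewrite q1 mulr1 ler_pM2l//; apply: lerXn2r; rewrite ?nnegrE ?invr_ge0//.
  by rewrite lef_pV2 ?posrE// ler_nat.
have : mu.-integrable setT (fun t => \sum_(n <oo) a n t)%E.
  apply/integrableP; split; first exact: ge0_emeasurable_sum.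
  under eq_integral do rewrite gee0_abs ?nneseries_ge0//.
  rewrite integral_nneseries//.
  apply: (@le_lt_trans _ _ (\sum_(n <oo) (8 / (2 ^ (n + 1))%:R)%:E)%E).
    by apply: lee_nneseries => [n _ _|n _]; [exact: integral_ge0|exact: ia].
  have : (fun n => \sum_(0 <= k < n) (8 / (2 ^ (k + 1))%:R)%:E)%E @ \oo --> (8%:E : \bar R).
    under eq_cvg do rewrite sumEFin.
    apply: cvg_EFin; first exact: nearW.
    by have := cvg_geometric_series_half (8 : R) 0; rewrite expr0 divr1.
  by move/cvg_lim => ->//; rewrite ltry.
move=> /(integrable_ae measurableT)[N [mN muN subN]].
have cvF t : ~ N t -> cvg ((fun n => F n t) @ \oo).
  move=> Nt; have fin : (\sum_(n <oo) a n t)%E \is a fin_num.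
    by apply: contrapT => H; apply: Nt; apply: subN => /(_ I).
  apply: (@summable_diff_cvg _ (fine (\sum_(n <oo) a n t)%E)) => n.
  rewrite -lee_fin fineK// -[leLHS]/(a n t).
  rewrite (@nneseries_split _ _ 0 n.+1)// add0n big_nat_recr//=.
  apply: le_trans (leeDl _ _); last by rewrite nneseries_ge0.
  by rewrite leeDr// sume_ge0.
pose f t := if t \in N then 0 else lim ((fun n => F n t) @ \oo).
have mN' : measurable_fun setT (fun t => t \in N).
  apply: (measurable_fun_bool true).
  by rewrite setTI (_ : _ @^-1` _ = N)//; apply/seteqP; split => t /=;
      [move=> /set_mem|move=> /mem_set].
have mf : measurable_fun setT f.
  apply: (measurable_fun_cvg (h := fun n t => if t \in N then 0 else F n t)).
    by move=> n; apply: measurable_fun_if => //; exact: (measurable_funS (E := setT)).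
  move=> t _; rewrite /f; case: ifPn => [_|]; first exact: cvg_cst.
  by rewrite notin_setE => /cvF.
(* Fatou's lemma in [m] for the squares of [F (m + n) - F n], whose integrals are bounded by [iD]
   uniformly in [m]. *)
have ifn n : (\int[mu]_t ((f t - F n t) ^+ 2)%:E <= ((2 * 4^-1 ^+ n) ^+ 2)%:E)%E.
  pose G m t := ((F (m + n)%N t - F n t) ^+ 2)%:E : \bar R.
  have mG m : measurable_fun setT (G m) by exact: mD.
  have G0 m t : setT t -> (0 <= G m t)%E by move=> _; rewrite lee_fin sqr_ge0.
  have cG t : ~ N t -> (fun m => G m t) @ \oo --> ((f t - F n t) ^+ 2)%:E.
    move=> Nt; apply: cvg_EFin; first exact: nearW.
    have c1 : (fun m => F (m + n)%N t - F n t) @ \oo --> f t - F n t.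
      apply: cvgB; last exact: cvg_cst.
      by rewrite (cvg_shiftn n (F ^~ t)) /f memNset//; exact: cvF.
    rewrite expr2 (_ : _ \o _ = (fun m => F (m + n)%N t - F n t) \* (fun m => F (m + n)%N t - F n t)).
      exact: cvgM.
    by apply/funext => m /=; rewrite expr2.
  have Hfat := fatou mu measurableT mG G0.
  apply: le_trans (le_trans _ Hfat) _.
    rewrite le_eqVlt; apply/orP; left; apply/eqP; apply: ae_eq_lower_integral.
    - by move=> t; rewrite lee_fin sqr_ge0.
    - move=> t; rewrite limn_einf_lim; apply: lime_ge; first exact: is_cvg_einfs.
      by apply: nearW => m; apply: le_ereal_inf_tmp => _ [k _ <-]; exact: G0.
    exists N; split => // t /= H; apply: contrapT => Nt; apply: H.
    have cGt := cG t Nt.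
    by rewrite is_cvg_limn_einfE; [apply/esym/cvg_lim|apply/cvg_ex; eexists; exact: cGt].
  rewrite limn_einf_lim; apply: lime_le; first exact: is_cvg_einfs.
  apply: nearW => m; apply: (@le_trans _ _ (\int[mu]_t G m t)%E).
    by apply: ereal_inf_lbound; exists m => /=.
  by apply: iD; exact: leq_addl.
have fL : f \in Lfun mu 2%:R%:E.
  apply/Lfun2P; split => //.
  apply: (@le_lt_trans _ _ (\int[mu]_t (2%:E * ((f t - F 0%N t) ^+ 2)%:E + 2%:E * (F 0%N t ^+ 2)%:E))%E).
    apply: ge0_le_lower_integral => t; first by rewrite lee_fin sqr_ge0.
    rewrite -!EFinM -EFinD lee_fin; have := sqr_ge0 (f t - 2 * F 0%N t); nra.
  have m1 : measurable_fun setT (fun t => ((f t - F 0%N t) ^+ 2)%:E : \bar R).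
    by apply/measurable_EFinP; apply: measurable_funX; exact: measurable_funB.
  have m2 : measurable_fun setT (fun t => (F 0%N t ^+ 2)%:E : \bar R).
    by apply/measurable_EFinP; exact: measurable_funX.
  rewrite ge0_integralD//; last first.
  - exact: measurable_funeM.
  - by move=> t _; rewrite mule_ge0 ?lee_fin ?sqr_ge0.
  - exact: measurable_funeM.
  - by move=> t _; rewrite mule_ge0 ?lee_fin ?sqr_ge0.
  rewrite !ge0_integralZl_EFin//; last first.
  - by move=> t _; rewrite lee_fin sqr_ge0.
  - by move=> t _; rewrite lee_fin sqr_ge0.
  apply: lte_add_pinfty; apply: lte_mul_pinfty => //.
  - by apply: le_lt_trans (ifn 0%N) _; rewrite ltry.
  - by have /Lfun2P[] := Lspace_Lfun (x 0%N).
exists (toL2 mu f) => n.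
rewrite -(@ler_pXn2r _ 2) ?nnegrE ?mulr_ge0 ?exprn_ge0// -lee_fin L2B_sqr.
apply: le_trans (ifn n); rewrite le_eqVlt; apply/orP; left; apply/eqP.
apply: ae_eq_integral => //.
- by apply/measurable_EFinP; apply: measurable_funX; apply: measurable_funB => //; exact: measurable_Lrepr.
- by apply/measurable_EFinP; apply: measurable_funX; exact: measurable_funB.
- by apply: filterS (toL2K fL) => t -> _.
Qed.

(** The filter contains a ball of each radius [4^-n]; any two of these balls meet, so their centres
    satisfy the hypothesis of [L2_rapid_cauchy_cvg]. *)
Lemma L2_cauchy_cvg (F : set_system (L2 mu)) : ProperFilter F -> cauchy F -> cvg F.
Proof.
move=> FF /cauchyP Fc.
have /choice[x Hx] : forall n : nat, exists x : L2 mu, F (ball x (4^-1 ^+ n : R)).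
  by move=> n; apply: Fc; rewrite exprn_gt0.
have dx n m : (n <= m)%N -> `|x m - x n| <= 2 * 4^-1 ^+ n.
  move=> nm; have [z [/= zm zn]] := filter_ex (filterI (Hx m) (Hx n)).
  move: zm zn; rewrite -!ball_normE /= => zm zn.
  have -> : x m - x n = (x m - z) - (x n - z) by rewrite opprB addrA subrK.
  apply: le_trans (ler_normB _ _) _.
  have h : 4^-1 ^+ m <= 4^-1 ^+ n :> R.
    by apply: ler_wiXn2l => //; rewrite invf_le1// ler1n.
  have := ltW zm; have := ltW zn; lra.
have [y Hy] := L2_rapid_cauchy_cvg dx.
apply/cvg_ex; exists y; apply/cvg_ballP => e e0.
have : geometric (3 : R) 4^-1 @ \oo --> 0.
  by apply: cvg_geometric; rewrite ger0_norm// invf_lt1// ltr1n.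
move=> /cvgrPdist_lt/(_ _ e0)[n _ /(_ n (leqnn n))].
rewrite /geometric /= sub0r normrN ger0_norm ?mulr_ge0 ?exprn_ge0// => ne.
apply: filterS (Hx n) => z; rewrite -!ball_normE /= => xz.
have -> : y - z = (y - x n) + (x n - z) by rewrite addrA subrK.
by apply: le_lt_trans (ler_normD _ _) _; have := Hy n; lra.
Qed.

HB.instance Definition _ := Uniform_isComplete.Build (L2 mu) L2_cauchy_cvg.

End L2_complete.

(** * Time-dependent coefficients *)

Section multiplication.
Context d (T : measurableType d) (R : realType) (mu : {measure set T -> \bar R}).

Definition ess_bounded (a : T -> R) (M : R) :=
  measurable_fun setT a /\ \forall x \ae mu, `|a x| <= M.

Lemma Lfun_ess_bounded (a : T -> R) : a \in Lfun mu +oo%E ->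
  exists2 M, 0 <= M & ess_bounded a M.
Proof.
rewrite inE => /andP[/[!inE]/= ma]; rewrite /finite_norm unlock /Lnorm.
case: ifPn => [mu0|mu0 _]; last first.
  (* For the zero measure every bound holds almost everywhere. *)
  exists 0 => //; split => //; exists setT; split => //.
  by apply/eqP; rewrite eq_le measure_ge0 andbT leNgt.
move=> /ess_supr_bounded[M aM]; exists `|M| => //; split => //.
by apply: filterS aM => x /le_trans; apply; exact: ler_norm.
Qed.

Lemma mulL2_Lfun (a : T -> R) M (f : L2 mu) : ess_bounded a M ->
  (fun x => a x * Lrepr f x) \in Lfun mu 2%:R%:E.
Proof.
move=> [ma aM]; apply/Lfun2P; split.
  by apply: measurable_funM => //; exact: measurable_Lrepr.
have [_ fi] := (Lfun2P mu _).1 (Lspace_Lfun f).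
apply: (@le_lt_trans _ _ (\int[mu]_x ((M ^+ 2)%:E * (Lrepr f x ^+ 2)%:E))%E).
  apply: ae_ge0_le_integral => //.
  - by move=> x _; rewrite lee_fin sqr_ge0.
  - apply/measurable_EFinP; apply: measurable_funX; by apply: measurable_funM => //; exact: measurable_Lrepr.
  - by move=> x _; rewrite -EFinM lee_fin mulr_ge0// sqr_ge0.
  - apply: measurable_funeM; apply/measurable_EFinP; apply: measurable_funX.
    exact: measurable_Lrepr.
  - apply: filterS aM => x aM _; rewrite -EFinM lee_fin exprMn ler_wpM2r ?sqr_ge0//.
    by rewrite -[leLHS]real_normK ?num_real// lerXn2r ?nnegrE//; exact: le_trans aM.
rewrite ge0_integralZl_EFin//; last by rewrite sqr_ge0.
- by apply: lte_mul_pinfty => //; rewrite lee_fin sqr_ge0.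
- by move=> x _; rewrite lee_fin sqr_ge0.
- by apply/measurable_EFinP; apply: measurable_funX; exact: measurable_Lrepr.
Qed.

Lemma mulL2_ae (a : T -> R) M (f : L2 mu) : ess_bounded a M ->
  \forall x \ae mu, Lrepr (mulL2 mu a f) x = a x * Lrepr f x.
Proof. by move=> aM; apply: toL2K; exact: mulL2_Lfun aM. Qed.

Lemma mulL2_norm (a : T -> R) M (f : L2 mu) : 0 <= M -> ess_bounded a M ->
  `|mulL2 mu a f| <= M * `|f|.
Proof.
move=> M0 aM; rewrite -(@ler_pXn2r _ 2) ?nnegrE ?mulr_ge0// exprMn -lee_fin [(M ^+ 2 * _)%:E]EFinM.
rewrite /mulL2 norm_toL2_sqr; last exact: mulL2_Lfun aM.
rewrite normL2_sqr -ge0_integralZl_EFin ?sqr_ge0//; last 2 first.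
- by move=> x _; rewrite lee_fin sqr_ge0.
- by apply/measurable_EFinP; apply: measurable_funX; exact: measurable_Lrepr.
apply: ae_ge0_le_integral => //.
- by move=> x _; rewrite lee_fin sqr_ge0.
- apply/measurable_EFinP; apply: measurable_funX; apply: measurable_funM; first by case: aM.
  by exact: measurable_Lrepr.
- by move=> x _; rewrite -EFinM lee_fin mulr_ge0// sqr_ge0.
- apply: measurable_funeM; apply/measurable_EFinP; apply: measurable_funX.
  exact: measurable_Lrepr.
- apply: filterS aM.2 => x ax _; rewrite -EFinM lee_fin exprMn ler_wpM2r ?sqr_ge0//.
  by rewrite -[leLHS]real_normK ?num_real// lerXn2r ?nnegrE//; exact: le_trans ax.
Qed.

Lemma mulL2_linear (a : T -> R) M : ess_bounded a M -> linear (mulL2 mu a).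
Proof.
move=> aM k f g; apply: L2_eq_ae.
have h1 := mulL2_ae (k *: f + g) aM; have h2 := mulL2_ae f aM; have h3 := mulL2_ae g aM.
have h4 := Lrepr_lin k f g; have h5 := Lrepr_lin k (mulL2 mu a f) (mulL2 mu a g).
apply: filterS3 h1 h2 (filterI h3 (filterI h4 h5)) => x -> e2 [e3 [e4 e5]].
by rewrite e5 e4 e2 e3; ring.
Qed.

Lemma mulL2_ae_eq (a b : T -> R) M (f : L2 mu) : ess_bounded a M ->
  measurable_fun setT b -> (\forall x \ae mu, a x = b x) -> mulL2 mu a f = mulL2 mu b f.
Proof.
move=> aM mb ab; have bM : ess_bounded b M.
  by split => //; apply: filterS2 ab aM.2 => x ->.
apply: toL2_ae; [exact: mulL2_Lfun aM|exact: mulL2_Lfun bM|].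
by apply: filterS ab => x ->.
Qed.

Lemma mulL2D (k : R) (a b : T -> R) M M' (f : L2 mu) : ess_bounded a M -> ess_bounded b M' ->
  mulL2 mu (fun x => k * a x + b x) f = k *: mulL2 mu a f + mulL2 mu b f.
Proof.
move=> aM bM; have abM : ess_bounded (fun x => k * a x + b x) (`|k| * M + M').
  split; first by apply: measurable_funD; [apply: measurable_funM => //; case: aM|case: bM].
  apply: filterS2 aM.2 bM.2 => x ax bx; apply: le_trans (ler_normD _ _) _.
  by rewrite normrM lerD// ler_wpM2l.
apply: L2_eq_ae.
have h1 := mulL2_ae f abM; have h2 := mulL2_ae f aM; have h3 := mulL2_ae f bM.
have h5 := Lrepr_lin k (mulL2 mu a f) (mulL2 mu b f).
by apply: filterS3 h1 h2 (filterI h3 h5) => x -> e2 [e3 e5]; rewrite e5 e2 e3; ring.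
Qed.

Lemma ip_mulL2 (a : T -> R) M (f g : L2 mu) : ess_bounded a M ->
  ip (mulL2 mu a f) g = \int[mu]_x (a x * Lrepr f x * Lrepr g x).
Proof. by move=> aM; rewrite ip_toL2l//; exact: mulL2_Lfun aM. Qed.

Lemma ip_mulL2C (a : T -> R) M (f g : L2 mu) : ess_bounded a M ->
  ip (mulL2 mu a f) g = ip f (mulL2 mu a g).
Proof.
move=> aM; rewrite [RHS](inner_sym (ip_inner mu)) !(ip_mulL2 _ _ aM).
by apply: eq_Rintegral => x _; ring.
Qed.

End multiplication.

Section time_multiplication.
Context dQ dS (Q : measurableType dQ) (S : measurableType dS) (R : realType).
Variables (mu : {sigma_finite_measure set Q -> \bar R})
  (nu : {sigma_finite_measure set S -> \bar R}).
Hypothesis nufin : (nu setT < +oo)%E.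
Variable c : L2 mu.

Definition slice_mul (lam : Q * S -> R) (t : S) : L2 mu :=
  mulL2 mu (fun q => lam (q, t)) c.

(** The bound holds at every point, so that every slice is bounded and approximating simple
    functions inherit a bound; [slice_mul_AL1] returns to essential bounds. *)
Definition bounded_fun2 (lam : Q * S -> R) (M : R) :=
  measurable_fun setT lam /\ forall p, `|lam p| <= M.

Lemma slice_ess_bounded lam M t : bounded_fun2 lam M ->
  ess_bounded mu (fun q => lam (q, t)) M.
Proof.
move=> [mlam lamM]; split; first exact: (measurable_fun_pair1 t mlam).
exact: nearW.
Qed.

Lemma slice_mulD k lam lam' M M' : bounded_fun2 lam M -> bounded_fun2 lam' M' ->
  AL1 nu (slice_mul lam) -> AL1 nu (slice_mul lam') ->
  AL1 nu (slice_mul (fun p => k * lam p + lam' p)).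
Proof.
move=> lamM lamM' lA lA'.
have kA : AL1 nu (fun t => k *: slice_mul lam t).
  apply: (@AL1_linear _ _ _ _ _ _ ( *:%R k) `|k|) lA => x.
  by rewrite normrZ.
have := AL1D kA lA'; congr (AL1 _ _); apply/funext => t.
by rewrite /slice_mul (mulL2D k c (slice_ess_bounded t lamM) (slice_ess_bounded t lamM')).
Qed.

(** Dominated convergence on the product space makes the squared distances small after integration
    in [t], by Tonelli; the inequality [x <= dl + x^2 / dl] converts this into an L^1 distance in
    [t]. *)
Lemma slice_mul_lim (lam_ : nat -> Q * S -> R) lam M :
  (forall n, bounded_fun2 (lam_ n) M) -> bounded_fun2 lam M ->
  (forall p, (fun n => lam_ n p) @ \oo --> lam p) ->
  (forall n, AL1 nu (slice_mul (lam_ n))) -> AL1 nu (slice_mul lam).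
Proof.
move=> bl_ bl lcvg lA; apply: AL1_lim => e e0.
have [_ fi] := (Lfun2P mu _).1 (Lspace_Lfun c).
pose C q := (Lrepr c q ^+ 2)%:E : \bar R.
pose K n (p : Q * S) := (((lam_ n p - lam p) * Lrepr c p.1) ^+ 2)%:E : \bar R.
have mc1 : measurable_fun setT (fun p : Q * S => Lrepr c p.1).
  exact: (measurableT_comp (measurable_Lrepr c) measurable_fst).
have mK n : measurable_fun setT (K n).
  apply/measurable_EFinP; apply: measurable_funX; apply: measurable_funM => //.
  by apply: measurable_funB; [case: (bl_ n)|case: bl].
have K0 n p : (0 <= K n p)%E by rewrite lee_fin sqr_ge0.
have M0 : 0 <= M by case: bl => _ /(_ (point, point)); exact: le_trans.
pose D : R := (2 * M) ^+ 2.
pose G (p : Q * S) : \bar R := (D%:E * C p.1)%E.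
have C0 q : (0 <= C q)%E by rewrite lee_fin sqr_ge0.
have D0 : 0 <= D by exact: sqr_ge0.
have G0 p : (0 <= G p)%E by apply: mule_ge0; [rewrite lee_fin|exact: C0].
have KG n p : (K n p <= G p)%E.
  rewrite /G /C -EFinM lee_fin exprMn ler_wpM2r ?sqr_ge0//.
  rewrite -[leLHS]real_normK ?num_real//; apply: lerXn2r; rewrite ?nnegrE ?mulr_ge0//.
  apply: le_trans (ler_normB _ _) _; rewrite mulr_natl mulr2n lerD//.
    by case: (bl_ n).
  by case: bl.
have mC : measurable_fun setT C.
  by apply/measurable_EFinP; apply: measurable_funX; exact: measurable_Lrepr.
have mG : measurable_fun setT G.
  apply: measurable_funeM; apply/measurable_EFinP; exact: measurable_funX.
have iG : (mu \x nu)%E.-integrable setT G.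
  apply/integrableP; split => //.
  under eq_integral do rewrite gee0_abs//.
  rewrite (fubini_tonelli2 _ mG G0) /fubini_G /=.
  rewrite (_ : (fun y => _) = cst (D%:E * \int[mu]_x C x)%E); last first.
    by apply/funext => y; rewrite ge0_integralZl_EFin.
  rewrite integral_cst//; apply: lte_mul_pinfty => //.
  - by apply: mule_ge0; [rewrite lee_fin|exact: integral_ge0].
  - rewrite fin_numM// ge0_fin_numE//; exact: integral_ge0.
have cK p : (fun n => K n p) @ \oo --> 0%E.
  apply: cvg_EFin; first exact: nearW.
  have c1 : (fun n => (lam_ n p - lam p) * Lrepr c p.1) @ \oo --> (0 : R).
    rewrite -[X in _ --> X](mul0r (Lrepr c p.1)) -(subrr (lam p)).
    by apply: cvgM; [apply: cvgB => //; exact: cvg_cst|exact: cvg_cst].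
  rewrite -[X in _ --> X](mul0r (0 : R)).
  rewrite (_ : _ \o _ = (fun n => (lam_ n p - lam p) * Lrepr c p.1) \*
      (fun n => (lam_ n p - lam p) * Lrepr c p.1)); first exact: cvgM.
  by apply/funext => n /=; rewrite expr2.
have cK' : {ae (mu \x nu)%E, forall p, setT p -> (fun n => K n p) @ \oo --> cst 0%E p}.
  by apply: aeW => p _; exact: cK.
have KG' : {ae (mu \x nu)%E, forall p n, setT p -> (`|K n p| <= G p)%E}.
  by apply: aeW => p n _; rewrite gee0_abs.
have [_ _] := dominated_convergence measurableT mK (measurable_cst _) cK' iG KG'.
rewrite integral0 => iK.
pose V := fine (nu setT); have V0 : 0 <= V by rewrite fine_ge0.
(* The L^1 distance is at most [dl V] plus the integral of the squares over [dl]. Here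
   [dl (V + 1) = e / 2], and an integral of squares of at most [dl (e / 2)] makes the second term
   [e / 2]. *)
pose dl := e / (2 * (V + 1)).
have dl0 : 0 < dl by rewrite divr_gt0// mulr_gt0// ltr_wpDl.
have e2 : 0 < dl * (e / 2) by rewrite mulr_gt0// divr_gt0.
have /fine_cvgP[fK /cvgrPdist_le/(_ _ e2) Ke] := iK.
have [n [fn en]] : exists n, (\int[(mu \x nu)%E]_p K n p)%E \is a fin_num /\
    `|0 - fine (\int[(mu \x nu)%E]_p K n p)%E| <= dl * (e / 2).
  by near \oo => n; exists n; split; near: n.
exists (slice_mul (lam_ n)) => //; apply: l1close_sym.
have mfub : measurable_fun setT (fubini_G mu (K n)).
  exact: (measurable_fun_fubini_tonelli_G _ (mK n) (K0 n)).
have fubE t : fubini_G mu (K n) t = (`|slice_mul (lam_ n) t - slice_mul lam t| ^+ 2)%:E.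
  rewrite /fubini_G L2B_sqr; apply: ae_eq_integral => //.
  - exact: (measurable_fun_pair1 t (mK n)).
  - by apply/measurable_EFinP; apply: measurable_funX; apply: measurable_funB; exact: measurable_Lrepr.
  - have h1 := mulL2_ae c (slice_ess_bounded t (bl_ n)).
    have h2 := mulL2_ae c (slice_ess_bounded t bl).
    by apply: filterS2 h1 h2 => q -> -> _; rewrite /K /= mulrBl.
have fub0 t : (0 <= fubini_G mu (K n) t)%E by rewrite fubE lee_fin sqr_ge0.
exists (fun t => dl%:E + dl^-1%:E * fubini_G mu (K n) t)%E; split.
- by apply: emeasurable_funD => //; exact: measurable_funeM.
- move=> t; rewrite fubE -EFinM -EFinD lee_fin.
  set x := `|_|; rewrite -(ler_pM2l dl0) mulrDr mulrA divff ?gt_eqF// mul1r.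
  have x0 : 0 <= x by exact: normr_ge0.
  have dx0 : 0 <= dl * x by rewrite mulr_ge0// ltW.
  have := sqr_ge0 (x - dl); rewrite sqrrB.
  move: dx0; move: (x) => y; nra.
- rewrite ge0_integralD//; last 3 first.
  + by move=> t _; rewrite lee_fin ltW.
  + by move=> t _; apply: mule_ge0 => //; rewrite lee_fin invr_ge0 ltW.
  + exact: measurable_funeM.
  rewrite integral_cst// ge0_integralZl_EFin//; last by rewrite invr_ge0 ltW.
  have iKe : (\int[nu]_t fubini_G mu (K n) t <= (dl * (e / 2))%:E)%E.
    rewrite -(fubini_tonelli2 _ (mK n) (K0 n)) -(fineK fn) lee_fin.
    by apply: le_trans en; rewrite sub0r normrN ler_norm.
  have nuV : nu setT = V%:E by rewrite fineK// ge0_fin_numE.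
  apply: (@le_trans _ _ (dl%:E * V%:E + dl^-1%:E * (dl * (e / 2))%:E)%E).
    apply: leeD; first by rewrite -nuV; exact: lexx.
    by apply: lee_wpmul2l => //; rewrite lee_fin invr_ge0 ltW.
  rewrite -!EFinM -EFinD lee_fin mulKf ?gt_eqF//.
  have V1 : V + 1 != 0 by rewrite gt_eqF// ltr_wpDl.
  have : dl * (V + 1) = e / 2 by rewrite /dl; field.
  rewrite mulrDr mulr1; lra.
Unshelve. all: end_near. Qed.

Lemma AL1_cst (x : L2 mu) : AL1 nu (fun _ : S => x).
Proof.
have := AL1_simple (s := [:: (setT, x)]) (mu := nu).
rewrite (_ : simple_fun _ = fun=> x); last first.
  by apply/funext => t; rewrite /simple_fun big_seq1 /= indicT scale1r.
by apply; apply/is_simple_cons; split; [exact: measurableT|exact: nufin|move=> p].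
Qed.

Lemma mulL2_0 : mulL2 mu (fun=> 0) c = 0.
Proof.
have b0 : ess_bounded mu (fun=> 0) (0 : R).
  by split; [exact: measurable_cst|apply: nearW => q; rewrite normr0].
apply/eqP; rewrite -normr_le0; apply: le_trans (mulL2_norm c (lexx 0) b0) _.
by rewrite mul0r.
Qed.

(** Dynkin's theorem: for a rectangle the slice is an indicator in [t] times a fixed vector,
    complements are handled by linearity, and disjoint unions by their finite partial unions and
    [slice_mul_lim]. *)
Lemma slice_mul_indic E : measurable E -> AL1 nu (slice_mul \1_E).
Proof.
have bI (A : set (Q * S)) : measurable A -> bounded_fun2 (\1_A : _ -> R) 1.
  move=> mA; split; first exact: measurable_indic.
  by move=> p; rewrite indicE; case: (_ \in _); rewrite ?normr1// normr0.
have A0 : AL1 nu (slice_mul (\1_(set0 : set (Q * S)))).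
  have := AL1_cst (mulL2 mu (fun=> 0) c); congr (AL1 _ _); apply/funext => t.
  by rewrite /slice_mul; congr mulL2; apply/funext => q; rewrite indic0.
have AT : AL1 nu (slice_mul (\1_(setT : set (Q * S)))).
  have := AL1_cst (mulL2 mu (fun=> 1) c); congr (AL1 _ _); apply/funext => t.
  by rewrite /slice_mul; congr mulL2; apply/funext => q; rewrite indicT.
move=> mE; have := mE; rewrite measurable_prod_measurableType => sE; move: E sE {mE}.
apply: dynkin_induction.
- exact: measurable_prod_measurableType.
- move=> _ _ [A mA [B mB <-]] [A' mA' [B' mB' <-]].
  exists (A `&` A'); first exact: measurableI.
  by exists (B `&` B'); [exact: measurableI|rewrite setXI].
- exact: AT.
- move=> _ [A mA [B mB <-]].
  have := AL1_restr mB (AL1_cst (mulL2 mu \1_A c)); congr (AL1 _ _); apply/funext => t.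
  rewrite /slice_mul indicE; case: (boolP (t \in B)) => tB /=.
    rewrite scale1r; congr mulL2; apply/funext => q.
    rewrite !indicE; congr ((nat_of_bool _)%:R); apply/idP/idP => [/set_mem qA|/set_mem[/= qA _]].
      by apply/mem_set; split => //; exact: set_mem.
    exact/mem_set.
  rewrite scale0r -mulL2_0; congr mulL2; apply/funext => q.
  rewrite indicE memNset// => -[_ /= tB']; move: tB; rewrite notin_setE; exact.
- move=> A mA PA.
  have := slice_mulD (-1) (bI _ mA) (bI _ measurableT) PA AT; congr (AL1 _ _).
  apply/funext => t; rewrite /slice_mul; congr mulL2; apply/funext => q.
  rewrite !indicE in_setC in_setT; case: (_ \in A) => /=.
    by rewrite mulr1 addNr.
  by rewrite mulr0 add0r.
- move=> F mF tF PF; pose U n := \bigcup_(k in [set k | (k < n)%N]) F k.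
  have mU n : measurable (U n) by apply: bigcup_measurable => k _; exact: mF.
  apply: (@slice_mul_lim (fun n => \1_(U n)) _ 1).
  + by move=> n; exact: bI.
  + by apply: bI; exact: bigcupT_measurable.
  + move=> p; have [[k _ Fkp]|nF] := pselect ((\bigcup_k F k) p).
      rewrite [X in _ --> X]indicE mem_set; last by exists k.
      apply: cvg_near_cst; exists k.+1 => // n /= kn.
      by rewrite indicE mem_set//; exists k.
    rewrite [X in _ --> X]indicE memNset//; apply: cvg_near_cst; apply: nearW => n.
    by rewrite indicE memNset// => -[k _ Fk]; apply: nF; exists k.
  + elim=> [|n IH].
      by rewrite (_ : U 0%N = set0)//; apply/seteqP; split => // p [].
    have := slice_mulD 1 (bI _ (mU n)) (bI _ (mF n)) IH (PF n); congr (AL1 _ (slice_mul _)).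
    apply/funext => p; rewrite mul1r !indicE.
    have [Fn|Fn] := pselect (F n p).
      rewrite [p \in F n]mem_set// [p \in U n.+1]mem_set; last by exists n => /=.
      rewrite memNset ?add0r// => -[k /= kn Fk].
      by have := tF k n I I (ex_intro _ p (conj Fk Fn)) => kE; rewrite kE ltnn in kn.
    rewrite [p \in F n]memNset// addr0; congr ((nat_of_bool _)%:R); apply/idP/idP => /set_mem[k /= kn Fk].
      by apply/mem_set; exists k => //=; rewrite ltnS ltnW.
    apply/mem_set; exists k => //=; move: kn; rewrite ltnS leq_eqVlt => /predU1P[kE|//].
    by rewrite kE in Fk.
Qed.

Import HBNNSimple.

Lemma slice_mul_nnsfun (g : {nnsfun (Q * S)%type >-> R}) : AL1 nu (slice_mul g).
Proof.
have -> : (g : Q * S -> R) = fun p =>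
    \sum_(y <- finmap.enum_fset (fset_set (range g))) (y * \1_(g @^-1` [set y]) p).
  by apply/funext => p; rewrite fimfunE fsbig_finite.
have mg y : measurable (g @^-1` [set y]).
  by rewrite -[X in measurable X]setTI; apply: (measurable_funPT g) => //.
suff H (s : seq R) : (exists M, bounded_fun2 (fun p => \sum_(y <- s) (y * \1_(g @^-1` [set y]) p)) M) /\
   AL1 nu (slice_mul (fun p => \sum_(y <- s) (y * \1_(g @^-1` [set y]) p))) by exact: (H _).2.
elim: s => [|y s [[M bM] IH]].
  have -> : (fun p => \sum_(y <- [::]) (y * \1_(g @^-1` [set y]) p)) = (fun=> 0).
    by apply/funext => p; rewrite big_nil.
  split.
    by exists 0; split; [exact: measurable_cst|move=> p; rewrite normr0].
  by rewrite /slice_mul mulL2_0; exact: AL1_cst.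
have bI : bounded_fun2 (\1_(g @^-1` [set y]) : _ -> R) 1.
  split; first exact: measurable_indic.
  by move=> p; rewrite indicE; case: (_ \in _); rewrite ?normr1// normr0.
have E : (fun p => \sum_(y <- y :: s) (y * \1_(g @^-1` [set y]) p)) =
    (fun p => y * \1_(g @^-1` [set y]) p + \sum_(y <- s) (y * \1_(g @^-1` [set y]) p)).
  by apply/funext => p; rewrite big_cons.
rewrite E; split.
  exists (`|y| + M); case: bM => mM bM; split.
    by apply: measurable_funD => //; apply: measurable_funM => //; case: bI.
  move=> p; apply: le_trans (ler_normD _ _) (lerD _ (bM p)).
  by rewrite normrM ler_piMr//; case: bI.
exact: slice_mulD bI bM (slice_mul_indic (mg y)) IH.
Qed.

Lemma slice_mul_bounded lam M : bounded_fun2 lam M -> AL1 nu (slice_mul lam).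
Proof.
move=> bl; have M0 : 0 <= M by case: bl => _ /(_ (point, point)); exact: le_trans.
(* Shifted by [M], the function is nonnegative and thus an increasing limit of nonnegative simple
   functions, all bounded by [2 M]. *)
have [ml lM] := bl; pose f p := lam p + M.
have f0 p : 0 <= f p.
  by rewrite /f -lerBlDr sub0r; have := lM p; rewrite ler_norml => /andP[].
have f2 p : f p <= 2 * M.
  by rewrite /f mulr_natl mulr2n lerD2r; apply: le_trans (lM p); exact: ler_norm.
have mf : measurable_fun setT f by exact: measurable_funD.
have [g [nd gf]] := approximation measurableT
  ((measurable_EFinP setT f).2 mf) (fun p _ => f0 p : (0 <= (EFin \o f) p)%E).
have gf' p : (fun n => g n p) @ \oo --> f p.
  by have /fine_cvgP[_] := gf p Logic.I.
have bg n : bounded_fun2 (g n) (2 * M).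
  split; first exact: measurable_funPT.
  move=> p; rewrite ger0_norm//; apply: le_trans (f2 p).
  have ndp : nondecreasing_seq (fun n => g n p) by move=> a b ab; exact/lefP/nd.
  rewrite -(cvg_lim _ (gf' p))//; apply: nondecreasing_cvgn_le => //.
  by apply/cvg_ex; exists (f p); exact: gf'.
have bf : bounded_fun2 f (2 * M) by split => // p; rewrite ger0_norm.
have fA := slice_mul_lim bg bf gf' (fun n => slice_mul_nnsfun (g n)).
have b1 : bounded_fun2 (fun=> - M) M.
  by split; [exact: measurable_cst|move=> p; rewrite normrN ger0_norm].
have A1 : AL1 nu (slice_mul (fun=> - M)) by exact: AL1_cst.
have := slice_mulD 1 bf b1 fA A1; congr (AL1 _ (slice_mul _)).
by apply/funext => p; rewrite mul1r /f addrK.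
Qed.

(** Clamping [lam] to [[-M, M]] bounds it everywhere and, for almost every [t], changes its slice
    only on a null set. *)
Lemma slice_mul_AL1 (lam : Q * S -> R) M : 0 <= M -> measurable_fun setT lam ->
  (\forall t \ae nu, \forall q \ae mu, `|lam (q, t)| <= M) -> AL1 nu (slice_mul lam).
Proof.
move=> M0 mlam lamM; pose lam' p := Num.max (- M) (Num.min M (lam p)).
have mlam' : measurable_fun setT lam'.
  by apply: measurable_maxr => //; exact: measurable_minr.
have b' : bounded_fun2 lam' M.
  split => // p; rewrite /lam' ler_norml le_max lexx/= ge_max ge_min lexx andbT.
  by rewrite ge0_cp.
apply: AL1_ae (slice_mul_bounded b').
apply: filterS lamM => t lamt; rewrite /slice_mul.
apply: (mulL2_ae_eq c (slice_ess_bounded t b')).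
  exact: (measurable_fun_pair1 t mlam).
apply: filterS lamt => q; rewrite ler_norml => /andP[h1 h2].
by rewrite /lam' min_r// max_r.
Qed.

End time_multiplication.

(** Tonelli for the indicator of a null set: the measures of its slices integrate to 0, so almost
    all of them vanish. *)
Lemma ae_slices dQ dS (Q : measurableType dQ) (S : measurableType dS) (R : realType)
    (mu : {sigma_finite_measure set Q -> \bar R})
    (nu : {sigma_finite_measure set S -> \bar R}) (P : Q * S -> Prop) :
  (\forall p \ae (mu \x nu)%E, P p) -> \forall t \ae nu, \forall q \ae mu, P (q, t).
Proof.
move=> [N [mN muN subN]].
have mI : measurable_fun setT (EFin \o (\1_N : Q * S -> R)).
  by apply/measurable_EFinP; exact: measurable_indic.
have I0 p : (0 <= (EFin \o (\1_N : Q * S -> R)) p)%E by rewrite lee_fin.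
have iN : (\int[(mu \x nu)%E]_p (EFin \o (\1_N : Q * S -> R)) p = 0)%E.
  by rewrite integral_indic// setIT; exact: muN.
have iG := etrans (esym (fubini_tonelli2 (m1 := mu) (m2 := nu) _ mI I0)) iN.
have mG := measurable_fun_fubini_tonelli_G (m1 := mu) _ mI I0.
have G0 t : (0 <= fubini_G mu (EFin \o (\1_N : Q * S -> R)) t)%E by exact: integral_ge0.
have := (ae_eq_integral_abs nu measurableT mG).1.
under eq_integral do rewrite gee0_abs//.
move=> /(_ iG); apply: filterS => t /(_ Logic.I).
rewrite indic_fubini_tonelli_GE//= => muy.
exists (ysection N t); split => //; first exact: measurable_ysection.
by move=> q /= H; rewrite /ysection /=; apply/mem_set; exact: subN.
Qed.

(** * Integration over one of two variables *)

Section averaging.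
Context d1 d2 (Q1 : measurableType d1) (Q2 : measurableType d2) (R : realType).
Variables (m1 : {sigma_finite_measure set Q1 -> \bar R})
  (m2 : {sigma_finite_measure set Q2 -> \bar R}).
Hypothesis m2fin : (m2 setT < +oo)%E.
Local Notation m12 := (m1 \x m2)%E.

Definition slice_int (f : Q1 * Q2 -> R) (x : Q1) : R := \int[m2]_y f (x, y).

Definition avg (F : L2 m12) : L2 m1 := toL2 m1 (slice_int (Lrepr F)).

Let V := fine (m2 setT).
Let V0 : 0 <= V. Proof. by rewrite fine_ge0. Qed.

Lemma measurable_slice_int f : measurable_fun setT f -> measurable_fun setT (slice_int f).
Proof.
move=> mf; have mEf : measurable_fun setT (EFin \o f) by exact/measurable_EFinP.
rewrite (_ : slice_int f = fun x => fine (fubini_F m2 (EFin \o f)^\+ x - fubini_F m2 (EFin \o f)^\- x)%E).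
  apply: measurableT_comp => //; apply: emeasurable_funB.
    apply: measurable_fun_fubini_tonelli_F; last by move=> p; exact: funepos_ge0.
    exact: measurable_funepos.
  apply: measurable_fun_fubini_tonelli_F; last by move=> p; exact: funeneg_ge0.
  exact: measurable_funeneg.
apply/funext => x; rewrite /slice_int /Rintegral integralE; congr (fine (_ - _)%E).
  by apply: eq_integral => y _; rewrite !funeposE.
by apply: eq_integral => y _; rewrite !funenegE.
Qed.

(** Cauchy-Schwarz against the constant 1, whose squared norm is [V]. *)
Lemma slice_int_sqr (f : Q1 * Q2 -> R) x : measurable_fun setT f ->
  (\int[m2]_y (f (x, y) ^+ 2)%:E < +oo)%E ->
  m2.-integrable setT (fun y => (f (x, y))%:E) /\
  ((slice_int f x ^+ 2)%:E <= V%:E * \int[m2]_y (f (x, y) ^+ 2)%:E)%E.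
Proof.
move=> mf fin.
have mfx : measurable_fun setT (fun y => f (x, y)) by exact: (measurable_fun_pair2 x mf).
have fL : (fun y => f (x, y)) \in Lfun m2 2%:R%:E by apply/Lfun2P.
have oneL : (fun _ : Q2 => (1 : R)) \in Lfun m2 2%:R%:E.
  apply/Lfun2P; split => //; rewrite expr1n integral_cst// mul1e//.
have f1 := Lfun2_mul_Lfun1 fL oneL.
split.
  have /Lfun1_integrable := f1; congr (integrable _ _ _).
  by apply/funext => y /=; rewrite mulr1.
have := inner_CS (ip_inner m2) (toL2 m2 (fun y => f (x, y))) (toL2 m2 (fun=> 1)).
rewrite ip_toL2r// (@ae_Rintegral_eq _ _ _ _ _ (fun y => f (x, y))); last 3 first.
- by apply: measurable_funM => //; exact: measurable_Lrepr.
- exact: mfx.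
- by apply: filterS (toL2K fL) => y ->; rewrite mulr1.
move=> H; rewrite -norm_toL2_sqr// -EFinM lee_fin.
have <- : `|toL2 m2 (fun=> 1)| ^+ 2 = V.
  apply: EFin_inj; rewrite norm_toL2_sqr// expr1n integral_cst// mul1e fineK//.
  by rewrite ge0_fin_numE.
rewrite -exprMn -[leLHS]real_normK ?num_real//; apply: lerXn2r; rewrite ?nnegrE ?mulr_ge0//.
by rewrite [leRHS]mulrC.
Qed.

Lemma slice_sqr_fin (F : L2 m12) :
  \forall x \ae m1, (\int[m2]_y (Lrepr F (x, y) ^+ 2)%:E < +oo)%E.
Proof.
have mF2 : measurable_fun setT (fun p => (Lrepr F p ^+ 2)%:E : \bar R).
  by apply/measurable_EFinP; apply: measurable_funX; exact: measurable_Lrepr.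
have F20 p : (0 <= (Lrepr F p ^+ 2)%:E :> \bar R)%E by rewrite lee_fin sqr_ge0.
have mG := measurable_fun_fubini_tonelli_F (m2 := m2) _ mF2 F20.
have G0 x : (0 <= fubini_F m2 (fun p => (Lrepr F p ^+ 2)%:E) x)%E by exact: integral_ge0.
have : m1.-integrable setT (fubini_F m2 (fun p => (Lrepr F p ^+ 2)%:E)).
  apply/integrableP; split => //; under eq_integral do rewrite gee0_abs//.
  by rewrite -(fubini_tonelli1 _ mF2 F20) -normL2_sqr ltry.
move/(integrable_ae measurableT); apply: filterS => x /(_ Logic.I).
by rewrite ge0_fin_numE.
Qed.

Lemma slice_int_Lfun (F : L2 m12) : slice_int (Lrepr F) \in Lfun m1 2%:R%:E /\
  (\int[m1]_x (slice_int (Lrepr F) x ^+ 2)%:E <= (V * `|F| ^+ 2)%:E)%E.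
Proof.
have mF := measurable_Lrepr F.
have mF2 : measurable_fun setT (fun p => (Lrepr F p ^+ 2)%:E : \bar R).
  by apply/measurable_EFinP; apply: measurable_funX.
have F20 p : (0 <= (Lrepr F p ^+ 2)%:E :> \bar R)%E by rewrite lee_fin sqr_ge0.
have mG := measurable_fun_fubini_tonelli_F (m2 := m2) _ mF2 F20.
have G0 x : (0 <= fubini_F m2 (fun p => (Lrepr F p ^+ 2)%:E) x)%E by exact: integral_ge0.
have ms := measurable_slice_int mF.
have le : (\int[m1]_x (slice_int (Lrepr F) x ^+ 2)%:E <= (V * `|F| ^+ 2)%:E)%E.
  rewrite EFinM normL2_sqr (fubini_tonelli1 _ mF2 F20) -ge0_integralZl_EFin//.
  apply: ae_ge0_le_integral => //.
  - by move=> x _; rewrite lee_fin sqr_ge0.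
  - by apply/measurable_EFinP; exact: measurable_funX.
  - by move=> x _; apply: mule_ge0.
  - exact: measurable_funeM.
  - by apply: filterS (slice_sqr_fin F) => x /(slice_int_sqr mF)[].
split => //; apply/Lfun2P; split => //; apply: le_lt_trans le _; exact: ltry.
Qed.

(** The preceding estimate gives the square root of [V]; the constant [V + 1] dominates it and
    avoids the root. *)
Lemma avg_norm (F : L2 m12) : `|avg F| <= (V + 1) * `|F|.
Proof.
have [sL le] := slice_int_Lfun F.
rewrite -(@ler_pXn2r _ 2) ?nnegrE ?mulr_ge0 ?addr_ge0// -lee_fin norm_toL2_sqr//.
apply: le_trans le _; rewrite lee_fin exprMn ler_wpM2r ?sqr_ge0//.
by have := V0; nra.
Qed.

Lemma avg_ae (F : L2 m12) : \forall x \ae m1, Lrepr (avg F) x = \int[m2]_y Lrepr F (x, y).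
Proof. by have [sL _] := slice_int_Lfun F; exact: toL2K. Qed.

Lemma ae_slices1 (P : Q1 * Q2 -> Prop) :
  (\forall p \ae m12, P p) -> \forall x \ae m1, \forall y \ae m2, P (x, y).
Proof.
move=> [N [mN muN subN]].
have mI : measurable_fun setT (EFin \o (\1_N : Q1 * Q2 -> R)).
  by apply/measurable_EFinP; exact: measurable_indic.
have I0 p : (0 <= (EFin \o (\1_N : Q1 * Q2 -> R)) p)%E by rewrite lee_fin.
have iN : (\int[m12]_p (EFin \o (\1_N : Q1 * Q2 -> R)) p = 0)%E.
  by rewrite integral_indic// setIT; exact: muN.
have iG := etrans (esym (fubini_tonelli1 (m1 := m1) (m2 := m2) _ mI I0)) iN.
have mG := measurable_fun_fubini_tonelli_F (m2 := m2) _ mI I0.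
have G0 t : (0 <= fubini_F m2 (EFin \o (\1_N : Q1 * Q2 -> R)) t)%E by exact: integral_ge0.
have := (ae_eq_integral_abs m1 measurableT mG).1.
under eq_integral do rewrite gee0_abs//.
move=> /(_ iG); apply: filterS => t /(_ Logic.I).
rewrite indic_fubini_tonelli_FE//= => muy.
exists (xsection N t); split => //; first exact: measurable_xsection.
by move=> q /= H; rewrite /xsection /=; apply/mem_set; exact: subN.
Qed.

Lemma avg_linear : linear avg.
Proof.
move=> k F G; apply: L2_eq_ae.
have h1 := avg_ae (k *: F + G); have h2 := avg_ae F; have h3 := avg_ae G.
have h4 := Lrepr_lin k (avg F) (avg G).
have h5 := ae_slices1 (Lrepr_lin k F G).
have h6 := slice_sqr_fin F; have h7 := slice_sqr_fin G.
have h8 := aeS3 (fun x a b c => conj a (conj b c)) h5 h6 h7.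
have h9 := aeS3 (fun x a b c => conj a (conj b c)) h3 h4 h8.
move: h1 h2 h9; apply: aeS3 => x -> e2 [e3 [-> [e5 [f6 g6]]]]; rewrite e2 e3.
have [iF _] := slice_int_sqr (measurable_Lrepr F) f6.
have [iG _] := slice_int_sqr (measurable_Lrepr G) g6.
rewrite -RintegralZl// -RintegralD//; last first.
  by have := integrableZl measurableT k iF; congr (integrable _ _ _).
apply: ae_Rintegral_eq => //.
- exact: (measurable_fun_pair2 x (measurable_Lrepr _)).
- apply: measurable_funD; last exact: (measurable_fun_pair2 x (measurable_Lrepr _)).
  by apply: measurable_funM => //; exact: (measurable_fun_pair2 x (measurable_Lrepr _)).
Qed.

(** The right-hand side has the form in which [C12] is defined. Since [toL2] is 0 outside L^2, its
    integral must be shown square-integrable; it is so because it agrees almost everywhere with the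
    slice integral of [mulL2 m12 a F]. *)
Lemma avg_mul (a : Q1 * Q2 -> R) M (F : L2 m12) : ess_bounded m12 a M ->
  avg (mulL2 m12 a F) = toL2 m1 (fun x => \int[m2]_y (a (x, y) * Lrepr F (x, y))).
Proof.
move=> aM.
have mp : measurable_fun setT (fun p => a p * Lrepr F p).
  by apply: measurable_funM; [case: aM|exact: measurable_Lrepr].
have [sL _] := slice_int_Lfun (mulL2 m12 a F).
have E : \forall x \ae m1, slice_int (Lrepr (mulL2 m12 a F)) x =
   \int[m2]_y (a (x, y) * Lrepr F (x, y)).
  apply: filterS (ae_slices1 (mulL2_ae F aM)) => x H.
  apply: ae_Rintegral_eq => //.
  - exact: (measurable_fun_pair2 x (measurable_Lrepr _)).
  - exact: (measurable_fun_pair2 x mp).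
apply: toL2_ae => //.
apply/Lfun2P; split; first exact: (measurable_slice_int mp).
have [_ fi] := (Lfun2P m1 _).1 sL.
apply: le_lt_trans fi; rewrite le_eqVlt; apply/orP; left; apply/eqP.
apply: ae_eq_lower_integral.
- by move=> x; rewrite lee_fin sqr_ge0.
- by move=> x; rewrite lee_fin sqr_ge0.
- by apply: filterS E => x ->.
Qed.

End averaging.

Lemma Lfun_slices (dQ dS : measure_display) (Q : measurableType dQ) (S : measurableType dS)
    (R : realType) (mu : {sigma_finite_measure set Q -> \bar R})
    (nu : {sigma_finite_measure set S -> \bar R}) (a : Q * S -> R) :
  a \in Lfun (mu \x nu)%E +oo%E ->
  exists M, [/\ 0 <= M, measurable_fun setT a &
    \forall t \ae nu, ess_bounded mu (fun q => a (q, t)) M].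
Proof.
move=> /Lfun_ess_bounded[M M0 [ma aM]]; exists M; split => //.
apply: aeS (ae_slices aM) => t aMt; split => //.
exact: (measurable_fun_pair1 t ma).
Qed.

Section averaged_coefficients.
Context d1 d2 dS (Q1 : measurableType d1) (Q2 : measurableType d2)
  (S : measurableType dS) (R : realType).
Variables (m1 : {sigma_finite_measure set Q1 -> \bar R})
  (m2 : {sigma_finite_measure set Q2 -> \bar R})
  (nu : {sigma_finite_measure set S -> \bar R}).
Hypothesis m1fin : (m1 setT < +oo)%E.
Hypothesis m2fin : (m2 setT < +oo)%E.
Hypothesis nufin : (nu setT < +oo)%E.
Local Notation m12 := (m1 \x m2)%E.

Let product_sigma_finite : sigma_finite setT m12.
Proof.
exists (fun=> setT); first by rewrite bigcup_const.
move=> _; split; first exact: measurableT.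
rewrite -setXTT product_measure1E//; apply: lte_mul_pinfty => //.
by rewrite ge0_fin_numE.
Qed.

(** The product as a sigma-finite measure, so that the slice lemmas apply with the pair [(x, y)] as
    space variable. *)
Let m12' : {sigma_finite_measure set (Q1 * Q2)%type -> \bar R} :=
  HB.pack m12 (Measure_isSigmaFinite.Build _ _ _ _ product_sigma_finite).

Lemma Lfun_slices2 (nu' : {sigma_finite_measure set S -> \bar R}) (a : Q1 * Q2 * S -> R) :
  a \in Lfun (m12 \x nu')%E +oo%E ->
  exists M, [/\ 0 <= M, measurable_fun setT a &
    \forall t \ae nu', ess_bounded m12 (fun q => a (q, t)) M].
Proof. exact (@Lfun_slices _ _ _ _ _ m12' nu' a). Qed.

(** [AL1_op] for multiplication by [a(., t)] followed by [avg]; on a fixed vector, integrability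
    comes from [slice_mul_AL1] and the boundedness of [avg]. *)
Lemma AL1_avg_mul (a : Q1 * Q2 * S -> R) M (w : S -> L2 m12) : 0 <= M ->
  measurable_fun setT a ->
  (\forall t \ae nu, ess_bounded m12 (fun q => a (q, t)) M) -> AL1 nu w ->
  AL1 nu (fun t => toL2 m1 (fun x => \int[m2]_y (a (x, y, t) * Lrepr (w t) (x, y)))).
Proof.
move=> M0 ma aM wA.
pose K t (w : L2 m12) : L2 m1 := avg (mulL2 m12 (fun p => a (p, t)) w).
have KA : AL1 nu (fun t => K t (w t)).
  apply: (@AL1_op _ _ _ nu _ _ K ((fine (m2 setT) + 1) * M)) => //.
  - apply: aeS aM => t aMt; split.
      move=> k x y; rewrite /K (mulL2_linear aMt k x y).
      exact: avg_linear m2fin _ _ _.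
    move=> x; apply: le_trans (avg_norm m2fin _) _.
    rewrite -mulrA ler_wpM2l ?addr_ge0// ?fine_ge0//.
    exact: mulL2_norm.
  - move=> c.
    pose L : {linear L2 m12 -> L2 m1} := HB.pack (@avg _ _ _ _ _ m1 m2)
      (GRing.isLinear.Build _ _ _ _ _ (avg_linear m2fin)).
    apply: (@AL1_linear _ _ _ nu _ _ L (fine (m2 setT) + 1)).
      exact: avg_norm m2fin.
    apply: (@slice_mul_AL1 _ _ _ _ _ m12' nu nufin c a M M0 ma).
    by apply: aeS aM => t [].
apply: AL1_ae KA; apply: aeS aM => t aMt.
exact: (avg_mul m2fin _ aMt).
Qed.

End averaged_coefficients.

(** * Integrability of the disturbance term *)

Section dterm_regularity.
Context (R : realType) (ell d T : R).
Variables (alpha1 : R * R -> R) (lambda1 : R * R * R -> R) (alpha1' : R -> R).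
Hypothesis alpha1_Loo : alpha1 \in Lfun (muI ell \x leb `]0%R, +oo[)%E +oo%E.
Hypothesis lambda1_Loo : lambda1 \in Lfun (muO ell d \x leb `]0%R, +oo[)%E +oo%E.
Hypothesis alpha1'_Loo : alpha1' \in Lfun (muI ell) +oo%E.
Local Notation muT := (leb `]0%R, T[).

Let sub0T : [set` `]0%R, T[] `<=` [set` `]0%R, +oo[].
Proof. by move=> x; rewrite /= !in_itv/= => /andP[->]. Qed.

Lemma alpha_bounded : exists M, [/\ 0 <= M,
  measurable_fun setT (alpha1 : measurableTypeR R * measurableTypeR R -> R) &
    \forall t \ae muT, ess_bounded (muI ell) (fun x => alpha1 (x, t)) M].
Proof.
have [M [M0 m1 aM]] := @Lfun_slices _ _ _ _ R (leb `]0%R, ell[) (leb `]0%R, +oo[) alpha1 alpha1_Loo.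
by exists M; split => //; exact: ae_subitv sub0T aM.
Qed.

Lemma alpha_diff_bounded : exists M, [/\ 0 <= M,
  measurable_fun setT ((fun p => alpha1 p - alpha1' p.1) : measurableTypeR R * measurableTypeR R -> R) &
    \forall t \ae muT, ess_bounded (muI ell) (fun x => alpha1 (x, t) - alpha1' x) M].
Proof.
have [M [M0 m1 aM]] := alpha_bounded.
have [M' M0' [m2 aM']] := Lfun_ess_bounded alpha1'_Loo.
exists (M + M'); split; first exact: addr_ge0.
  by apply: measurable_funB => //; exact: (measurableT_comp m2 measurable_fst).
apply: aeS aM => t [mt at']; split; first exact: measurable_funB.
by apply: aeS2 at' aM' => x h1 h2; apply: le_trans (ler_normB _ _) (lerD h1 h2).
Qed.

Lemma AL1_mul_alpha (u : R -> L2 (muI ell)) : AL1 muT u ->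
  AL1 muT (fun t => mulL2 (muI ell) (fun x => alpha1 (x, t) - alpha1' x) (u t)).
Proof.
move=> uA; have [M [M0 m1 aM]] := alpha_diff_bounded.
apply: (@AL1_op _ _ _ muT _ _ (fun t => mulL2 (muI ell) (fun x => alpha1 (x, t) - alpha1' x)) M) => //.
- apply: aeS aM => t aMt; split; first exact: mulL2_linear aMt.
  by move=> x; exact: mulL2_norm.
- move=> c; apply: (@slice_mul_AL1 _ _ _ _ R (leb `]0%R, ell[) muT (leb_fin 0 T) c (fun p => alpha1 p - alpha1' p.1) M) => //.
  by apply: aeS aM => t [].
Qed.

Lemma AL1_C12 (v : R -> L2 (muO ell d)) : AL1 muT (fun t => pD false (v t)) ->
  AL1 muT (fun t => C12 lambda1 t (v t)).
Proof.
move=> vA.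
have [M [M0 m1 aM]] := @Lfun_slices2 _ _ _ _ _ _ R (leb `]0%R, ell[)
  (leb `]0%R, d[) (leb_fin 0 ell) (leb_fin 0 d) (leb `]0%R, +oo[) lambda1 lambda1_Loo.
exact: (@AL1_avg_mul _ _ _ _ _ _ R (leb `]0%R, ell[) (leb `]0%R, d[)
  muT (leb_fin 0 ell) (leb_fin 0 d) (leb_fin 0 T) lambda1 M _ M0 m1 (ae_subitv sub0T aM) vA).
Qed.

Lemma AL1_dterm (u : R -> L2 (muI ell)) (v : R -> L2 (muO ell d)) : AL1 muT u ->
  AL1 muT (fun t => pD false (v t)) -> AL1 muT (dterm alpha1 lambda1 alpha1' u v).
Proof.
move=> uA vA; apply: AL1D (AL1_mul_alpha uA) _.
pose L : {linear L2 (muI ell) -> L2 (muI ell)} := -%R.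
apply: (@AL1_linear _ _ _ muT _ _ L 1) (AL1_C12 vA) => x.
by rewrite normrN mul1r.
Qed.

End dterm_regularity.

(** * Semigroups with a symmetric generator *)

Section vector_derivative.
Context (R : realType) (E : normedModType R).

Lemma is_deriveP (f : R -> E) (t : R) (y : E) : is_derive t 1 f y <->
  forall e, 0 < e -> exists2 dl, 0 < dl & forall h, 0 < `|h| < dl ->
    `|h^-1 *: (f (t + h) - f t) - y| <= e.
Proof.
have eqf : (fun h => h^-1 *: ((f \o shift t) (h *: (1 : R)) - f t)) =
    (fun h => h^-1 *: (f (t + h) - f t)).
  by apply/funext => h /=; rewrite -[h *: 1]/(h * 1) mulr1 [h + t]addrC.
split=> [[df dfy] e e0|H].
  have : (fun h => h^-1 *: (f (t + h) - f t)) @ 0^' --> y.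
    by rewrite -eqf -dfy; exact: df.
  move=> /cvgrPdist_le/(_ _ e0); rewrite near_withinE => /nbhs_ballP[dl /= dl0 Hd].
  exists dl => // h /andP[h0 hd]; rewrite distrC; apply: Hd => /=.
    by rewrite -ball_normE /= sub0r normrN.
  by rewrite -normr_gt0.
have cv : (fun h => h^-1 *: (f (t + h) - f t)) @ 0^' --> y.
  apply/cvgrPdist_le => e e0; have [dl dl0 Hd] := H e e0.
  rewrite near_withinE; apply/nbhs_ballP; exists dl => //= h.
  rewrite -ball_normE /= sub0r normrN => hd h0; rewrite distrC; apply: Hd.
  by rewrite hd normr_gt0 h0.
split; first by rewrite /derivable eqf; apply/cvg_ex; exists y.
by rewrite /derive eqf; apply: cvg_lim.
Qed.

Lemma is_derive_cvg (f : R -> E) (t : R) (y : E) : is_derive t 1 f y ->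
  (fun h => h^-1 *: (f (t + h) - f t)) @ 0^' --> y.
Proof.
move=> /is_deriveP H; apply/cvgrPdist_le => e e0; have [dl dl0 Hd] := H e e0.
rewrite near_withinE; apply/nbhs_ballP; exists dl => //= h.
rewrite -ball_normE /= sub0r normrN => hd h0; rewrite distrC; apply: Hd.
by rewrite hd normr_gt0 h0.
Qed.

Lemma is_derive_dist (f : R -> E) (t : R) (y : E) : is_derive t 1 f y ->
  exists2 dl, 0 < dl & forall h, `|h| < dl -> `|f (t + h) - f t| <= (`|y| + 1) * `|h|.
Proof.
move=> /is_deriveP/(_ 1 ltr01)[dl dl0 Hd]; exists dl => // h hd.
have [->|h0] := eqVneq h 0; first by rewrite addr0 subrr !normr0 mulr0.
have nh : 0 < `|h| by rewrite normr_gt0.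
have := Hd h; rewrite nh hd => /(_ isT) H.
have -> : f (t + h) - f t = h *: (h^-1 *: (f (t + h) - f t)).
  by rewrite scalerA divff// scale1r.
rewrite normrZ mulrC ler_pM2r//.
rewrite -[X in `|X|](subrK y); apply: le_trans (ler_normD _ _) _.
by rewrite addrC lerD2l.
Qed.

Lemma is_derive_cont (f : R -> E) (t : R) (y : E) : is_derive t 1 f y -> {for t, continuous f}.
Proof.
move=> /is_derive_dist[dl dl0 Hd]; apply/cvgrPdist_le => e e0.
have k0 : 0 < `|y| + 1 by rewrite ltr_wpDl.
apply/nbhs_ballP; exists (Num.min dl (e / (`|y| + 1))).
  by rewrite /= lt_min dl0 divr_gt0.
move=> s /=; rewrite lt_min => /andP[s1 s2].
have := Hd (s - t); rewrite [t + _]addrC subrK distrC s1 => /(_ isT) H.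
rewrite distrC; apply: le_trans H _.
by rewrite mulrC -ler_pdivlMr// ltW.
Qed.

Lemma is_derive_reflect (g : R -> E) (a t : R) (y : E) : is_derive (a - t) 1 g y ->
  is_derive t 1 (fun s => g (a - s)) (- y).
Proof.
move=> /is_deriveP H; apply/is_deriveP => e /H[dl dl0 Hd]; exists dl => // h hd.
have := Hd (- h); rewrite normrN => /(_ hd).
suff -> : h^-1 *: (g (a - (t + h)) - g (a - t)) - - y =
    - ((- h)^-1 *: (g (a - t - h) - g (a - t)) - y) by rewrite normrN.
by rewrite invrN scaleNr (opprD (- _)) !opprK (opprD t) addrA.
Qed.

End vector_derivative.

Section inner_derivative.
Context (R : realType) (E : normedModType R) (ip : E -> E -> R).
Hypothesis ipP : inner_product ip.

Lemma is_derive_inner (f g : R -> E) (t : R) (f' g' : E) : is_derive t 1 f f' -> is_derive t 1 g g' ->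
  is_derive t 1 (fun s => ip (f s) (g s)) (ip f' (g t) + ip (f t) g').
Proof.
move=> df dg.
have eqf : (fun h => h^-1 *: (((fun s => ip (f s) (g s)) \o shift t) (h *: (1 : R)) - ip (f t) (g t))) =
    (fun h => ip (h^-1 *: (f (t + h) - f t)) (g (t + h)) + ip (f t) (h^-1 *: (g (t + h) - g t))).
  apply/funext => h /=; rewrite -[h *: 1]/(h * 1) mulr1 [h + t]addrC.
  rewrite -[LHS]/(h^-1 * _) (innerZl ipP) (innerZr ipP) (innerBl ipP) (innerBr ipP).
  by rewrite -mulrDr addrA subrK.
have cg : (fun h => g (t + h)) @ 0^' --> g t.
  have := is_derive_cont dg => /cvgrPdist_le H; apply/cvgrPdist_le => e /H.
  move=> /nbhs_ballP[dl /= dl0 Hd]; rewrite near_withinE; apply/nbhs_ballP; exists dl => //= h.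
  rewrite -ball_normE /= sub0r normrN => hd _; apply: Hd.
  by rewrite -ball_normE /= opprD addrA subrr sub0r normrN.
have cv : (fun h => ip (h^-1 *: (f (t + h) - f t)) (g (t + h)) +
    ip (f t) (h^-1 *: (g (t + h) - g t))) @ 0^' --> ip f' (g t) + ip (f t) g'.
  apply: cvgD; apply: cvg_inner => //; first exact: is_derive_cvg.
    exact: cvg_cst.
  exact: is_derive_cvg.
split; first by rewrite /derivable eqf; apply/cvg_ex; eexists; exact: cv.
by rewrite /derive eqf; apply: cvg_lim.
Qed.

(* the mean value inequality, obtained by testing with [f b - f a - (b - a) y] *)
Lemma mvt_inner (f f' : R -> E) (a b : R) (y : E) (C : R) : a <= b ->
  {within `[a, b], continuous f} ->
  (forall s, s \in `]a, b[ -> is_derive s 1 f (f' s)) ->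
  (forall s, s \in `]a, b[ -> `|f' s - y| <= C) ->
  `|f b - f a - (b - a) *: y| <= C * (b - a).
Proof.
rewrite le_eqVlt => /predU1P[<- _ _ _|ab cf df fC].
  by rewrite !subrr scale0r subrr normr0 mulr0.
set w := f b - f a - _.
have [->|w0] := eqVneq w 0.
  have C0 : 0 <= C.
    apply: le_trans (fC ((a + b) / 2) _); first exact: normr_ge0.
    by rewrite in_itv/= midf_lt// midf_lt.
  by rewrite normr0 mulr_ge0// subr_ge0 ltW.
have cstd (s : R) : is_derive s 1 (fun=> w) 0 by exact: is_derive_cst.
have dF (s : R) : s \in `]a, b[ -> is_derive s 1 (fun s => ip (f s) w) (ip (f' s) w).
  move=> /df dfs; have := is_derive_inner dfs (cstd s).
  by rewrite (inner0r ipP) addr0.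
have cF : {within `[a, b], continuous (fun s => ip (f s) w)}.
  move=> s; apply: (cvg_inner ipP); [exact: cf|exact: cvg_cst].
have [c cab H] := MVT ab dF cF.
have : `|w| ^+ 2 <= C * (b - a) * `|w|.
  rewrite -(inner_norm ipP) {1}/w (innerBl ipP) (innerBl ipP) (innerZl ipP) H.
  rewrite [ip (f' c) w * _]mulrC -mulrBr -(innerBl ipP) mulrAC.
  rewrite [leRHS]mulrC ler_pM2l ?subr_gt0//.
  apply: le_trans (ler_norm _) _; apply: le_trans (inner_CS ipP _ _) _.
  by rewrite ler_wpM2r// fC.
by rewrite expr2 ler_pM2r// normr_gt0.
Qed.

End inner_derivative.

Section semigroup_bounds.
Context (R : realType) (E : completeNormedModType R).
Variable S : R -> E -> E.
Hypothesis S_C0 : C0_semigroup S.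

Definition sg_map t (t0 : 0 <= t) : {linear E -> E} :=
  HB.pack (S t) (GRing.isLinear.Build _ _ _ _ _ (C0_linear S_C0 t0)).

Lemma sgB t x y : 0 <= t -> S t (x - y) = S t x - S t y.
Proof. by move=> t0; exact: (linearB (sg_map t0)). Qed.

Lemma sgD t x y : 0 <= t -> S t (x + y) = S t x + S t y.
Proof. by move=> t0; exact: (linearD (sg_map t0)). Qed.

Lemma sgZ t a x : 0 <= t -> S t (a *: x) = a *: S t x.
Proof. by move=> t0; rewrite -[S t]/(sg_map t0 : E -> E) linearZ. Qed.

Lemma sg_bounded1 t : 0 <= t -> exists2 M, 1 <= M & forall x, `|S t x| <= M * `|x|.
Proof.
move=> t0; have := (linear_bounded_continuous (sg_map t0)).2 (C0_bounded S_C0 t0).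
move=> /linear_boundedP H.
have [M [M1 HM]] : exists M : R, 1 <= M /\ forall x, `|S t x| <= M * `|x|.
  near +oo_R => M; exists M; split; near: M; last exact: H.
  exact: nbhs_pinfty_ge.
by exists M.
Unshelve. all: end_near. Qed.

Lemma sg_cvg0 x e : 0 < e -> exists2 dl, 0 < dl & forall t, 0 <= t < dl -> `|S t x - x| <= e.
Proof.
move=> e0; have := @C0_strong _ _ _ S_C0 x => /cvgrPdist_le/(_ _ e0).
rewrite near_withinE => /nbhs_ballP[dl /= dl0 H]; exists dl => // t /andP[].
rewrite le_eqVlt => /predU1P[<- _|t0 td].
  by rewrite (C0_id S_C0) subrr normr0 ltW.
by rewrite distrC; apply: H => //=; rewrite -?ball_normE /= ?sub0r ?normrN gtr0_norm.
Qed.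

(** Otherwise there are times [t n <= 1 / (n + 1)] at which the norm of the semigroup exceeds
    [n + 1]. Strong continuity at 0 makes this sequence of operators pointwise bounded, against the
    Banach-Steinhaus theorem. *)
Lemma sg_bounded_near0 : exists dl M, [/\ 0 < dl, 1 <= M &
  forall t x, 0 <= t <= dl -> `|S t x| <= M * `|x|].
Proof.
apply: contrapT => H.
have /choice[t Ht] : forall n : nat, exists t : R, 0 <= t <= n.+1%:R^-1 /\
    exists x, n.+1%:R * `|x| < `|S t x|.
  move=> n; apply: contrapT => Hn; apply: H; exists n.+1%:R^-1, n.+1%:R.
  split; [by rewrite invr_gt0|by rewrite ler1n|].
  move=> t x tn; rewrite leNgt; apply/negP => h; apply: Hn.
  by exists t; split => //; exists x.
have t0 n : 0 <= t n by have [/andP[]] := Ht n.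
have bf : forall f, range (fun n => S (t n)) f -> bounded_fun_norm f /\ linear f.
  move=> _ [n _ <-]; split; last exact: (C0_linear S_C0).
  have [M M1 HM] := sg_bounded1 (t0 n).
  move=> r; exists (M * r) => x xr; apply: le_trans (HM x) _.
  by rewrite ler_wpM2l// (le_trans _ M1).
have pb : pointwise_bounded (range (fun n => S (t n))).
  move=> x; have [dl dl0 Hd] := sg_cvg0 x ltr01.
  have [N _ HN] := near_infty_natSinv_lt (PosNum dl0).
  (* Once [t n < dl], the orbit is within 1 of [x]; the finitely many earlier indices are covered by
     the sum. *)
  exists (`|x| + 1 + \sum_(n < N) `|S (t n) x|) => _ [n _ <-].
  have [nN|nN] := ltnP n N.
    apply: le_trans (_ : \sum_(n < N) `|S (t n) x| <= _); last by rewrite lerDr addr_ge0.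
    by rewrite (bigD1 (Ordinal nN))//= lerDl sumr_ge0.
  apply: (@le_trans _ _ (`|x| + 1)); last by rewrite lerDl sumr_ge0.
  rewrite -(subrK x (S (t n) x)); apply: le_trans (ler_normD _ _) _.
  rewrite addrC lerD2l; apply: Hd; rewrite t0/=.
  by have [/andP[_ tn] _] := Ht n; apply: le_lt_trans tn _; exact: HN.
have [M HM] := Banach_Steinhauss bf pb 1.
pose n := Num.truncn M.
have [_ [x Hx]] := Ht n.
have x0 : 0 < `|x|.
  rewrite normr_gt0; apply/eqP => x0; move: Hx; rewrite x0 normr0 mulr0.
  by rewrite -(scale0r (0 : E)) sgZ// scale0r normr0 ltxx.
have := HM _ (ex_intro2 _ _ n I erefl) (`|x|^-1 *: x).
rewrite normrZ normfV normr_id mulVf ?gt_eqF// => /(_ (lexx _)).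
rewrite sgZ// normrZ normfV normr_id ler_pdivrMl// leNgt => /negP; apply.
apply: le_lt_trans Hx; rewrite mulrC ler_pM2r//; apply: ltW; exact: truncnS_gt.
Qed.

(** [[0, T]] is covered by finitely many steps of length [dl], each of which costs a factor [M]. *)
Lemma sg_bounded T : exists2 M, 1 <= M & forall t x, 0 <= t <= T -> `|S t x| <= M * `|x|.
Proof.
have [dl [M [dl0 M1 H]]] := sg_bounded_near0.
have M0 : 0 <= M by exact: le_trans M1.
have step n t x : 0 <= t <= n%:R * dl -> `|S t x| <= M ^+ n * `|x|.
  elim: n t x => [|n IH] t x.
    rewrite mul0r -eq_le => /eqP <-.
    by rewrite (C0_id S_C0) expr0 mul1r.
  move=> /andP[t0 tn]; have [td|td] := leP t dl.
    apply: le_trans (H t x _) _; first by rewrite t0.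
    by rewrite ler_wpM2r// exprS ler_peMr// exprn_ege1.
  have tdl : 0 <= t - dl by rewrite subr_ge0 ltW.
  have -> : S t x = S dl (S (t - dl) x).
    by rewrite -(C0_add S_C0 (ltW dl0) tdl) addrC subrK.
  apply: le_trans (H _ _ _) _; first by rewrite lexx ltW.
  rewrite exprS -mulrA ler_wpM2l//; apply: IH.
  by rewrite tdl lerBlDr; move: tn; rewrite -natr1 mulrDl mul1r.
pose n := (Num.truncn (T / dl)).+1.
have nT : T <= n%:R * dl by rewrite -ler_pdivrMr//; apply: ltW; exact: truncnS_gt.
exists (M ^+ n); first exact: exprn_ege1.
by move=> t x /andP[t0 tT]; apply: step; rewrite t0 (le_trans tT).
Qed.

(** For [s <= t] one has [S s x - S t x = S s (x - S (t - s) x)], so right continuity at 0 and the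
    bound on [[0, T]] give continuity from both sides, uniformly. *)
Lemma sg_unif_cont T x e : 0 < e -> exists2 dl, 0 < dl & forall s t,
  0 <= s <= T -> 0 <= t <= T -> `|s - t| < dl -> `|S s x - S t x| <= e.
Proof.
move=> e0; have [M M1 HM] := sg_bounded T; have M0 : 0 < M by exact: lt_le_trans M1.
have [dl dl0 Hd] := sg_cvg0 x (divr_gt0 e0 M0); exists dl => //.
have le s t : 0 <= s <= T -> 0 <= t <= T -> s <= t -> `|s - t| < dl -> `|S s x - S t x| <= e.
  move=> /andP[s0 sT] /andP[t0 tT] st d.
  have ts0 : 0 <= t - s by rewrite subr_ge0.
  have -> : S t x = S s (S (t - s) x) by rewrite -(C0_add S_C0)// addrC subrK.
  rewrite -sgB//; apply: le_trans (HM _ _ _) _; first by rewrite s0.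
  rewrite mulrC -ler_pdivlMr// distrC; apply: Hd; rewrite ts0.
  by move: d; rewrite distrC ger0_norm.
move=> s t hs ht d; have [st|ts] := leP s t; first exact: le.
by rewrite distrC; apply: le => //; [exact: ltW|rewrite distrC].
Qed.

Lemma sg_cvg (T : Type) (F : set_system T) (FF : Filter F) (tau : T -> R) (f : T -> E) (t : R) (x : E) :
  0 <= t -> tau @ F --> t -> (\forall s \near F, 0 <= tau s) -> f @ F --> x ->
  (fun s => S (tau s) (f s)) @ F --> S t x.
Proof.
move=> t0 ct tau0 cf; apply/cvgrPdist_le => e e0.
have [M M1 HM] := sg_bounded (t + 1); have M0 : 0 < M by exact: lt_le_trans M1.
have e2 : 0 < e / 2 by rewrite divr_gt0.
have [dl dl0 Hd] := sg_unif_cont (t + 1) x e2.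
have /cvgrPdist_le/(_ _ (divr_gt0 e2 M0)) H1 := cf.
have /cvgrPdist_lt/(_ _ dl0) H2 := ct.
have /cvgrPdist_lt/(_ _ ltr01) H3 := ct.
near=> s.
have s0 : 0 <= tau s by near: s.
have sT : 0 <= tau s <= t + 1.
  rewrite s0 /=; have : `|t - tau s| < 1 by near: s.
  by rewrite ltr_norml => /andP[h _]; lra.
have -> : S t x - S (tau s) (f s) = (S t x - S (tau s) x) + S (tau s) (x - f s).
  by rewrite sgB// addrA subrK.
apply: le_trans (ler_normD _ _) _; rewrite [e]splitr lerD//.
  apply: Hd => //; first by rewrite t0 lerDl ler01.
  by near: s.
apply: le_trans (HM _ _ sT) _; rewrite mulrC -ler_pdivlMr//.
by near: s.
Unshelve. all: end_near. Qed.

Lemma sg_within (K : set R) (tau : R -> R) (f : R -> E) :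
  {within K, continuous tau} -> {within K, continuous f} -> (forall s, K s -> 0 <= tau s) ->
  {within K, continuous (fun s => S (tau s) (f s))}.
Proof.
move=> /subspace_continuousP ct /subspace_continuousP cf tau0.
apply/subspace_continuousP => s Ks; apply: sg_cvg; [exact: tau0|exact: ct| |exact: cf].
by rewrite near_withinE; apply: nearW => r; exact: tau0.
Qed.

End semigroup_bounds.

Lemma isB_cst (R : realType) (E : normedModType R) (a b : R) (c : E) : a <= b ->
  isB (leb `]a, b[) (fun=> c) ((b - a) *: c).
Proof.
move=> ab; have hs : is_simple (leb `]a, b[) [:: (setT, c)].
  apply/is_simple_cons; split; [exact: measurableT|exact: leb_fin|by move=> p].
have := isB_simple hs; rewrite /simple_integral big_seq1 /=.
rewrite (leb_itv_setT ab) /=; congr (isB _ _ _); apply/funext => s.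
by rewrite /simple_fun big_seq1 /= indicT scale1r.
Qed.

Lemma isB_leb_norm (R : realType) (E : normedModType R) (a b : R) (f : R -> E) w C :
  a <= b -> isB (leb `]a, b[) f w -> 0 <= C -> (forall t, a < t < b -> `|f t| <= C) ->
  `|w| <= C * (b - a).
Proof.
move=> ab fw C0 H; have eq := leb_itv_setT ab.
have -> : b - a = fine (leb `]a, b[ setT) by rewrite eq.
apply: (isB_norm_cst (leb_fin a b) fw C0); apply: leb_aeW => t.
by rewrite in_itv/=; exact: H.
Qed.

(** * The generator and its domain *)

Section generator_facts.
Context (R : realType) (E : completeNormedModType R).
Variables (S : R -> E -> E) (dom : set E) (A : E -> E).
Hypothesis S_C0 : C0_semigroup S.
Hypothesis S_gen : generator S dom A.

Lemma generatorP x y : (dom x /\ y = A x) <->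
  forall e, 0 < e -> exists2 dl, 0 < dl & forall h, 0 < h < dl ->
   `|h^-1 *: (S h x - x) - y| <= e.
Proof.
split=> [/S_gen H e e0|H].
  move: H => /cvgrPdist_le/(_ _ e0); rewrite near_withinE => /nbhs_ballP[dl /= dl0 H].
  exists dl => // h /andP[h0 hd]; rewrite distrC; apply: H => //=.
  by rewrite -?ball_normE /= ?sub0r ?normrN gtr0_norm.
apply/S_gen/cvgrPdist_le => e /H[dl dl0 Hd]; rewrite near_withinE; apply/nbhs_ballP.
exists dl => //= h; rewrite -?ball_normE /= ?sub0r ?normrN => hd h0.
by rewrite distrC; apply: Hd; rewrite h0 -(gtr0_norm h0).
Qed.

Lemma dom_linear a x y : dom x -> dom y -> dom (a *: x + y) /\ A (a *: x + y) = a *: A x + A y.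
Proof.
move=> dx dy.
have Hx := (generatorP x (A x)).1 (conj dx erefl).
have Hy := (generatorP y (A y)).1 (conj dy erefl).
suff [? ->] : dom (a *: x + y) /\ a *: A x + A y = A (a *: x + y) by [].
apply/generatorP => e e0.
have k0 : 0 < `|a| + 1 by rewrite ltr_wpDl.
have e2 : 0 < e / 2 by rewrite divr_gt0.
have [d1 d10 H1] := Hx _ (divr_gt0 e2 k0); have [d2 d20 H2] := Hy _ e2.
exists (Num.min d1 d2); first by rewrite lt_min d10.
move=> h; rewrite lt_min => /and3P[h0 h1 h2].
have -> : h^-1 *: (S h (a *: x + y) - (a *: x + y)) - (a *: A x + A y) =
    a *: (h^-1 *: (S h x - x) - A x) + (h^-1 *: (S h y - y) - A y).
  rewrite (sgD S_C0 _ _ (ltW h0)) (sgZ S_C0 _ _ (ltW h0)) opprD addrACA -scalerBr.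
  by rewrite scalerDr scalerA [h^-1 * a]mulrC -scalerA opprD addrACA -scalerBr.
apply: le_trans (ler_normD _ _) _; rewrite [e]splitr lerD//; last by apply: H2; rewrite h0.
rewrite normrZ; have := H1 h; rewrite h0 h1 => /(_ isT) H.
apply: le_trans (ler_wpM2l _ H) _ => //.
by rewrite mulrCA ler_piMr ?(ltW e2)// ler_pdivrMr// mul1r lerDl.
Qed.

Lemma dom0 : dom 0 /\ A 0 = 0.
Proof.
suff [? <-] : dom 0 /\ 0 = A 0 by [].
apply/generatorP => e e0; exists 1; first exact: ltr01.
move=> h /andP[h0 _]; have {}h0 := ltW h0.
have -> : S h 0 = 0 by rewrite -(subrr (0 : E)) (sgB S_C0)// !subrr.
by rewrite !subr0 scaler0 normr0 ltW.
Qed.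

Lemma domZ a x : dom x -> dom (a *: x) /\ A (a *: x) = a *: A x.
Proof.
by move=> dx; have := dom_linear a dx dom0.1; rewrite !addr0 dom0.2 addr0.
Qed.

Lemma sg_dom t x : 0 <= t -> dom x -> dom (S t x) /\ A (S t x) = S t (A x).
Proof.
move=> t0 dx; have Hx := (generatorP x (A x)).1 (conj dx erefl).
suff [? ->] : dom (S t x) /\ S t (A x) = A (S t x) by [].
apply/generatorP => e e0.
have [M M1 HM] := sg_bounded1 S_C0 t0; have M0 : 0 < M by exact: lt_le_trans M1.
have [dl dl0 Hd] := Hx _ (divr_gt0 e0 M0); exists dl => // h /[dup] hh /andP[h0 _].
rewrite -(C0_add S_C0 (ltW h0) t0) [h + t]addrC (C0_add S_C0 t0 (ltW h0)).
rewrite -(sgB S_C0)// -(sgZ S_C0)// -(sgB S_C0)//.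
by apply: le_trans (HM _) _; rewrite mulrC -ler_pdivlMr//; exact: Hd.
Qed.

(** The generator only provides a right derivative. The left difference quotient with step [k] is
    [S (t - k)] applied to the right quotient of [x] at 0, and converges by the local bound and
    strong continuity. *)
Lemma sg_derive (t : R) x : 0 < t -> dom x -> is_derive t 1 (fun s => S s x) (S t (A x)).
Proof.
move=> t0 dx; have Hx := (generatorP x (A x)).1 (conj dx erefl).
apply/is_deriveP => e e0.
have [M M1 HM] := sg_bounded S_C0 t; have M0 : 0 < M by exact: lt_le_trans M1.
have e2 : 0 < e / 2 by rewrite divr_gt0.
have [d1 d10 H1] := Hx _ (divr_gt0 e2 M0).
have [d2 d20 H2] := sg_unif_cont S_C0 t (A x) e2.
exists (Num.min d1 (Num.min d2 t)); first by rewrite !lt_min d10 d20.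
move=> h; rewrite !lt_min => /and4P[nh h1 h2 h3].
have [hn|hp] := ltP h 0; last first.
  have h0 : 0 < h by rewrite lt_neqAle hp andbT eq_sym -normr_gt0.
  rewrite (C0_add S_C0 (ltW t0) hp) -(sgB S_C0) ?(ltW t0)// -(sgZ S_C0) ?(ltW t0)//.
  rewrite -(sgB S_C0) ?(ltW t0)//.
  apply: le_trans (HM _ _ _) _; first by rewrite lexx ltW.
  have := H1 h; rewrite h0 -{1}(gtr0_norm h0) h1 => /(_ isT) H.
  apply: le_trans (ler_wpM2l (ltW M0) H) _.
  by rewrite mulrC divfK ?gt_eqF// ler_pdivrMr// ler_peMr ?ler1n// ltW.
pose k := - h; have k0 : 0 < k by rewrite oppr_gt0.
have kE : `|h| = k by rewrite ltr0_norm.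
rewrite kE in h1 h2 h3.
have tk0 : 0 <= t - k by rewrite subr_ge0 ltW.
have -> : t + h = t - k by rewrite /k opprK.
have -> : h^-1 *: (S (t - k) x - S t x) = k^-1 *: (S t x - S (t - k) x).
  by rewrite /k invrN scaleNr -scalerN opprB.
have -> : S t x = S (t - k) (S k x) by rewrite -(C0_add S_C0 tk0 (ltW k0)) subrK.
rewrite -(sgB S_C0)// -(sgZ S_C0)//.
have -> : S (t - k) (k^-1 *: (S k x - x)) - S t (A x) =
    S (t - k) (k^-1 *: (S k x - x) - A x) + (S (t - k) (A x) - S t (A x)).
  by rewrite (sgB S_C0)// addrA subrK.
apply: le_trans (ler_normD _ _) _; rewrite [e]splitr lerD//.
  apply: le_trans (HM _ _ _) _; first by rewrite tk0 gerBl ltW.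
  by rewrite mulrC -ler_pdivlMr//; apply: H1; rewrite k0.
apply: H2; rewrite ?tk0 ?lexx ?(ltW t0)//=; first by rewrite gerBl ltW.
by rewrite addrAC subrr sub0r normrN gtr0_norm.
Qed.

Lemma sg_within1 (K : set R) x : (forall s, K s -> 0 <= s) ->
  {within K, continuous (fun s => S s x)}.
Proof.
move=> K0; apply: (sg_within S_C0) => //.
  by apply: continuous_subspaceT => s; exact: cvg_id.
by apply: continuous_subspaceT => s; exact: cvg_cst.
Qed.

Lemma sg_AL1 T x a : 0 <= a -> AL1 (leb `]a, T[) (fun s => S s x).
Proof.
move=> a0; apply: continuous_AL1; apply: sg_within1 => s /=.
by rewrite in_itv/= => /andP[as_ _]; exact: le_trans as_.
Qed.

(** [S k] maps the integral over [(0, h)] to the one over [(k, h + k)]. The difference quotient is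
    therefore the average over [(h, h + k)] minus the average over [(0, k)], and these tend to
    [S h x] and [x]. *)
Lemma sg_int_dom h w x : 0 < h -> isB (leb `]0, h[) (fun s => S s x) w ->
  dom w /\ A w = S h x - x.
Proof.
move=> h0 Iw.
have fin (a b : R) : (leb `]a, b[ setT < +oo)%E by exact: leb_fin.
have avg (a e : R) : 0 <= a -> 0 < e -> exists2 dl, 0 < dl & forall k v, 0 < k < dl ->
    isB (leb `]a, a + k[) (fun s => S s x) v -> `|k^-1 *: v - S a x| <= e.
  move=> a0 e0; have [dl dl0 Hd] := sg_unif_cont S_C0 (a + 1) x e0.
  exists (Num.min dl 1); first by rewrite lt_min dl0 ltr01.
  move=> k v; rewrite lt_min => /and3P[k0 kd k1] Iv.
  have Ic : isB (leb `]a, a + k[) (fun _ : R => - S a x) (- (k *: S a x)).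
    have := @isB_cst R E a (a + k) (- S a x).
    by rewrite lerDl (ltW k0) [a + k - a]addrAC subrr add0r scalerN; exact.
  have aak : a <= a + k by rewrite lerDl ltW.
  have H : `|v - k *: S a x| <= e * k.
    have := isB_leb_norm aak (isBD Iv Ic) (ltW e0); rewrite [a + k - a]addrAC subrr add0r.
    apply => s /andP[as_ sk]; apply: Hd.
    - by rewrite (le_trans a0 (ltW as_))/= (le_trans (ltW sk))// lerD2l ltW.
    - by rewrite a0 lerDl ler01.
    - rewrite ger0_norm; last by rewrite subr_ge0 ltW.
      by rewrite ltrBlDl; apply: lt_trans sk _; rewrite ltrD2l.
  have -> : k^-1 *: v - S a x = k^-1 *: (v - k *: S a x).
    by rewrite scalerBr scalerA mulVf ?gt_eqF// scale1r.
  by rewrite normrZ normfV gtr0_norm// ler_pdivrMl// mulrC.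
suff [? ->] : dom w /\ S h x - x = A w by [].
apply/generatorP => e e0; have e2 : 0 < e / 2 by rewrite divr_gt0.
have [d1 d10 H1] := avg h _ (ltW h0) e2; have [d2 d20 H2] := avg 0 _ (lexx 0) e2.
exists (Num.min d1 d2); first by rewrite lt_min d10.
move=> k; rewrite lt_min => /and3P[k0 k1 k2].
have [w1 Iw1] := AL1_isB (fin h (h + k)) (@sg_AL1 (h + k) x h (ltW h0)).
have [w2 Iw2] := AL1_isB (fin 0 (0 + k)) (@sg_AL1 (0 + k) x 0 (lexx 0)).
have [M M1 HM] := sg_bounded1 S_C0 (ltW k0).
have Iw3 : isB (leb `]k, h + k[) (fun s => S s x) (S k w).
  have := isB_linear (L := sg_map S_C0 (ltW k0)) HM Iw; rewrite /= => I3.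
  have := @isB_shift R E k (h + k) (- k) (fun s => S k (S s x)) (S k w).
  rewrite subrr addrK => /(_ I3); apply: isB_ae; apply: leb_aeW => s.
  rewrite in_itv/= => /andP[ks _].
  by rewrite -(C0_add S_C0 (ltW k0)) ?subr_ge0 ?(ltW ks)// addrC subrK.
have hk : 0 <= h <= h + k by rewrite (ltW h0) lerDl ltW.
have kh : 0 <= k <= h + k by rewrite (ltW k0) lerDr ltW.
have A0 := @sg_AL1 (h + k) x 0 (lexx 0).
have I1 := isB_cat hk A0 Iw Iw1.
rewrite add0r in Iw2.
have I2 := isB_cat kh A0 Iw2 Iw3.
have eqw := isB_unique (fin _ _) I1 I2.
have -> : S k w - w = w1 - w2.
  by apply/eqP; rewrite subr_eq addrAC eq_sym subr_eq [w1 + w]addrC eqw addrC.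
have -> : k^-1 *: (w1 - w2) - (S h x - x) =
    (k^-1 *: w1 - S h x) - (k^-1 *: w2 - x).
  by rewrite scalerBr !opprB [LHS]addrACA [RHS]addrACA; congr (_ + _); exact: addrC.
apply: le_trans (ler_normB _ _) _; rewrite [e]splitr lerD//.
  by apply: H1 Iw1; rewrite k0.
have := H2 k w2; rewrite add0r (C0_id S_C0) k0 k2 => /(_ isT); exact.
Qed.

(** The averages of the orbit of [y] over [(0, h)] lie in the domain and tend to [y]. *)
Lemma dom_dense y e : 0 < e -> exists2 z, dom z & `|y - z| <= e.
Proof.
move=> e0; have [dl dl0 Hd] := sg_cvg0 S_C0 y e0.
pose h := dl / 2; have h0 : 0 < h by rewrite divr_gt0.
have hd : h < dl by rewrite /h ltr_pdivrMr// ltr_pMr// ltr1n.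
have [w Iw] := AL1_isB (leb_fin 0 h) (@sg_AL1 h y 0 (lexx 0)).
have [dw _] := sg_int_dom h0 Iw.
exists (h^-1 *: w); first by have [] := domZ h^-1 dw.
have Ic : isB (leb `]0, h[) (fun _ : R => - y) (- (h *: y)).
  by have := isB_cst (- y) (ltW h0); rewrite subr0 scalerN.
have H : `|w - h *: y| <= e * h.
  have := isB_leb_norm (ltW h0) (isBD Iw Ic) (ltW e0); rewrite subr0.
  by apply => s /andP[s0 sh]; apply: Hd; rewrite (ltW s0) (lt_trans sh).
have -> : y - h^-1 *: w = - (h^-1 *: (w - h *: y)).
  by rewrite scalerBr scalerA mulVf ?gt_eqF// scale1r opprB.
by rewrite normrN normrZ normfV gtr0_norm// ler_pdivrMl// mulrC.
Qed.

Section selfadjoint.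
Variable ip : E -> E -> R.
Hypothesis ipP : inner_product ip.
Hypothesis A_sym : forall x y, dom x -> dom y -> ip (A x) y = ip x (A y).

(** For [x] and [y] in the domain, [<S s x, S (t - s) y>] has zero derivative in [s] by the symmetry
    of [A]; its values at 0 and [t] are the two sides. Density then removes the restriction on [y]
    and on [x] in turn. *)
Lemma sg_selfadjoint t x y : 0 <= t -> ip (S t x) y = ip x (S t y).
Proof.
move=> t0.
have [M M1 HM] := sg_bounded1 S_C0 t0.
have key x' y' : dom x' -> dom y' -> ip (S t x') y' = ip x' (S t y').
  move=> dx dy; move: t0; rewrite le_eqVlt => /predU1P[<-|t_gt0].
    by rewrite !(C0_id S_C0).
  have t0 := ltW t_gt0.
  have dF (s : R) : s \in `]0, t[ ->
      is_derive s 1 (fun s => ip (S s x') (S (t - s) y')) ((fun=> 0) s).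
    rewrite in_itv/= => /andP[s0 st].
    have ts0 : 0 < t - s by rewrite subr_gt0.
    have h1 := sg_derive s0 dx.
    have h2 := is_derive_reflect (sg_derive ts0 dy).
    have := is_derive_inner ipP h1 h2; rewrite (innerNr ipP).
    have [d1 e1] := sg_dom (ltW s0) dx; have [d2 e2] := sg_dom (ltW ts0) dy.
    by rewrite -e1 -e2 (A_sym d1 d2) subrr.
  have cF : {within `[0, t], continuous (fun s => ip (S s x') (S (t - s) y'))}.
    have c1 : {within `[0, t], continuous (fun s => S s x')}.
      by apply: sg_within1 => s /=; rewrite in_itv/= => /andP[].
    have c2 : {within `[0, t], continuous (fun s => S (t - s) y')}.
      apply: (sg_within S_C0).
      - apply: continuous_subspaceT => s; apply: cvgB; [exact: cvg_cst|exact: cvg_id].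
      - by apply: continuous_subspaceT => s; exact: cvg_cst.
      - by move=> s /=; rewrite in_itv/= subr_ge0 => /andP[].
    by move=> s; apply: (cvg_inner ipP); [exact: c1|exact: c2].
  have [c _] := MVT t_gt0 dF cF.
  rewrite mul0r subrr subr0 !(C0_id S_C0) => /eqP.
  by rewrite subr_eq0 => /eqP.
have keyx x' : dom x' -> ip (S t x') y = ip x' (S t y).
  move=> dx; apply/eqP; rewrite -subr_eq0 -normr_le0; apply/ler_addgt0Pl => e e0.
  rewrite addr0.
  (* Each of the two error terms is at most [M |x'| |y - z|]. *)
  have k0 : 0 < 2 * (M * `|x'|) + 1 by rewrite ltr_wpDl// !mulr_ge0// (le_trans _ M1).
  have [z dz yz] := dom_dense y (divr_gt0 e0 k0).
  have -> : ip (S t x') y - ip x' (S t y) = ip (S t x') (y - z) - ip x' (S t (y - z)).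
    by rewrite (sgB S_C0)// !(innerBr ipP) (key _ _ dx dz); ring.
  apply: le_trans (ler_normB _ _) _.
  have h1 := inner_CS ipP (S t x') (y - z); have h2 := inner_CS ipP x' (S t (y - z)).
  have h3 := HM x'; have h4 := HM (y - z).
  have h5 : `|S t x'| * `|y - z| <= M * `|x'| * `|y - z| by rewrite ler_wpM2r.
  have h6 : `|x'| * `|S t (y - z)| <= `|x'| * (M * `|y - z|) by rewrite ler_wpM2l.
  have h7 : (2 * (M * `|x'|) + 1) * `|y - z| <= e by rewrite mulrC -ler_pdivlMr.
  have h8 : 0 <= `|y - z| by [].
  lra.
apply/eqP; rewrite -subr_eq0 -normr_le0; apply/ler_addgt0Pl => e e0.
rewrite addr0.
have k0 : 0 < 2 * (M * `|y|) + 1 by rewrite ltr_wpDl// !mulr_ge0// (le_trans _ M1).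
have [z dz yz] := dom_dense x (divr_gt0 e0 k0).
have -> : ip (S t x) y - ip x (S t y) = ip (S t (x - z)) y - ip (x - z) (S t y).
  by rewrite (sgB S_C0)// !(innerBl ipP) (keyx _ dz); ring.
apply: le_trans (ler_normB _ _) _.
have h1 := inner_CS ipP (S t (x - z)) y; have h2 := inner_CS ipP (x - z) (S t y).
have h3 := HM y; have h4 := HM (x - z).
have h5 : `|x - z| * `|S t y| <= `|x - z| * (M * `|y|) by rewrite ler_wpM2l.
have h6 : `|S t (x - z)| * `|y| <= M * `|x - z| * `|y| by rewrite ler_wpM2r.
have h7 : (2 * (M * `|y|) + 1) * `|x - z| <= e by rewrite mulrC -ler_pdivlMr.
have h8 : 0 <= `|x - z| by [].
lra.
Qed.

(* tested with [phi] in the domain, the difference quotient of [S] at [x] is a value of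
   [<S s y, phi>] with [s] between [0] and [h], by the mean value theorem *)
Lemma dom_adjoint x y : (forall z, dom z -> ip x (A z) = ip y z) -> dom x /\ A x = y.
Proof.
move=> H; suff [? <-] : dom x /\ y = A x by [].
apply/generatorP => e e0; have [dl dl0 Hd] := sg_cvg0 S_C0 y e0.
exists dl => // h /andP[h0 hd].
apply: (inner_le_norm_dense ipP (ltW e0) dom_dense) => z dz.
have dF (s : R) : s \in `]0, h[ -> is_derive s 1 (fun s => ip x (S s z)) (ip (S s y) z).
  rewrite in_itv/= => /andP[s0 sh].
  have h1 := sg_derive s0 dz.
  have := is_derive_inner ipP (is_derive_cst x s 1) h1.
  have [d1 e1] := sg_dom (ltW s0) dz.
  by rewrite (inner0l ipP) add0r -e1 H// -sg_selfadjoint// ltW.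
have cF : {within `[0, h], continuous (fun s => ip x (S s z))}.
  have c1 : {within `[0, h], continuous (fun s => S s z)}.
    by apply: sg_within1 => s /=; rewrite in_itv/= => /andP[].
  by move=> s; apply: (cvg_inner ipP); [exact: cvg_cst|exact: c1].
have [c] := MVT h0 dF cF; rewrite in_itv/= subr0 (C0_id S_C0) => /andP[c0 ch] mvt.
rewrite (innerBl ipP) (innerZl ipP) (innerBl ipP) (sg_selfadjoint _ _ (ltW h0)) mvt.
rewrite mulrC mulfK ?gt_eqF// -(innerBl ipP).
apply: le_trans (inner_CS ipP _ _) _; rewrite ler_wpM2r//.
by apply: Hd; rewrite (ltW c0) (lt_trans ch).
Qed.

End selfadjoint.
End generator_facts.

(** * Test functions and distributional derivatives *)

Section smooth_functions.
Context (R : realType).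
Implicit Types (f g : R -> R) (x y : R).

Lemma is_derive_near f g x y dl : 0 < dl ->
  (forall r, `|r - x| < dl -> f r = g r) -> is_derive x 1 g y -> is_derive x 1 f y.
Proof.
move=> dl0 fg /is_deriveP H; apply/is_deriveP => e /H[dl' dl'0 Hd].
exists (Num.min dl dl'); first by rewrite lt_min dl0.
move=> h; rewrite lt_min => /and3P[h0 h1 h2].
rewrite !fg; [by apply: Hd; rewrite h0|by rewrite subrr normr0|].
by rewrite [x + h]addrC addrK.
Qed.

(** Each derivative is named by a witness instead of being computed, which makes closure under
    products, inverses and affine substitutions a direct induction; [smooth_derivable] converts to
    [derive1n]. *)
Fixpoint smooth n f : Prop :=
  if n is n'.+1 then exists2 f', (forall x, is_derive x 1 f (f' x)) & smooth n' f' else True.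

Lemma smoothW n f : smooth n.+1 f -> smooth n f.
Proof. by elim: n f => // n IH f [f' df sf]; exists f' => //; exact: IH. Qed.

Lemma smooth_derivable f : (forall n, smooth n f) -> forall n x, derivable (derive1n n f) x 1.
Proof.
move=> sf n x; have := sf n.+1; elim: n f {sf} => [|n IH] f [f' df sf].
  by have [] := df x.
have -> : derive1n n.+1 f = derive1n n f'.
  rewrite /derive1n iterSr; congr iter; apply/funext => r.
  by rewrite derive1E; have [] := df r.
exact: IH.
Qed.

Lemma smooth_lin n a f g : smooth n f -> smooth n g -> smooth n (fun x => a * f x + g x).
Proof.
elim: n f g => // n IH f g [f' df sf] [g' dg sg]; exists (fun x => a * f' x + g' x); last exact: IH.
move=> x; have df' := df x; have dg' := dg x.
have -> : (fun x => a * f x + g x) = (a \*: f) + g by [].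
exact: is_deriveD.
Qed.

Lemma smooth_cst n a : smooth n (fun=> a).
Proof. by elim: n a => // n IH a; exists (fun=> 0) => // x; exact: is_derive_cst. Qed.

Lemma smoothM n f g : smooth n f -> smooth n g -> smooth n (fun x => f x * g x).
Proof.
elim: n f g => // n IH f g /[dup] /smoothW sf [f' df sf'] /[dup] /smoothW sg [g' dg sg'].
exists (fun x => 1 * (f x * g' x) + g x * f' x).
  move=> x; have df' := df x; have dg' := dg x.
  by rewrite mul1r; exact: is_deriveM.
by apply: smooth_lin; exact: IH.
Qed.

Lemma smoothV n f : (forall x, f x != 0) -> smooth n f -> smooth n (fun x => (f x)^-1).
Proof.
move=> f0; elim: n => // n IH /[dup] /smoothW sf [f' df sf'].
exists (fun x => -1 * ((f x)^-1 * (f x)^-1 * f' x) + 0).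
  move=> x; have df' := df x; have := is_deriveV (f0 x) df'.
  rewrite addr0 mulN1r /GRing.scale /= mulNr -exprVn expr2; exact.
by apply: smooth_lin; [apply: smoothM => //; apply: smoothM; exact: IH|exact: smooth_cst].
Qed.

Lemma smooth_affine n a b f : smooth n f -> smooth n (fun x => f (a * x + b)).
Proof.
elim: n f => // n IH f [f' df sf]; exists (fun x => a * f' (a * x + b) + 0).
  move=> x; have df' := df (a * x + b).
  have dl : is_derive x 1 (fun x => a * x + b) a.
    apply/is_deriveP => e /ltW e0; exists 1; first exact: ltr01.
    move=> h /andP[h0 _]; rewrite -[h^-1 *: _]/(h^-1 * _).
    have -> : a * (x + h) + b - (a * x + b) = a * h by ring.
    by rewrite mulrC mulfK -?normr_gt0// subrr normr0.
  by have := @is_derive1_comp _ f (fun x => a * x + b) x _ _ df' dl; rewrite addr0 mulrC.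
by apply: smooth_lin; [exact: IH|exact: smooth_cst].
Qed.

(* the derivatives of [exp (- 1 / x)] are combinations of these functions *)
Definition flat k x : R := if 0 < x then x^-1 ^+ k * expR (- x^-1) else 0.

(** With [y = 1 / x], the exponential series gives [exp y >= y^(k+1) / (k+1)!], that is
    [y^k exp (-y) <= (k+1)! x]. This bound settles the derivative at 0. *)
Lemma flat_small k : exists2 C, 0 < C & forall x, `|flat k x| <= C * `|x|.
Proof.
exists (k.+1`!%:R) => [|x]; first by rewrite ltr0n fact_gt0.
rewrite /flat; have [x0|x0] := ltP 0 x; last by rewrite normr0 mulr_ge0.
have y0 : 0 < x^-1 by rewrite invr_gt0.
rewrite ger0_norm; last by rewrite mulr_ge0 ?expR_ge0// exprn_ge0// ltW.
rewrite expRN ler_pdivrMr ?expR_gt0// (gtr0_norm x0).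
have := expR_ge1Dxn k (ltW y0) => H.
have F0 : 0 < k.+1`!%:R :> R by rewrite ltr0n fact_gt0.
have : x^-1 ^+ k.+1 / k.+1`!%:R <= expR x^-1 by lra.
rewrite ler_pdivrMr// exprS [x^-1 * _]mulrC ler_pdivrMr// => H'.
suff -> : k.+1`!%:R * x * expR x^-1 = expR x^-1 * k.+1`!%:R * x by [].
by ring.
Qed.

(** Away from 0 this is direct computation; at 0 the difference quotient of [flat k] is [flat k.+1],
    which tends to 0. *)
Lemma flat_derive k x : is_derive x 1 (flat k) (- k%:R * flat k.+1 x + flat k.+2 x).
Proof.
have [x0|x0|->] := ltgtP x 0.
- have -> : - k%:R * flat k.+1 x + flat k.+2 x = 0.
    by rewrite /flat ltNge (ltW x0)/= mulr0 addr0.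
  apply: (@is_derive_near _ (cst 0) _ _ (- x)); rewrite ?oppr_gt0// => r.
  by rewrite ltr_norml => /andP[_ h]; rewrite /flat ifN// -leNgt; lra.
- apply: (@is_derive_near _ (fun x => x^-1 ^+ k * expR (- x^-1)) _ _ x) => // [r|].
    by rewrite ltr_norml => /andP[h _]; rewrite /flat ifT//; lra.
  have xn0 : x != 0 by rewrite gt_eqF.
  have dV : is_derive x 1 (fun x => x^-1) (- x ^- 2).
    have := @is_deriveV _ id x 1 1 xn0 (is_derive_id _ _).
    by rewrite /GRing.scale /= mulr1.
  have dX := @is_deriveX _ _ _ k x 1 _ dV.
  have dE := @is_derive1_comp _ expR _ x _ _ (is_derive_expR _) (is_deriveN dV).
  have dM := is_deriveM dX dE.
  have -> : (fun x : R => x^-1 ^+ k * expR (- x^-1)) = (fun x => x^-1) ^+ k * (expR \o - (fun x => x^-1)).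
    by apply/funext => r; rewrite [RHS]/=/GRing.mul/= exprfctE.
  apply: is_derive_eq; rewrite /flat x0 /GRing.scale /= opprK -exprVn.
  rewrite exprfctE; move: (x^-1) (expR _) => y ex.
  case: k {dX dM} => [|k] /=; first by rewrite !exprS expr0 mul0r; ring.
  by move: (k.+1%:R : R) => c; rewrite !exprS; ring.
- have -> : - k%:R * flat k.+1 0 + flat k.+2 0 = 0.
    by rewrite /flat ltxx mulr0 addr0.
  have [C C0 HC] := flat_small k.+1; apply/is_deriveP => e e0.
  exists (e / C); first by rewrite divr_gt0.
  move=> h /andP[h0 hd]; rewrite add0r subr0 {2}/flat ltxx subr0.
  have -> : h^-1 *: flat k h = flat k.+1 h.
    by rewrite /flat; case: ifP => _; rewrite ?scaler0// /GRing.scale /= exprS mulrA.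
  by apply: le_trans (HC h) _; rewrite mulrC -ler_pdivlMr// ltW.
Qed.

Lemma smooth_flat n k : smooth n (flat k).
Proof.
elim: n k => // n IH k; exists (fun x => - k%:R * flat k.+1 x + flat k.+2 x).
  by move=> x; exact: flat_derive.
by apply: smooth_lin; exact: IH.
Qed.

(** The quotient [p(x) / (p(x) + p(1 - x))] with [p = flat 0]. Its derivative vanishes outside
    [[0, 1]], where the function is locally constant, and is bounded on [[0, 1]] by compactness. *)
Lemma smooth_step : exists th th' : R -> R,
  [/\ forall n, smooth n th, forall x, is_derive x 1 th (th' x),
      [/\ forall x, x <= 0 -> th x = 0, forall x, 1 <= x -> th x = 1 & forall x, 0 <= th x <= 1],
      forall x, ~ (0 <= x <= 1) -> th' x = 0 &
      exists2 C, 0 < C & forall x, `|th' x| <= C].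
Proof.
(* The factors 1 and -1 give the sum the shape expected by [smooth_lin] and [smooth_affine]. *)
pose q x := 1 * flat 0 x + flat 0 (-1 * x + 1).
have p0 x : 0 <= flat 0 x by rewrite /flat; case: ifP => // _; rewrite expr0 mul1r expR_ge0.
have pp x : 0 < x -> 0 < flat 0 x by move=> x0; rewrite /flat x0 expr0 mul1r expR_gt0.
have q0 x : 0 < q x.
  rewrite /q mul1r; have [x0|x0] := ltP 0 x; first by rewrite ltr_pwDl ?pp.
  by rewrite ltr_wpDl// pp//; lra.
pose th x := flat 0 x * (q x)^-1.
have sth n : smooth n th.
  apply: smoothM; first exact: smooth_flat.
  apply: smoothV; first by move=> x; rewrite gt_eqF.
  by apply: smooth_lin; [exact: smooth_flat|apply: smooth_affine; exact: smooth_flat].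
have [th' dth sth'] := sth 2.
have th0 x : x <= 0 -> th x = 0 by move=> x0; rewrite /th /flat ltNge x0/= mul0r.
have th1 x : 1 <= x -> th x = 1.
  move=> x1; rewrite /th /q {3}/flat ifN ?addr0 ?mul1r ?divff//.
    by rewrite gt_eqF// pp//; lra.
  by rewrite -leNgt; lra.
have th01 x : 0 <= th x <= 1.
  rewrite /th divr_ge0 ?(ltW (q0 x))//= ler_pdivrMr// mul1r /q mul1r lerDl.
  exact: p0.
have cth' : continuous th'.
  by case: sth' => th'' dth' _ x; exact: is_derive_cont (dth' x).
have th'0 x : ~ (0 <= x <= 1) -> th' x = 0.
  move=> /negP; rewrite negb_and -!ltNge => x01.
  have [c [dl dl0 H]] : exists c, exists2 dl, 0 < dl & forall r, `|r - x| < dl -> th r = c.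
    case/orP: x01 => x0.
      exists 0, (- x); rewrite ?oppr_gt0// => r; rewrite ltr_norml => /andP[_ h].
      by apply: th0; lra.
    exists 1, (x - 1); rewrite ?subr_gt0// => r; rewrite ltr_norml => /andP[h _].
    by apply: th1; lra.
  have [_ <-] := dth x.
  by have [_ ->] := is_derive_near dl0 H (is_derive_cst c x 1).
exists th, th'; split => //.
have cn : {within `[0, 1], continuous (fun x => `|th' x|)}.
  apply: continuous_subspaceT => x.
  by apply: continuous_comp; [exact: cth'|exact: norm_continuous].
have [c _ Hc] := EVT_max ler01 cn.
exists (`|th' c| + 1); first by rewrite ltr_wpDl.
move=> x; have [x01|/negP/th'0 ->] := boolP (0 <= x <= 1); last by rewrite normr0 addr_ge0.
by apply: ler_wpDr => //; apply: Hc; rewrite in_itv.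
Qed.

End smooth_functions.

Lemma isBB d (T : measurableType d) (R : realType) (mu : {measure set T -> \bar R})
    (E : normedModType R) (f g : T -> E) w v :
  isB mu f w -> isB mu g v -> isB mu (fun t => f t - g t) (w - v).
Proof.
move=> fw gv; pose L : {linear E -> E} := @GRing.opp E.
have LM x : `|L x| <= 1 * `|x| by rewrite /L /= normrN mul1r.
exact: isBD fw (isB_linear LM gv).
Qed.

(** * Increments from a distributional derivative *)

Section weak_FTC.
Context (R : realType).

Lemma simple_fun_bounded d (T : measurableType d) (E : normedModType R) (s : seq (set T * E)) :
  exists2 M : R, 0 < M & forall t, `|simple_fun s t| <= M.
Proof.
elim: s => [|p s [M M0 H]].
  by exists 1; rewrite ?ltr01// => t; rewrite /simple_fun big_nil normr0.
exists (`|p.2| + M); first by rewrite ltr_wpDl.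
move=> t; rewrite simple_fun_cons; apply: le_trans (ler_normD _ _) _.
rewrite lerD// normrZ ler_piMl// indicE; case: (_ \in _); rewrite ?normr1 ?normr0//.
Qed.

(** [k] is within [e / 2] in L^1 of a simple function bounded by [M], which contributes at most
    [M dl = e / 2] over a length [dl]. Dominated functions are included in order to treat [k] times
    a step by the same bound. *)
Lemma AL1_abs_cont (E : normedModType R) a b (k : R -> E) e : 0 < e -> AL1 (leb `]a, b[) k ->
  exists2 dl, 0 < dl & forall a' b' (E' : normedModType R) (f : R -> E') w,
    a <= a' -> a' <= b' -> b' <= b -> b' - a' <= dl ->
    isB (leb `]a', b'[) f w -> (forall t, `|f t| <= `|k t|) -> `|w| <= e.
Proof.
move=> e0 kA; have e2 : 0 < e / 2 by rewrite divr_gt0.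
have [s _ ks] := kA _ e2; have [M M0 HM] := simple_fun_bounded s.
exists (e / 2 / M); first by rewrite divr_gt0.
move=> a' b' E' f w aa ab bb hd fw fk.
have sub : [set` `]a', b'[] `<=` [set` `]a, b[].
  by move=> t /=; rewrite !in_itv/= => /andP[h1 h2]; rewrite (le_lt_trans aa) ?(lt_le_trans h2).
have [h [mh kh ih]] := l1close_mono (fun A mA => leb_le sub mA) ks.
have h0 := l1close_ge0 kh.
have mM : measurable_fun setT (fun _ : measurableTypeR R => M%:E : \bar R) by exact: measurable_cst.
have := isB_norm_le (leb_fin a' b') fw (emeasurable_funD mh mM) _.
rewrite ge0_integralD//; last by move=> t _; rewrite lee_fin ltW.
rewrite integral_cst// -[X in (_ * X)%E]/(leb _ setT) (leb_itv_setT ab) => H.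
rewrite -lee_fin; apply: le_trans (H _) _.
  move=> t; apply: (@le_trans _ _ (`|k t - simple_fun s t| + M)%:E); last first.
    by rewrite EFinD leeD.
  rewrite lee_fin; apply: le_trans (fk t) _.
  rewrite -{1}(subrK (simple_fun s t) (k t)); apply: le_trans (ler_normD _ _) _.
  by rewrite lerD2l.
rewrite [e]splitr [X in (_ <= X)%E]EFinD; apply: leeD => //.
by rewrite -EFinM lee_fin mulrC -ler_pdivlMr.
Qed.

Variables (th th' : R -> R).
Hypothesis th_smooth : forall n, smooth n th.
Hypothesis th_derive : forall x : R, is_derive x 1 th (th' x).
Hypothesis th0 : forall x, x <= 0 -> th x = 0.
Hypothesis th1 : forall x, 1 <= x -> th x = 1.
Hypothesis th01 : forall x, 0 <= th x <= 1.
Hypothesis th'0 : forall x, ~ (0 <= x <= 1) -> th' x = 0.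
Variable C : R.
Hypothesis C0 : 0 < C.
Hypothesis th'C : forall x, `|th' x| <= C.

(** The passage from 0 to 1 takes place on [[c, c + n]], the real number [n] being its width; the
    argument is written in the form of [smooth_affine]. *)
Definition step (c n t : R) : R := th (n^-1 * t + - c / n).
Definition step' (c n t : R) : R := n^-1 * th' (n^-1 * t + - c / n).

Lemma step_arg (c n t : R) : n^-1 * t + - c / n = (t - c) / n.
Proof. by rewrite mulrC mulrDl. Qed.

Lemma step_smooth c n m : smooth m (step c n).
Proof. exact: smooth_affine. Qed.

Lemma step_derive (c n t : R) : is_derive t 1 (step c n) (step' c n t).
Proof.
have dl : is_derive t 1 (fun x => n^-1 * x + - c / n) n^-1.
  apply/is_deriveP => e /ltW e0; exists 1; first exact: ltr01.
  move=> h /andP[h0 _]; rewrite -[h^-1 *: _]/(h^-1 * _).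
  have -> : n^-1 * (t + h) + - c / n - (n^-1 * t + - c / n) = n^-1 * h by ring.
  by rewrite mulrC mulfK -?normr_gt0// subrr normr0.
have H := @is_derive1_comp _ th _ t _ _ (th_derive _) dl.
by apply: is_derive_eq H _; rewrite mulrC.
Qed.

Lemma step_cont c n : continuous (step c n).
Proof. by move=> t; exact: is_derive_cont (step_derive c n t). Qed.

Lemma step'_cont c n : continuous (step' c n).
Proof.
have [g dg [g' dg' _]] := th_smooth 2.
rewrite /step'; have -> : th' = g.
  by apply/funext => x; have [_ <-] := th_derive x; have [_ <-] := dg x.
move=> t; apply: cvgM; first exact: cvg_cst.
apply: continuous_comp; last exact: is_derive_cont (dg' _).
by apply: cvgD; [apply: cvgM; [exact: cvg_cst|exact: cvg_id]|exact: cvg_cst].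
Qed.

Lemma step_le c n t : 0 < n -> t <= c -> step c n t = 0.
Proof.
move=> n0 tc; rewrite /step step_arg; apply: th0.
by rewrite ler_pdivrMr// mul0r subr_le0.
Qed.

Lemma step_ge c n t : 0 < n -> c + n <= t -> step c n t = 1.
Proof.
move=> n0 tc; rewrite /step step_arg; apply: th1.
by rewrite ler_pdivlMr// mul1r; lra.
Qed.

Lemma step'_0 c n t : 0 < n -> ~ (c <= t <= c + n) -> step' c n t = 0.
Proof.
move=> n0 H; rewrite /step' step_arg th'0 ?mulr0// => /andP[h1 h2]; apply: H.
by move: h1 h2; rewrite ler_pdivlMr// ler_pdivrMr// mul0r mul1r => h1 h2; lra.
Qed.

(** The support lies in [[a, b + n]], hence the conditions [0 < a] and [b + n < T]; the end point 0
    is reached later by a limit. *)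
Lemma trapezoid_test1 (a b n T : R) : 0 < a -> a <= b -> 0 < n -> b + n < T ->
  test1 `]0, T[ (fun t => -1 * step b n t + step a n t).
Proof.
move=> a0 ab n0 bT; split.
  by apply: smooth_derivable => m; apply: smooth_lin; exact: step_smooth.
exists [set` `[a, b + n]]; split; first exact: segment_compact.
  move=> t /=; rewrite !in_itv/= => /andP[at_ tb].
  by rewrite (lt_le_trans a0)//= (le_lt_trans tb).
move=> t /=; rewrite in_itv/= => /negP; rewrite negb_and -!ltNge => /orP[h|h].
  by rewrite !step_le ?(ltW h)// ?(le_trans (ltW h))// mulr0 addr0.
by rewrite !step_ge//; lra.
Qed.

Lemma trapezoid_derive a b n : derive1 (fun t => -1 * step b n t + step a n t) =
  fun t => step' a n t - step' b n t.
Proof.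
apply/funext => t; rewrite derive1E.
have [df eqf] := @is_deriveB _ _ _ _ _ _ _ _ _ (step_derive a n t) (step_derive b n t).
by rewrite -eqf; congr ('D_1 _ t); apply/funext => s; rewrite mulN1r addrC.
Qed.

Lemma step_AL1 (k : R -> R) c n T : AL1 (leb `]0, T[) k ->
  AL1 (leb `]0, T[) (fun t => k t * step c n t).
Proof.
move=> kA; have := @AL1_op _ _ _ (leb `]0, T[) R R (fun t x => x * step c n t) 1 k kA.
apply.
  apply: leb_aeW => t _; split; first by move=> r x y /=; rewrite mulrDl -scalerAl.
  move=> x; rewrite normrM mul1r ler_piMr//.
  by have /andP[? ?] := th01 (n^-1 * t + - c / n); rewrite ger0_norm.
move=> r; apply: continuous_AL1; apply: continuous_subspaceT => t.
by apply: cvgM; [exact: cvg_cst|exact: step_cont].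
Qed.

Lemma isB_zero (a b : R) (f : R -> R) : a <= b -> (forall t, a < t < b -> f t = 0) ->
  isB (leb `]a, b[) f 0.
Proof.
move=> ab f0; have := isB_cst (0 : R) ab; rewrite scaler0; apply: isB_ae.
by apply: leb_aeW => t; rewrite in_itv/= => /f0.
Qed.

(* the trapezoidal test functions are differences of two such steps *)
Lemma step_integral (k : R -> R) c T e : 0 <= c -> c < T -> 0 < e -> AL1 (leb `]0, T[) k ->
  exists2 n0, 0 < n0 & forall n v w, 0 < n < n0 -> c + n < T ->
    isB (leb `]0, T[) (fun t => k t * step c n t) v -> isB (leb `]c, T[) k w ->
    `|v - w| <= e.
Proof.
move=> c0 cT e0 kA; have e2 : 0 < e / 2 by rewrite divr_gt0.
have [dl dl0 Hd] := AL1_abs_cont e2 kA; exists dl => // n v w /andP[n0 nd] cnT Iv Iw.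
have T0 : 0 <= T by exact: le_trans c0 (ltW cT).
have ccn : c <= c + n by rewrite lerDl ltW.
have fin (a b : R) : (leb `]a, b[ setT < +oo)%E by exact: leb_fin.
have sub (a b : R) : 0 <= a -> b <= T -> [set` `]a, b[] `<=` [set` `]0, T[].
  by move=> a0 bT t /=; rewrite !in_itv/= => /andP[h1 h2]; rewrite (le_lt_trans a0) ?(lt_le_trans h2).
have sA := step_AL1 c n kA.
have [v2 Iv2] := AL1_isB (fin c (c + n)) (AL1_subitv (sub _ _ c0 (ltW cnT)) sA).
have [w2 Iw2] := AL1_isB (fin c (c + n)) (AL1_subitv (sub _ _ c0 (ltW cnT)) kA).
have cn0 : 0 <= c + n by exact: le_trans ccn.
have [w3 Iw3] := AL1_isB (fin (c + n) T) (AL1_subitv (sub _ _ cn0 (lexx T)) kA).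
have Iv3 : isB (leb `](c + n), T[) (fun t => k t * step c n t) w3.
  apply: isB_ae Iw3; apply: leb_aeW => t; rewrite in_itv/= => /andP[h _].
  by rewrite step_ge ?mulr1// ltW.
have Iv1 : isB (leb `]0, c[) (fun t => k t * step c n t) 0.
  by apply: isB_zero => // t /andP[_ /ltW tc]; rewrite step_le ?mulr0.
have cnT' : c <= c + n <= T by rewrite ccn ltW.
have c0T : 0 <= c <= T by rewrite c0 ltW.
have eqw := isB_unique (fin _ _) Iw (isB_cat cnT' (AL1_subitv (sub _ _ c0 (lexx T)) kA) Iw2 Iw3).
have I23 := isB_cat cnT' (AL1_subitv (sub _ _ c0 (lexx T)) sA) Iv2 Iv3.
have eqv := isB_unique (fin _ _) Iv (isB_cat c0T sA Iv1 I23).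
have dn : c + n - c <= dl by rewrite [c + n]addrC addrK ltW.
have b1 := Hd c (c + n) _ _ _ c0 ccn (ltW cnT) dn Iv2.
have b2 := Hd c (c + n) _ _ _ c0 ccn (ltW cnT) dn Iw2.
have -> : v - w = v2 - w2 by rewrite eqv eqw; ring.
apply: le_trans (ler_normB _ _) _; rewrite [e]splitr lerD//; last exact: b2.
apply: b1 => t; rewrite normrM ler_piMr//.
by have /andP[? ?] := th01 (n^-1 * t + - c / n); rewrite ger0_norm.
Qed.

(** [step' c n] has integral 1 over [[c, c + n]] and is bounded by [C / n]. Where [h] stays within
    [e / C] of [h c], the error is at most [(e / C) (C / n) n = e]. *)
Lemma step'_integral (h : R -> R) c T e : 0 <= c -> c < T -> 0 < e ->
  {within `[0, T], continuous h} ->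
  exists2 n0, 0 < n0 & forall n v, 0 < n < n0 -> c + n < T ->
    isB (leb `]0, T[) (fun t => h t * step' c n t) v -> `|v - h c| <= e.
Proof.
move=> c0 cT e0 hc; have T0 : 0 <= T by exact: le_trans c0 (ltW cT).
have eC : 0 < e / C by rewrite divr_gt0.
have [dl dl0 Hd] := itv_unif_continuous hc eC.
exists dl => // n v /andP[n0 nd] cnT Iv.
have ccn : c <= c + n by rewrite lerDl ltW.
have cn0 : 0 <= c + n by exact: le_trans ccn.
have fin (a b : R) : (leb `]a, b[ setT < +oo)%E by exact: leb_fin.
have sA (a b : R) : 0 <= a -> b <= T -> AL1 (leb `]a, b[) (fun t => h t * step' c n t).
  move=> a0 bT; apply: continuous_AL1.
  have hc' : {within `[a, b], continuous h}.
    apply: continuous_subspaceW hc => t /=.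
    by rewrite !in_itv/= => /andP[h1 h2]; rewrite (le_trans a0) ?(le_trans h2).
  have sc' : {within `[a, b], continuous (step' c n)}.
    exact/continuous_subspaceT/step'_cont.
  by move=> t; apply: cvgM; [exact: hc'|exact: sc'].
have [v2 Iv2] := AL1_isB (fin c (c + n)) (sA _ _ c0 (ltW cnT)).
have I1 : isB (leb `]0, c[) (fun t => h t * step' c n t) 0.
  apply: isB_zero => // t /andP[_ tc]; rewrite step'_0 ?mulr0//.
  by rewrite leNgt tc.
have I3 : isB (leb `](c + n), T[) (fun t => h t * step' c n t) 0.
  apply: isB_zero => [|t /andP[tc _]]; first exact: ltW.
  by rewrite step'_0 ?mulr0// => /andP[_]; rewrite leNgt tc.
have c0T : 0 <= c <= T by rewrite c0 ltW.
have cnT' : c <= c + n <= T by rewrite ccn ltW.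
have I23 := isB_cat cnT' (sA _ _ c0 (lexx T)) Iv2 I3.
have := isB_unique (fin _ _) Iv (isB_cat c0T (sA _ _ (lexx 0) (lexx T)) I1 I23).
rewrite add0r addr0 => ->.
have F : isB (leb `]c, (c + n)[) (step' c n) 1.
  have := @isB_FTC R (step c n) (step' c n) c (c + n) ccn.
  rewrite step_ge// step_le// subr0; apply.
  - exact/continuous_subspaceT/step_cont.
  - exact/continuous_subspaceT/step'_cont.
  - by move=> t _; exact: step_derive.
pose L : {linear R -> R} := GRing.scale (- h c).
have LM x : `|L x| <= `|h c| * `|x| by rewrite /L /= normrZ normrN.
have I := isBD Iv2 (isB_linear LM F).
have := isB_leb_norm ccn I (ltW (divr_gt0 e0 n0)).
rewrite [L _]mulr1 [c + n - c]addrAC subrr add0r divfK ?gt_eqF//; apply => t /andP[ct tc].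
have -> : h t * step' c n t + L (step' c n t) = (h t - h c) * step' c n t.
  by rewrite [L _]mulNr -mulrBl.
rewrite normrM /step' normrM normfV (gtr0_norm n0).
have h1 : `|h t - h c| <= e / C.
  apply: Hd; rewrite ?in_itv/=.
  - by rewrite (le_trans c0 (ltW ct)) (le_trans (ltW tc) (ltW cnT)).
  - by rewrite c0 ltW.
  - by rewrite gtr0_norm ?subr_gt0//; lra.
have h2 := th'C (n^-1 * t + - c / n).
rewrite mulrCA [e / n]mulrC ler_wpM2l ?invr_ge0 ?(ltW n0)//.
apply: le_trans (ler_pM _ _ h1 h2) _ => //.
by rewrite divfK ?gt_eqF.
Qed.

End weak_FTC.

Section weak_FTC_main.
Context (R : realType).

Lemma weak_FTC (h k : R -> R) T a b : {within `[0, T], continuous h} ->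
  AL1 (leb `]0, T[) k ->
  (forall f, test1 `]0, T[ f -> \int[leb `]0, T[]_t (h t * derive1 f t) =
     - \int[leb `]0, T[]_t (k t * f t)) ->
  0 <= a -> a <= b -> b < T -> isB (leb `]a, b[) k (h b - h a).
Proof.
move=> hc kA H.
have [th [th' [th_smooth dth [th0 th1 th01] th'0 [C C0 th'C]]]] := smooth_step R.
have fin (x y : R) : (leb `]x, y[ setT < +oo)%E by exact: leb_fin.
have sub (x y : R) : 0 <= x -> y <= T -> [set` `]x, y[] `<=` [set` `]0, T[].
  by move=> x0 yT t /=; rewrite !in_itv/= => /andP[h1 h2]; rewrite (le_lt_trans x0) ?(lt_le_trans h2).
have pos (x y : R) : 0 < x -> x <= y -> y < T -> isB (leb `]x, y[) k (h y - h x).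
  move=> x0 xy yT.
  have y0 : 0 <= y by exact: le_trans (ltW x0) xy.
  have xT : x < T by exact: le_lt_trans yT.
  have [w Iw] := AL1_isB (fin x y) (AL1_subitv (sub _ _ (ltW x0) (ltW yT)) kA).
  have [wy Iwy] := AL1_isB (fin y T) (AL1_subitv (sub _ _ y0 (lexx T)) kA).
  have xyT : x <= y <= T by rewrite xy ltW.
  have Iwx := isB_cat xyT (AL1_subitv (sub _ _ (ltW x0) (lexx T)) kA) Iw Iwy.
  suff -> : h y - h x = w by [].
  apply/eqP; rewrite -subr_eq0 -normr_le0; apply/ler_addgt0Pl => e e0; rewrite addr0.
  have e4 : 0 < e / 4 by rewrite divr_gt0.
  have [n1 n10 H1] := step_integral dth th0 th1 th01 (ltW x0) xT e4 kA.
  have [n2 n20 H2] := step_integral dth th0 th1 th01 y0 yT e4 kA.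
  have [n3 n30 H3] := step'_integral th_smooth dth th0 th1 th'0 C0 th'C (ltW x0) xT e4 hc.
  have [n4 n40 H4] := step'_integral th_smooth dth th0 th1 th'0 C0 th'C y0 yT e4 hc.
  (* One width serves the four limits, each costing [e / 4], and keeps [y + n] below [T]; halving
     makes the inequalities strict. *)
  pose n := Num.min (Num.min n1 n2) (Num.min (Num.min n3 n4) (T - y)) / 2.
  have m0 : 0 < Num.min (Num.min n1 n2) (Num.min (Num.min n3 n4) (T - y)).
    by rewrite !lt_min n10 n20 n30 n40 subr_gt0.
  have n0 : 0 < n by rewrite divr_gt0.
  have : n < Num.min (Num.min n1 n2) (Num.min (Num.min n3 n4) (T - y)).
    by rewrite /n ltr_pdivrMr// ltr_pMr// ltr1n.
  rewrite !lt_min => /and3P[/andP[nn1 nn2] /andP[nn3 nn4] nT].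
  have ynT : y + n < T by rewrite -ltrBrDl.
  have xnT : x + n < T by apply: le_lt_trans ynT; rewrite lerD2r.
  have [vx Ivx] := AL1_isB (fin 0 T) (step_AL1 dth th01 x n kA).
  have [vy Ivy] := AL1_isB (fin 0 T) (step_AL1 dth th01 y n kA).
  have hA c : AL1 (leb `]0, T[) (fun t => h t * step' th' c n t).
    apply: continuous_AL1.
    have sc' : {within `[0, T], continuous (step' th' c n)}.
      exact/continuous_subspaceT/(step'_cont th_smooth dth).
    by move=> t; apply: cvgM; [exact: hc|exact: sc'].
  have [ux Iux] := AL1_isB (fin 0 T) (hA x).
  have [uy Iuy] := AL1_isB (fin 0 T) (hA y).
  have n1' : 0 < n < n1 by rewrite n0.
  have n2' : 0 < n < n2 by rewrite n0.
  have n3' : 0 < n < n3 by rewrite n0.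
  have n4' : 0 < n < n4 by rewrite n0.
  have {}H1 := H1 n _ _ n1' xnT Ivx Iwx.
  have {}H2 := H2 n _ _ n2' ynT Ivy Iwy.
  have {}H3 := H3 n _ n3' xnT Iux.
  have {}H4 := H4 n _ n4' ynT Iuy.
  have := H _ (trapezoid_test1 th_smooth th0 th1 x0 xy n0 ynT).
  rewrite (trapezoid_derive dth).
  have -> : \int[leb `]0, T[]_t (h t * (step' th' x n t - step' th' y n t)) = ux - uy.
    apply: isB_Rintegral; first exact: fin.
    have := isBB Iux Iuy; congr (isB _ _ _).
    by apply/funext => t; rewrite mulrBr.
  have -> : \int[leb `]0, T[]_t (k t * (-1 * step th y n t + step th x n t)) = vx - vy.
    apply: isB_Rintegral; first exact: fin.
    have := isBB Ivx Ivy; congr (isB _ _ _).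
    by apply/funext => t; rewrite mulN1r mulrDr mulrN addrC.
  move: H1 H2 H3 H4; rewrite !ler_norml => /andP[? ?] /andP[? ?] /andP[? ?] /andP[? ?] ?.
  lra.
(* A trapezoid starting at 0 has no compact support in []0, T[]. The formula on [[x, b]] is carried
   to [x = 0] by the continuity of [h] and the absolute continuity of the integral of [k]. *)
rewrite le_eqVlt => /predU1P[<-|a0]; last exact: pos.
rewrite le_eqVlt => /predU1P[<- _|b0 bT].
  by rewrite subrr; apply: isB_zero => // t /andP[h1 h2]; have := lt_trans h1 h2; rewrite ltxx.
have [w Iw] := AL1_isB (fin 0 b) (AL1_subitv (sub _ _ (lexx 0) (ltW bT)) kA).
suff -> : h b - h 0 = w by [].
apply/eqP; rewrite -subr_eq0 -normr_le0; apply/ler_addgt0Pl => e e0; rewrite addr0.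
have e2 : 0 < e / 2 by rewrite divr_gt0.
have [dl dl0 Hd] := AL1_abs_cont e2 kA.
have [dl' dl'0 Hd'] := itv_unif_continuous hc e2.
pose x := Num.min (Num.min dl dl') b / 2.
have m0 : 0 < Num.min (Num.min dl dl') b by rewrite !lt_min dl0 dl'0.
have x0 : 0 < x by rewrite divr_gt0.
have : x < Num.min (Num.min dl dl') b by rewrite /x ltr_pdivrMr// ltr_pMr// ltr1n.
rewrite !lt_min => /andP[/andP[xd xd'] xb].
have xT : x <= T by rewrite ltW// (lt_trans xb).
have [v Iv] := AL1_isB (fin 0 x) (AL1_subitv (sub _ _ (lexx 0) xT) kA).
have x0b : 0 <= x <= b by rewrite !ltW.
have I := isB_cat x0b (AL1_subitv (sub _ _ (lexx 0) (ltW bT)) kA) Iv (pos _ _ x0 (ltW xb) bT).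
have eqw := isB_unique (fin _ _) Iw I.
have -> : h b - h 0 - w = (h x - h 0) - v by rewrite eqw; ring.
apply: le_trans (ler_normB _ _) _; rewrite [e]splitr lerD//.
  apply: Hd'; rewrite ?in_itv/=.
  - by rewrite (ltW x0) xT.
  - by rewrite lexx (le_trans _ xT) ?ltW.
  - by rewrite subr0 gtr0_norm.
by apply: (Hd _ _ _ _ _ _ _ _ _ Iv) => //; rewrite ?subr0 ?ltW.
Qed.

End weak_FTC_main.

Lemma Rintegral_ae d (T : measurableType d) (R : realType) (mu : {measure set T -> \bar R})
  (f g : T -> R) : (\forall t \ae mu, f t = g t) -> \int[mu]_t f t = \int[mu]_t g t.
Proof.
move=> fg; rewrite /Rintegral [in LHS]integralE [in RHS]integralE; congr (fine (_ - _)).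
  by apply: ae_eq_lower_integral => //; apply: aeS fg => t h; rewrite !funeposE h.
by apply: ae_eq_lower_integral => //; apply: aeS fg => t h; rewrite !funenegE h.
Qed.

(** * Weak derivatives and the symmetry of [A_n] *)

Section sobolev_interval.
Context (R : realType) (ell : R).
Hypothesis ell_gt0 : 0 < ell.
Local Notation mu := (muI ell).

Lemma continuous_Lfun2 (F : R -> R) : continuous F -> F \in Lfun mu 2%:R%:E.
Proof.
move=> cF.
have cn : {within `[0, ell], continuous (fun x => `|F x|)}.
  apply: continuous_subspaceT => x.
  by apply: continuous_comp; [exact: cF|exact: norm_continuous].
have [c _ Hc] := EVT_max (ltW ell_gt0) cn.
have mF : measurable_fun setT (F : measurableTypeR R -> R) by exact: continuous_measurable_fun.
apply/Lfun2P; split => //.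
apply: (@le_lt_trans _ _ (\int[mu]_x (cst ((`|F c| ^+ 2)%:E) x))%E).
  apply: ae_ge0_le_integral => //.
  - by move=> x _; rewrite lee_fin sqr_ge0.
  - by apply/measurable_EFinP; apply: measurable_funX.
  - by move=> x _; rewrite lee_fin sqr_ge0.
  - apply: leb_aeW => x; rewrite in_itv/= => /andP[x0 xl] _.
    rewrite lee_fin -[leLHS]real_normK ?num_real// lerXn2r ?nnegrE//.
    by apply: Hc; rewrite in_itv/= !ltW.
rewrite integral_cst//; apply: lte_mul_pinfty => //; exact: leb_fin.
Qed.

Lemma test1_Lfun2 i (f : R -> R) : test1 i f ->
  f \in Lfun mu 2%:R%:E /\ derive1 f \in Lfun mu 2%:R%:E.
Proof.
move=> [df _]; split; apply: continuous_Lfun2 => x.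
  exact: is_derive_cont (derivableP (df 0 x)).
exact: is_derive_cont (derivableP (df 1 x)).
Qed.

Lemma wDP (w : L2 mu) : H1I w -> weak_deriv w (wD w).
Proof. by move=> h; have := xgetPex 0 h. Qed.

(** The defining identity of [wD (wD x)] is tested with the functions that approximate [y] in H^1
    and passes to the limit; the boundary condition on [y] enters through this approximation. *)
Lemma wD_by_parts (x y : L2 mu) : H2I x -> H10 y -> ip (wD x) (wD y) = - ip (wD (wD x)) y.
Proof.
move=> [_ /wDP hx] [_ [f [tf fy f'y]]].
have ipP := ip_inner mu.
have c1 : (fun n => ip (wD x) (toL2 mu (derive1 (f n)))) @ \oo --> ip (wD x) (wD y).
  by apply: (cvg_inner ipP); [exact: cvg_cst|exact: f'y].
have c2 : (fun n => ip (- wD (wD x)) (toL2 mu (f n))) @ \oo --> ip (- wD (wD x)) y.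
  by apply: (cvg_inner ipP); [exact: cvg_cst|exact: fy].
have eqf : (fun n => ip (- wD (wD x)) (toL2 mu (f n))) =
    (fun n => ip (wD x) (toL2 mu (derive1 (f n)))).
  apply/funext => n; have [L1 L2] := test1_Lfun2 (tf n).
  by rewrite (innerNl ipP) !ip_toL2r// hx.
rewrite eqf in c2; rewrite -(innerNl ipP).
by rewrite -(cvg_lim (@Rhausdorff R) c1) -(cvg_lim (@Rhausdorff R) c2).
Qed.

Variables (eps1 : R) (alpha1' : R -> R).
Hypothesis alpha1'_Loo : alpha1' \in Lfun mu +oo%E.

(** Integrating by parts on either side gives the same [- <wD x, wD y>], and multiplication by a
    real function is symmetric. *)
Lemma An_sym (x y : L2 mu) : domAn x -> domAn y ->
  ip (An eps1 alpha1' x) y = ip x (An eps1 alpha1' y).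
Proof.
move=> [Hx Vx] [Hy Vy]; have ipP := ip_inner mu.
have [M _ aM] := Lfun_ess_bounded alpha1'_Loo.
rewrite /An (inner_lin ipP) (innerDr ipP) (innerZr ipP) (ip_mulL2C _ _ aM).
congr (eps1 * _ + _); apply: oppr_inj.
rewrite -(wD_by_parts Hx Vy) (inner_sym ipP x) -(wD_by_parts Hy Vx).
exact: (inner_sym ipP).
Qed.

End sobolev_interval.

(** * The weak formulation tested on the first component *)

Section energy_weak_form.
Context (R : realType) (ell d D eps1 eps2 eps2' : R).
Context (alpha1 lambda2 : R * R -> R) (alpha2 lambda1 : R * R * R -> R) (g alpha1' : R -> R).
Hypothesis ell_gt0 : 0 < ell.
Hypothesis alpha1'_Loo : alpha1' \in Lfun (muI ell) +oo%E.
Local Notation A := (@An R ell eps1 alpha1').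

(** Makes the pairs [(phi, 0)] admissible test elements. The representative chosen for the class 0
    vanishes only almost everywhere. *)
Lemma H1O0 : H1O (0 : L2 (muO ell d)).
Proof.
move=> b; exists 0 => f _.
have z : \forall x \ae muO ell d, Lrepr (0 : L2 (muO ell d)) x = 0.
  have := Lrepr_lin (-1) (0 : L2 (muO ell d)) 0; rewrite scaler0 addr0.
  by apply: aeS => x ->; rewrite mulN1r addNr.
have zero (k : R * R -> R) : \int[muO ell d]_q (Lrepr (0 : L2 (muO ell d)) q * k q) = 0.
  apply: (@etrans _ _ (\int[muO ell d]_q 0)); last by rewrite /Rintegral integral0.
  by apply: Rintegral_ae; apply: aeS z => x ->; rewrite mul0r.
by rewrite !zero oppr0.
Qed.

(* the weak derivatives of [0] are not known to be [0], the terms in them only cancel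
   in the difference *)
Lemma energy_formB (t M : R) (u : L2 (muI ell)) (v : L2 (muO ell d)) (Ud phi : L2 (muI ell)) :
  ess_bounded (muI ell) (fun x => alpha1 (x, t)) M ->
  H10 u -> domAn phi -> domAn (0 : L2 (muI ell)) -> A 0 = 0 ->
  energy_form eps1 eps2 eps2' alpha1 lambda2 alpha2 lambda1 g t u v Ud (phi, 0) -
  energy_form eps1 eps2 eps2' alpha1 lambda2 alpha2 lambda1 g t u v Ud (0, 0) =
  ip u (A phi) + ip (Bop g Ud +
     (mulL2 (muI ell) (fun x => alpha1 (x, t) - alpha1' x) u - C12 lambda1 t v)) phi.
Proof.
move=> aM Hu [Hphi _] [H0 _] A0; have ipP := ip_inner (muI ell).
have [M' _ aM'] := Lfun_ess_bounded alpha1'_Loo.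
have e1 : eps1 * ip (wD u) (wD phi) = - (eps1 * ip u (wD (wD phi))).
  by rewrite (inner_sym ipP) (wD_by_parts ell_gt0 Hphi Hu) (inner_sym ipP u) mulrN.
have e0 : eps1 * ip (wD u) (wD 0) = 0.
  rewrite (inner_sym ipP) (wD_by_parts ell_gt0 H0 Hu) mulrN -(innerZl ipP).
  have -> : eps1 *: wD (wD (0 : L2 (muI ell))) = 0.
    have m0 : mulL2 (muI ell) alpha1' 0 = 0.
      have := mulL2_linear aM' (-1) 0 0; rewrite scaler0 addr0 => ->.
      by rewrite scaleN1r addNr.
    by move: A0; rewrite /An m0 addr0.
  by rewrite (inner0l ipP) oppr0.
have -> : mulL2 (muI ell) (fun x => alpha1 (x, t) - alpha1' x) u =
    mulL2 (muI ell) (fun x => alpha1 (x, t)) u - mulL2 (muI ell) alpha1' u.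
  have := mulL2D (-1) u aM' aM; rewrite scaleN1r [- _ + _]addrC => <-.
  by congr (mulL2 _ _ _); apply/funext => x; rewrite mulN1r addrC.
pose K := - (eps2 * ip (pD false v) (pD false (0 : L2 (muO ell d)))) +
  (- (eps2' * ip (pD true v) (pD true (0 : L2 (muO ell d)))) +
  (\int[muO ell d]_q (alpha2 (q, t) * Lrepr v q * Lrepr (0 : L2 (muO ell d)) q) -
   \int[muO ell d]_q (lambda2 (q.1, t) * Lrepr (wD u) q.1 * Lrepr (0 : L2 (muO ell d)) q))).
have eF psi : energy_form eps1 eps2 eps2' alpha1 lambda2 alpha2 lambda1 g t u v Ud (psi, 0) =
    - eps1 * ip (wD u) (wD psi) + ip (mulL2 (muI ell) (fun x => alpha1 (x, t)) u) psi -
    ip (C12 lambda1 t v) psi + ip (Bop g Ud) psi + K.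
  by rewrite (ip_mulL2 u psi aM) /energy_form -!addrA.
clearbody K; have eF1 := eF phi; have eF2 := eF 0.
rewrite mulNr e1 in eF1; rewrite mulNr e0 in eF2.
have z0 (x : L2 (muI ell)) : ip x 0 = 0 by exact: (inner0r ipP).
rewrite eF1 eF2.
rewrite (z0 (mulL2 _ _ u)) (z0 (C12 lambda1 t v)) (z0 (Bop g Ud)).
rewrite /An (innerDr ipP) (innerZr ipP) -(ip_mulL2C u phi aM').
rewrite !(innerDl ipP) !(innerNl ipP).
move: (ip u (wD (wD phi))) (ip (mulL2 (muI ell) alpha1' u) phi) (ip (C12 lambda1 t v) phi) => r1 r2 r3.
move: (ip (mulL2 (muI ell) _ u) phi) (ip (Bop g Ud) phi) => r4 r5.
ring.
Qed.

End energy_weak_form.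

(** By the reverse triangle inequality simple functions suffice. Their sets may overlap, so the
    induction carries a constant [c] that collects the values of the sets already met. *)
Lemma AL1_norm d (T : measurableType d) (R : realType) (mu : {measure set T -> \bar R})
  (E : normedModType R) (f : T -> E) : (mu setT < +oo)%E -> AL1 mu f -> AL1 mu (fun t => `|f t|).
Proof.
move=> mufin fA; apply: AL1_lim => e /fA[s hs fs].
exists (fun t => `|simple_fun s t|); last first.
  rewrite -[e]mul1r; apply: (l1close_comp _ _ fs) => // t; rewrite mul1r.
  exact: ler_dist_dist.
suff H (c : E) : AL1 mu (fun t => `|simple_fun s t + c|).
  by have := H 0; congr (AL1 _ _); apply/funext => t; rewrite addr0.
elim: s hs {fs} c => [_ c|p s IH /is_simple_cons[mp _ /IH {}IH] c].
  have hs : is_simple mu [:: (setT, `|c|)].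
    by apply/is_simple_cons; split => //; exact: measurableT.
  have := AL1_simple hs; congr (AL1 _ _); apply/funext => t.
  by rewrite /simple_fun big_seq1 big_nil /= indicT scale1r add0r.
have := AL1D (AL1_restr mp (IH (p.2 + c))) (AL1_restr (measurableC mp) (IH c)).
congr (AL1 _ _); apply/funext => t; rewrite simple_fun_cons !indicE in_setC.
case: (t \in p.1) => /=; first by rewrite !scale1r scale0r addr0 addrCA addrA.
by rewrite !scale0r scale1r !add0r.
Qed.

Lemma isB_ge0 d (T : measurableType d) (R : realType) (mu : {measure set T -> \bar R})
  (f : T -> R) w : (mu setT < +oo)%E -> isB mu f w -> (forall t, 0 <= f t) -> 0 <= w.
Proof.
by move=> mufin /(isB_Rintegral mufin) <- f0; apply: fine_ge0; apply: integral_ge0 => t _; rewrite lee_fin.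
Qed.

Lemma isB_norm_le_isB d (T : measurableType d) (R : realType) (mu : {measure set T -> \bar R})
  (f g : T -> R) w v : (mu setT < +oo)%E -> isB mu f w -> isB mu g v ->
  (\forall t \ae mu, `|f t| <= g t) -> `|w| <= v.
Proof.
move=> mufin fw gv fg.
(* Changing [g] on a null set makes the bound hold everywhere, as [isB_ge0] requires. *)
have {}gv : isB mu (fun t => Num.max (g t) `|f t|) v.
  by apply: isB_ae gv; apply: aeS fg => t h; rewrite max_l.
have bd t : `|f t| <= Num.max (g t) `|f t| by rewrite le_max lexx orbT.
rewrite ler_norml; apply/andP; split.
  rewrite -subr_ge0 opprK addrC; apply: (isB_ge0 mufin (isBD gv fw)) => t.
  by have := bd t; rewrite ler_norml => /andP[h _]; lra.
rewrite -subr_ge0; apply: (isB_ge0 mufin (isBB gv fw)) => t.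
by have := bd t; rewrite ler_norml => /andP[_ h]; lra.
Qed.

(** Presents integrals over subintervals as increments, the form in which [telescope_le] uses
    them. *)
Lemma AL1_primitive (R : realType) (E : completeNormedModType R) (T : R) (f : R -> E) :
  AL1 (leb `]0, T[) f -> exists P : R -> E,
    forall a b, 0 <= a -> a <= b -> b <= T -> isB (leb `]a, b[) f (P b - P a).
Proof.
move=> fA; exists (fun s => bochner (leb `]0, s[) f) => a b a0 ab bT.
have fin (x y : R) : (leb `]x, y[ setT < +oo)%E by exact: leb_fin.
have sub (x y : R) : 0 <= x -> y <= T -> AL1 (leb `]x, y[) f.
  move=> x0 yT; apply: AL1_subitv fA => t /=; rewrite !in_itv/= => /andP[h1 h2].
  by rewrite (le_lt_trans x0) ?(lt_le_trans h2).
have [wa Iwa] := AL1_isB (fin 0 a) (sub _ _ (lexx 0) (le_trans ab bT)).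
have [w Iw] := AL1_isB (fin a b) (sub _ _ a0 bT).
have ab0 : 0 <= a <= b by rewrite a0.
have I := isB_cat ab0 (sub _ _ (lexx 0) bT) Iwa Iw.
by rewrite (isB_bochner (fin _ _) Iwa) (isB_bochner (fin _ _) I) addrAC subrr add0r.
Qed.

(** The hypothesis covers only intervals shorter than [dl]. Steps of length [dl / 2] chain it up to
    [t], the increments of [m] adding up exactly. *)
Lemma telescope_le (R : realType) (Q m : R -> R) (t dl e : R) : 0 <= t -> 0 < dl ->
  (forall a b, 0 <= a -> a <= b -> b <= t -> b - a < dl -> `|Q b - Q a| <= e * (m b - m a)) ->
  `|Q t - Q 0| <= e * (m t - m 0).
Proof.
move=> t0 dl0 H; pose k := dl / 2.
have k0 : 0 < k by rewrite divr_gt0.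
have kd : k < dl by rewrite /k ltr_pdivrMr// ltr_pMr// ltr1n.
suff step n s : 0 <= s -> s <= t -> s <= n%:R * k -> `|Q s - Q 0| <= e * (m s - m 0).
  pose n := (Num.truncn (t / k)).+1; apply: (step n) => //.
  by rewrite -ler_pdivrMr//; apply: ltW; exact: truncnS_gt.
elim: n s => [|n IH] s s0 st.
  rewrite mul0r => s0'; have -> : s = 0 by apply/eqP; rewrite eq_le s0' s0.
  by apply: H; rewrite ?lexx// subrr.
rewrite -natr1 mulrDl mul1r => sn.
have [sk|ks] := leP s k.
  by apply: H => //; rewrite subr0; exact: le_lt_trans kd.
have sk0 : 0 <= s - k by rewrite subr_ge0 ltW.
have sks : s - k <= s by rewrite gerBl ltW.
have h1 : `|Q (s - k) - Q 0| <= e * (m (s - k) - m 0).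
  by apply: IH => //; [exact: le_trans st|rewrite lerBlDr].
have h2 : `|Q s - Q (s - k)| <= e * (m s - m (s - k)).
  by apply: H => //; rewrite opprB addrC subrK.
have -> : Q s - Q 0 = (Q s - Q (s - k)) + (Q (s - k) - Q 0) by rewrite addrA subrK.
by apply: le_trans (ler_normD _ _) _; lra.
Qed.

(** * Variation of constants *)

Section weak_mild.
Context (R : realType) (E : completeNormedModType R).
Variables (S : R -> E -> E) (dom : set E) (A : E -> E) (ip : E -> E -> R).
Hypothesis S_C0 : C0_semigroup S.
Hypothesis S_gen : generator S dom A.
Hypothesis ipP : inner_product ip.
Variables (u F : R -> E) (T : R).
Hypothesis FA : AL1 (leb `]0, T[) F.
Hypothesis u_cont : {within `[0, T], continuous u}.
Hypothesis u_weak : forall phi a b, dom phi -> 0 <= a -> a <= b -> b < T ->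
  isB (leb `]a, b[) (fun s => ip (u s) (A phi) + ip (F s) phi) (ip (u b) phi - ip (u a) phi).

Lemma AL1_pair_sg (t : R) psi : 0 <= t -> t <= T ->
  AL1 (leb `]0, t[) (fun s => ip (F s) (S (t - s) psi)).
Proof.
move=> t0 tT; have [M M1 HM] := sg_bounded S_C0 t.
have FAt : AL1 (leb `]0, t[) F.
  apply: AL1_subitv FA => s /=; rewrite !in_itv/= => /andP[-> h].
  exact: lt_le_trans tT.
apply: (@AL1_op _ _ _ (leb `]0, t[) E R (fun s c => ip c (S (t - s) psi)) (M * `|psi|) F FAt).
  apply: leb_aeW => s; rewrite in_itv/= => /andP[s0 st]; split.
    by move=> a x y; rewrite (inner_lin ipP).
  move=> x; rewrite mulrC; apply: le_trans (inner_CS ipP _ _) _; rewrite ler_wpM2l//.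
  by apply: HM; rewrite subr_ge0 (ltW st)/= gerBl ltW.
move=> c; apply: continuous_AL1.
have c2 : {within `[0, t], continuous (fun s => S (t - s) psi)}.
  apply: (sg_within S_C0).
  - apply: continuous_subspaceT => s; apply: cvgB; [exact: cvg_cst|exact: cvg_id].
  - by apply: continuous_subspaceT => s; exact: cvg_cst.
  - by move=> s /=; rewrite in_itv/= subr_ge0 => /andP[].
by move=> s; apply: (cvg_inner ipP); [exact: cvg_cst|exact: c2].
Qed.

(* on a short interval, the increment of [<u s, S (t - s) psi>] minus the integral of
   [<F s, S (t - s) psi>] is small relative to the length and to the integral of [|F|] *)
Lemma weak_mild (t : R) psi : 0 <= t -> t < T -> dom psi ->
  isB (leb `]0, t[) (fun s => ip (F s) (S (t - s) psi)) (ip (u t) psi - ip (u 0) (S t psi)).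
Proof.
move=> t0 tT dpsi.
have fin (x y : R) : (leb `]x, y[ setT < +oo)%E by exact: leb_fin.
have [M M1 HM] := sg_bounded S_C0 t; have M0 : 0 <= M by exact: le_trans M1.
have ut : {within `[0, t], continuous u}.
  apply: continuous_subspaceW u_cont => s /=; rewrite !in_itv/= => /andP[-> h].
  by rewrite (le_trans h) ?ltW.
have [Mu Mu0 HMu] : exists2 Mu, 0 <= Mu & forall s, 0 <= s <= t -> `|u s| <= Mu.
  have cn : {within `[0, t], continuous (fun s => `|u s|)}.
    by move=> s; apply: cvg_norm; exact: ut.
  have [c _ Hc] := EVT_max t0 cn.
  by exists `|u c| => // s st; apply: Hc; rewrite in_itv.
have [Pw HPw] := AL1_primitive (AL1_pair_sg psi t0 (ltW tT)).
have FAt : AL1 (leb `]0, t[) F.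
  apply: AL1_subitv FA => s /=; rewrite !in_itv/= => /andP[-> h].
  exact: lt_trans tT.
have [Pn HPn] := AL1_primitive (AL1_norm (fin _ _) FAt).
pose phi s := S (t - s) psi.
have ts s : 0 <= s <= t -> 0 <= t - s <= t.
  by move=> /andP[s0 st]; rewrite subr_ge0 st gerBl.
have dphi s : 0 <= s <= t -> dom (phi s) /\ A (phi s) = S (t - s) (A psi).
  by move=> /ts/andP[h _]; exact: (sg_dom S_C0 S_gen h dpsi).
pose C := M * `|A psi| + Mu.
have C0 : 0 <= C by rewrite addr_ge0// mulr_ge0.
(* The claim amounts to equal values of [Q] at 0 and [t]. On short intervals the increments of [Q]
   are at most [e] times those of [m], for every positive [e]. *)
pose Q s := ip (u s) (phi s) - Pw s.
pose m s := C * s + Pn s.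
suff key : Q t - Q 0 = 0.
  have := HPw 0 t (lexx 0) t0 (lexx t); congr (isB _ _ _).
  by move: key; rewrite /Q /phi subrr subr0 (C0_id S_C0) => key; lra.
have mge : 0 <= m t - m 0.
  have := isB_ge0 (fin _ _) (HPn 0 t (lexx 0) t0 (lexx t)) (fun s => normr_ge0 _) => h.
  by rewrite /m mulr0; have := mulr_ge0 C0 t0 => h'; lra.
apply/eqP; rewrite -normr_le0; apply/ler_addgt0Pl => e' e'0; rewrite addr0.
pose e := e' / (m t - m 0 + 1); have k0 : 0 < m t - m 0 + 1 by rewrite ltr_wpDl.
have e0 : 0 < e by rewrite divr_gt0.
have [d1 d10 H1] := itv_unif_continuous ut e0.
have [d2 d20 H2] := sg_unif_cont S_C0 t psi e0.
have [d3 d30 H3] := sg_unif_cont S_C0 t (A psi) e0.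
pose dl := Num.min d1 (Num.min d2 d3).
have dl0 : 0 < dl by rewrite !lt_min d10 d20.
apply: (@le_trans _ _ (e * (m t - m 0))); last first.
  by rewrite /e mulrAC ler_pdivrMr// ler_pM2l// lerDl.
apply: (telescope_le t0 dl0) => a b a0 ab bt bad.
have b0 : 0 <= b by exact: le_trans ab.
have at_ : a <= t by exact: le_trans bt.
have hb : 0 <= b <= t by rewrite b0.
have ha : 0 <= a <= t by rewrite a0.
have [db eb] := dphi b hb.
have I1 := u_weak db a0 ab (le_lt_trans bt tT).
(* [I1] moves [u] with the test vector frozen at [phi b], [I2] moves the test vector with [u] frozen
   at [a]. Their sum is the increment of [<u, phi>], obtained without differentiating [u]. *)
have I2 : isB (leb `]a, b[) (fun s => - ip (u a) (S (t - s) (A psi)))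
    (ip (u a) (phi b) - ip (u a) (phi a)).
  have cS x : {within `[a, b], continuous (fun s => S (t - s) x)}.
    apply: (sg_within S_C0).
    - apply: continuous_subspaceT => s; apply: cvgB; [exact: cvg_cst|exact: cvg_id].
    - by apply: continuous_subspaceT => s; exact: cvg_cst.
    - move=> s /=; rewrite in_itv/= subr_ge0 => /andP[_ sb]; exact: le_trans bt.
  apply: (@isB_FTC R (fun s => ip (u a) (phi s))) => //.
  - by move=> s; apply: (cvg_inner ipP); [exact: cvg_cst|exact: cS].
  - by move=> s; apply: cvgN; apply: (cvg_inner ipP); [exact: cvg_cst|exact: cS].
  - move=> s; rewrite in_itv/= => /andP[as_ sb].
    have ts0 : 0 < t - s by rewrite subr_gt0; exact: lt_le_trans bt.
    have := is_derive_inner ipP (is_derive_cst (u a) s 1) (is_derive_reflect (sg_derive S_C0 S_gen ts0 dpsi)).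
    by rewrite (inner0l ipP) add0r (innerNr ipP).
have I := isBB (isBD I1 I2) (HPw a b a0 ab bt).
have Ib : isB (leb `]a, b[) (fun s => e * (C + `|F s|)) (e * (m b - m a)).
  have J := isBD (isB_cst C ab) (HPn a b a0 ab bt).
  pose L : {linear R -> R} := GRing.scale e.
  have LM x : `|L x| <= `|e| * `|x| by rewrite /L /= normrZ.
  have := isB_linear LM J; congr (isB _ _ _); rewrite /L /= /m -[LHS]/(e * ((b - a) * C + _)).
  by ring.
have -> : Q b - Q a = ip (u b) (phi b) - ip (u a) (phi b) + (ip (u a) (phi b) - ip (u a) (phi a)) - (Pw b - Pw a).
  by rewrite /Q; ring.
apply: (isB_norm_le_isB (fin _ _) I Ib); apply: leb_aeW => s; rewrite in_itv/= => /andP[as_ sb].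
have hs : 0 <= s <= t by rewrite (le_trans a0 (ltW as_)) (le_trans (ltW sb)).
rewrite eb -/(phi b).
(* The three terms are small through the variation of [u], of [S (t - s) (A psi)] and of
   [S (t - s) psi]. Only the last one multiplies [F], whence the integral of [|F|] in [m]. *)
have -> : ip (u s) (S (t - b) (A psi)) + ip (F s) (phi b) +
      - ip (u a) (S (t - s) (A psi)) - ip (F s) (S (t - s) psi) =
    ip (u s - u a) (S (t - b) (A psi)) + ip (u a) (S (t - b) (A psi) - S (t - s) (A psi)) +
    ip (F s) (phi b - S (t - s) psi).
  by rewrite !(innerBl ipP) !(innerBr ipP); ring.
move: bad; rewrite !lt_min => /and3P[bd1 bd2 bd3].
have sa : `|s - a| < b - a by rewrite gtr0_norm ?subr_gt0// ltrD2r.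
have bs : `|t - b - (t - s)| < b - a.
  rewrite opprB addrA [t - b + s]addrAC -addrA [- b + _]addrC addrA.
  have -> : t + s - t - b = s - b by ring.
  by rewrite distrC gtr0_norm ?subr_gt0// ltrD2l ltrN2.
have f1 : `|ip (u s - u a) (S (t - b) (A psi))| <= e * (M * `|A psi|).
  apply: le_trans (inner_CS ipP _ _) _; apply: ler_pM => //; last by apply: HM; exact: ts.
  by apply: H1; rewrite ?in_itv//; exact: lt_trans bd1.
have f2 : `|ip (u a) (S (t - b) (A psi) - S (t - s) (A psi))| <= Mu * e.
  apply: le_trans (inner_CS ipP _ _) _; apply: ler_pM => //; first exact: HMu.
  by apply: H3; [exact: ts|exact: ts|exact: lt_trans bd3].
have f3 : `|ip (F s) (phi b - S (t - s) psi)| <= `|F s| * e.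
  apply: le_trans (inner_CS ipP _ _) _; rewrite ler_wpM2l//.
  by apply: H2; [exact: ts|exact: ts|exact: lt_trans bd2].
apply: le_trans (ler_normD _ _) _.
have f4 := ler_normD (ip (u s - u a) (S (t - b) (A psi)))
  (ip (u a) (S (t - b) (A psi) - S (t - s) (A psi))).
have -> : e * (C + `|F s|) = e * (M * `|A psi|) + Mu * e + `|F s| * e by rewrite /C; ring.
lra.
Qed.

End weak_mild.

Section semigroup_convolution.
Context (R : realType) (E : completeNormedModType R).
Variable S : R -> E -> E.
Hypothesis S_C0 : C0_semigroup S.

Lemma AL1_sg_conv (a t : R) (f : R -> E) : AL1 (leb `]a, t[) f ->
  AL1 (leb `]a, t[) (fun s => S (t - s) (f s)).
Proof.
move=> fA; have [M M1 HM] := sg_bounded S_C0 (t - a).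
apply: (@AL1_op _ _ _ (leb `]a, t[) E E (fun s => S (t - s)) M f fA).
  apply: leb_aeW => s; rewrite in_itv/= => /andP[as_ st]; split.
    by apply: (C0_linear S_C0); rewrite subr_ge0 ltW.
  by move=> x; apply: HM; rewrite subr_ge0 (ltW st)/= lerD2l lerN2 ltW.
move=> c; apply: continuous_AL1; apply: (sg_within S_C0).
- by apply: continuous_subspaceT => s; apply: cvgB; [exact: cvg_cst|exact: cvg_id].
- by apply: continuous_subspaceT => s; exact: cvg_cst.
- by move=> s /=; rewrite in_itv/= subr_ge0 => /andP[].
Qed.

Lemma isB_sg (h a b : R) (f : R -> E) w : 0 <= h -> isB (leb `]a, b[) f w ->
  isB (leb `]a, b[) (fun s => S h (f s)) (S h w).
Proof.
move=> h0 fw; have [M M1 HM] := sg_bounded1 S_C0 h0.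
exact: (isB_linear (L := sg_map S_C0 h0) HM fw).
Qed.

Lemma predictor_shift (D t : R) (u0 ut : E) (b dd : R -> E) j0 jt w : 0 < D -> 0 <= t ->
  AL1 (leb `](- D), t[) b -> AL1 (leb `]0, t[) dd ->
  isB (leb `]0, t[) (fun s => S (t - s) (b (s - D) + dd s)) (ut - S t u0) ->
  isB (leb `]0, D[) (fun s => S (D - s) (b (0 - D + s))) j0 ->
  isB (leb `]0, D[) (fun s => S (D - s) (b (t - D + s))) jt ->
  isB (leb `]0, t[) (fun s => S (t - s) (b s + S D (dd s))) w ->
  S D ut + jt = S t (S D u0 + j0) + w.
Proof.
move=> D0 t0 bA dA Iu I0 It Iw; have D0' := ltW D0.
have fin (x y : R) : (leb `]x, y[ setT < +oo)%E by exact: leb_fin.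
have [M M1 HM] := sg_bounded1 S_C0 D0'.
have SdA : AL1 (leb `]0, t[) (fun s => S D (dd s)).
  exact: (AL1_linear (L := sg_map S_C0 D0') HM dA).
(* [v], the propagated disturbance, enters the formulas for both [ut] and [w]; once subtracted, only
   integrals of [S (t - r) (b r)] remain. *)
have [v Iv] := AL1_isB (fin 0 t) (AL1_sg_conv SdA).
have Iu' : isB (leb `]0, t[) (fun s => S (t + D - s) (b (s - D))) (S D (ut - S t u0) - v).
  apply: isB_ae (isBB (isB_sg D0' Iu) Iv); apply: leb_aeW => s; rewrite in_itv/= => /andP[s0 st].
  have ts : 0 <= t - s by rewrite subr_ge0 ltW.
  rewrite (sgD S_C0)// (sgD S_C0)// /= -!(C0_add S_C0)// [D + _]addrC addrK.
  by rewrite addrAC.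
have Ia : isB (leb `](- D), (t - D)[) (fun r => S (t - r) (b r)) (S D (ut - S t u0) - v).
  have := @isB_shift R E (- D) (t - D) D _ _ ; rewrite addNr subrK => /(_ _ _ Iu').
  apply: isB_ae; apply: leb_aeW => r _; rewrite addrK; congr (S _ _).
  by rewrite opprD [- r - D]addrC addrA addrK.
have Ib : isB (leb `](t - D), t[) (fun r => S (t - r) (b r)) jt.
  have := @isB_shift R E (t - D) t (D - t) _ _.
  rewrite [t + (D - t)]addrC subrK addrA subrK subrr => /(_ _ _ It).
  apply: isB_ae; apply: leb_aeW => r _.
  have -> : t - D + (r + (D - t)) = r by ring.
  by congr (S _ _); ring.
have Ic : isB (leb `](- D), 0[) (fun r => S (t - r) (b r)) (S t j0).
  have := @isB_shift R E (- D) 0 D _ _.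
  rewrite addNr add0r => /(_ _ _ (isB_sg t0 I0)).
  apply: isB_ae; apply: leb_aeW => r; rewrite in_itv/= => /andP[_ r0].
  have -> : 0 - D + (r + D) = r by ring.
  rewrite -(C0_add S_C0)//; last by rewrite opprD [- r - D]addrC addrA subrr add0r oppr_ge0 ltW.
  by congr (S _ _); ring.
have Id : isB (leb `]0, t[) (fun r => S (t - r) (b r)) (w - v).
  apply: isB_ae (isBB Iw Iv); apply: leb_aeW => s; rewrite in_itv/= => /andP[s0 st].
  by rewrite (sgD S_C0) ?subr_ge0 ?(ltW st)//= addrK.
have bA' := AL1_sg_conv bA.
have o1 : - D <= t - D <= t by rewrite lerDr t0 gerBl.
have o2 : - D <= 0 <= t by rewrite oppr_le0 D0'.
have := isB_unique (fin _ _) (isB_cat o1 bA' Ia Ib) (isB_cat o2 bA' Ic Id).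
rewrite (sgB S_C0)// (sgD S_C0)// -!(C0_add S_C0)// [D + t]addrC => H.
have {}H : S D ut - S (t + D) u0 + jt = S t j0 + w.
  apply: (addIr (- v)); rewrite -[RHS]addrA -H -!addrA; congr (_ + (_ + _)); exact: addrC.
by apply: (addIr (- S (t + D) u0)); rewrite addrAC H [RHS]addrAC [S (t + D) u0 + _]addrC addrK.
Qed.

End semigroup_convolution.

Section mild.
Context (R : realType) (E : completeNormedModType R).
Variables (S : R -> E -> E) (dom : set E) (A : E -> E) (ip : E -> E -> R).
Hypothesis S_C0 : C0_semigroup S.
Hypothesis S_gen : generator S dom A.
Hypothesis ipP : inner_product ip.
Hypothesis A_sym : forall x y, dom x -> dom y -> ip (A x) y = ip x (A y).
Variables (u F : R -> E) (T : R).
Hypothesis FA : AL1 (leb `]0, T[) F.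
Hypothesis u_cont : {within `[0, T], continuous u}.
Hypothesis u_weak : forall phi a b, dom phi -> 0 <= a -> a <= b -> b < T ->
  isB (leb `]a, b[) (fun s => ip (u s) (A phi) + ip (F s) phi) (ip (u b) phi - ip (u a) phi).

(** The integral [w] exists by integrability. Tested with [psi] in the dense domain, the semigroup
    moves onto [psi] by self-adjointness, where [weak_mild] gives the value. *)
Lemma mild (t : R) : 0 <= t -> t < T ->
  isB (leb `]0, t[) (fun s => S (t - s) (F s)) (u t - S t (u 0)).
Proof.
move=> t0 tT.
have FAt : AL1 (leb `]0, t[) F.
  apply: AL1_subitv FA => s /=; rewrite !in_itv/= => /andP[-> h].
  exact: lt_trans tT.
have [w Iw] := AL1_isB (leb_fin 0 t) (AL1_sg_conv S_C0 FAt).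
suff <- : w = u t - S t (u 0) by [].
apply: (inner_dense_inj ipP (dom_dense S_C0 S_gen)) => psi dpsi.
have I := weak_mild S_C0 S_gen ipP FA u_cont u_weak t0 tT dpsi.
have I' := isB_inner ipP psi Iw.
rewrite (innerBl ipP) (sg_selfadjoint S_C0 S_gen ipP A_sym _ _ t0).
have H := isB_unique (leb_fin 0 t) _ I; apply: H.
apply: isB_ae I'; apply: leb_aeW => s; rewrite in_itv/= => /andP[s0 st].
by rewrite (sg_selfadjoint S_C0 S_gen ipP A_sym)// subr_ge0 ltW.
Qed.

End mild.

(** * Energy solutions *)

Section energy_part.
Context (R : realType) (ell d D eps1 eps2 eps2' : R).
Context (alpha1 lambda2 : R * R -> R) (alpha2 lambda1 : R * R * R -> R) (g alpha1' : R -> R).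
Hypothesis ell_gt0 : 0 < ell.
Hypothesis D_gt0 : 0 < D.
Hypothesis alpha1_Loo : alpha1 \in Lfun (muI ell \x leb `]0%R, +oo[)%E +oo%E.
Hypothesis lambda1_Loo : lambda1 \in Lfun (muO ell d \x leb `]0%R, +oo[)%E +oo%E.
Hypothesis g_Loo : g \in Lfun (muI ell) +oo%E.
Hypothesis alpha1'_Loo : alpha1' \in Lfun (muI ell) +oo%E.
Local Notation X := (L2 (muI ell)).
Variable S : R -> X -> X.
Hypothesis S_C0 : C0_semigroup S.
Hypothesis S_gen : generator S (@domAn R ell) (An eps1 alpha1').
Local Notation A := (@An R ell eps1 alpha1').

Lemma Bop_bounded : linear (Bop g : X -> X) /\ exists M, forall x : X, `|Bop g x| <= M * `|x|.
Proof.
have [M M0 gM] := Lfun_ess_bounded g_Loo.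
split; first exact: mulL2_linear gM.
by exists M => x; exact: mulL2_norm.
Qed.

Definition Bmap : {linear X -> X} :=
  HB.pack (Bop g : X -> X) (GRing.isLinear.Build _ _ _ _ _ Bop_bounded.1).

Lemma AL1_Bop d' (T : measurableType d') (mu : {measure set T -> \bar R}) (f : T -> X) :
  AL1 mu f -> AL1 mu (fun s => Bop g (f s)).
Proof.
move=> fA; have [_ [M HM]] := Bop_bounded.
exact: (AL1_linear (L := Bmap) HM fA).
Qed.

Section solution.
Variables (u0 : X) (v0 : L2 (muO ell d)) (U0 u U : R -> X) (v : R -> L2 (muO ell d)).
Hypothesis sol : energy_solution D eps1 eps2 eps2' alpha1 lambda2 alpha2 lambda1 g u0 v0 U0 u v U.
Variable T : R.
Hypothesis T0 : 0 < T.

Lemma energy_u_cont : {within `[0, T], continuous u}.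
Proof.
have h : {within `[0, T], continuous (fun t => (u t, v t))} by exact: (energy_continuous sol T0).
move=> s; exact: (@cvg_comp _ _ _ _ (@fst X (L2 (muO ell d))) _ _ _ (h s) cvg_fst).
Qed.

Lemma energy_b_AL1 : AL1 (leb `](- D), T[) (fun s => Bop g (U s)).
Proof. by apply: AL1_Bop; apply: bochner_L2_AL1; [exact: leb_fin|exact: (energy_input sol)]. Qed.

Lemma energy_d_AL1 : AL1 (leb `]0, T[) (dterm alpha1 lambda1 alpha1' u v).
Proof.
apply: AL1_dterm => //; first exact: continuous_AL1 energy_u_cont.
have [_ _ _ _ Hb] := energy_L2V sol T0.
by apply: bochner_L2_AL1; [exact: leb_fin|exact: Hb].
Qed.

Definition forcing s := Bop g (U (s - D)) + dterm alpha1 lambda1 alpha1' u v s.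

Lemma forcing_AL1 : AL1 (leb `]0, T[) forcing.
Proof.
apply: AL1D energy_d_AL1.
apply: (@AL1_shift R X 0 T (- D) (fun s => Bop g (U s))).
apply: AL1_subitv energy_b_AL1 => s /=; rewrite !in_itv/= add0r => /andP[-> h] /=.
by apply: lt_trans h _; rewrite gtrBl.
Qed.

Lemma energy_weak phi a b : domAn phi -> 0 <= a -> a <= b -> b < T ->
  isB (leb `]a, b[) (fun s => ip (u s) (A phi) + ip (forcing s) phi) (ip (u b) phi - ip (u a) phi).
Proof.
move=> dphi a0 ab bT; have ipP := ip_inner (muI ell).
have [d0 A0] := dom0 S_C0 S_gen.
apply: (@weak_FTC R (fun s => ip (u s) phi) _ T) => //.
- by move=> s; apply: (cvg_inner ipP); [exact: energy_u_cont|exact: cvg_cst].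
- apply: AL1D; first by apply: (AL1_inner ipP); exact: continuous_AL1 energy_u_cont.
  by apply: (AL1_inner ipP); exact: forcing_AL1.
move=> f tf.
have [w [[wlin _ _] wt wE]] := energy_equation sol T0.
have [inV_uv _ _ _ _] := energy_L2V sol T0.
have [M [_ _ aM]] := @alpha_bounded R ell T alpha1 alpha1_Loo.
have vphi : inV (phi, 0 : L2 (muO ell d)).
  by split; [case: dphi|exact: H1O0].
have v0' : inV (0 : X, 0 : L2 (muO ell d)).
  by split; [case: d0|exact: H1O0].
have ipO0 t : ip (v t) (0 : L2 (muO ell d)) = 0 by exact: (inner0r (ip_inner (muO ell d))).
have := wt (phi, 0) f vphi tf; rewrite /=.
have -> : \int[leb `]0, T[]_t ((ip (u t) phi + ip (v t) 0) * derive1 f t) =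
    \int[leb `]0, T[]_t (ip (u t) phi * derive1 f t).
  by congr fine; apply: eq_integral => t _; rewrite ipO0 addr0.
move=> ->; congr (- _); apply: Rintegral_ae.
have wE2 := aeS2 (fun t h1 h2 => conj h1 h2) wE (aeS2 (fun t h1 h2 => conj h1 h2) wlin inV_uv).
apply: aeS2 wE2 aM => t [wEt [wl [Hu Hv]]] aMt; congr (_ * _).
(* Linearity on V makes [w t] vanish at [(0, 0)], so the form may be replaced by the difference
   computed in [energy_formB]. *)
have w0 : w t (0, 0) = 0.
  have := wl 1 (0, 0) (0, 0) v0' v0'.
  have -> : 1 *: (0 : X, 0 : L2 (muO ell d)) + (0, 0) = (0, 0).
    by rewrite -[(0, 0)]/(0 : X * L2 (muO ell d)) scaler0 addr0.
  by rewrite mul1r => h; apply: (addrI (w t (0, 0))); rewrite addr0.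
rewrite -[LHS]subr0 -w0 (wEt _ vphi) (wEt _ v0').
by rewrite (energy_formB _ _ _ _ _ _ ell_gt0 alpha1'_Loo _ _ aMt Hu dphi d0 A0) /forcing /dterm.
Qed.

Lemma energy_mild t : 0 <= t -> t < T ->
  isB (leb `]0, t[) (fun s => S (t - s) (forcing s)) (u t - S t (u 0)).
Proof.
apply: (mild S_C0 S_gen (ip_inner (muI ell)) _ forcing_AL1 energy_u_cont).
  exact: (An_sym ell_gt0 _ alpha1'_Loo).
by move=> phi a b; exact: energy_weak.
Qed.

End solution.

Lemma predictor_mild (u0 : X) (v0 : L2 (muO ell d)) (U0 u U : R -> X) (v : R -> L2 (muO ell d))
    (z : R -> R -> X) :
  energy_solution D eps1 eps2 eps2' alpha1 lambda2 alpha2 lambda1 g u0 v0 U0 u v U ->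
  (forall t, 0 <= t -> \forall s \ae leb `]0, D[, z s t = U (t - D + s)) ->
  let f t s := S (t - s) (Bop g (U s) + S D (dterm alpha1 lambda1 alpha1' u v s)) in
  forall t, 0 <= t ->
    [/\ bochner_integrable (leb `]0, D[) (predictor_integrand D g S z t),
        bochner_integrable (leb `]0, t[) (f t) &
        predictor D g S u z t =
          S t (predictor D g S u z 0) + bochner (leb `]0, t[) (f t)].
Proof.
move=> sol zU f t t0.
(* The weak identity reaches only times below the horizon; [t + 1] puts [t] strictly inside. *)
have T0 : 0 < t + 1 by rewrite ltr_wpDl.
have tT : t < t + 1 by rewrite ltrDl.
have fin (x y : R) : (leb `]x, y[ setT < +oo)%E by exact: leb_fin.
have bA := energy_b_AL1 sol T0; have dA := energy_d_AL1 sol T0.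
have bA' : AL1 (leb `](- D), t[) (fun s => Bop g (U s)).
  by apply: AL1_subitv bA => s /=; rewrite !in_itv/= => /andP[-> h]; exact: lt_trans tT.
have dA' : AL1 (leb `]0, t[) (dterm alpha1 lambda1 alpha1' u v).
  by apply: AL1_subitv dA => s /=; rewrite !in_itv/= => /andP[-> h]; exact: lt_trans tT.
have J r : 0 <= r -> r <= t -> exists j, isB (leb `]0, D[) (fun s => S (D - s) (Bop g (U (r - D + s)))) j.
  move=> r0 rt; suff rA : AL1 (leb `]0, D[) (fun s => Bop g (U (r - D + s))).
    by have H := AL1_isB (fin 0 D) (AL1_sg_conv S_C0 rA); exact: H.
  have : AL1 (leb `](0 + (r - D)), (D + (r - D))[) (fun s => Bop g (U s)).
    apply: AL1_subitv bA => s /=; rewrite !in_itv/= => /andP[h1 h2].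
    by apply/andP; split; lra.
  move=> /AL1_shift; congr (AL1 _ _); apply/funext => s; by rewrite [s + _]addrC.
have P r : 0 <= r -> forall j, isB (leb `]0, D[) (fun s => S (D - s) (Bop g (U (r - D + s)))) j ->
    isB (leb `]0, D[) (predictor_integrand D g S z r) j.
  by move=> r0 j; apply: isB_ae; apply: aeS (zU r r0) => s h; rewrite /predictor_integrand h.
have [j0 I0] := J 0 (lexx 0) t0; have [jt It] := J t t0 (lexx t).
have fA : AL1 (leb `]0, t[) (f t).
  apply: (AL1_sg_conv S_C0); apply: AL1D.
    apply: AL1_subitv bA' => s /=; rewrite !in_itv/= => /andP[h ->].
    by rewrite andbT; apply: lt_trans h; rewrite oppr_lt0.
  have [M M1 HM] := sg_bounded1 S_C0 (ltW D_gt0).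
  exact: (AL1_linear (L := sg_map S_C0 (ltW D_gt0)) HM dA').
have [w Iw] := AL1_isB (fin 0 t) fA.
split.
- by exists jt; apply: isB_is_bochner; exact: P.
- by exists w; exact: isB_is_bochner.
rewrite /predictor (isB_bochner (fin _ _) (P _ t0 _ It)) (isB_bochner (fin _ _) (P _ (lexx 0) _ I0)).
rewrite (isB_bochner (fin _ _) Iw).
have Im := energy_mild sol T0 t0 tT.
exact: (predictor_shift S_C0 D_gt0 t0 bA' dA' Im I0 It Iw).
Qed.

End energy_part.

Lemma within_comp (U V W : topologicalType) (K : set V) (A : set U)
    (f : V -> W) (g : U -> V) :
  {within K, continuous f} -> continuous g -> (forall x, A x -> K (g x)) ->
  {within A, continuous (f \o g)}.
Proof.
move=> /subspace_continuousP cf cg AK; apply/subspace_continuousP => x Ax.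
have cfx := cf _ (AK _ Ax); move=> P /cfx H.
change (nbhs x [set y | A y -> P (f (g y))]).
have gH : nbhs x (g @^-1` [set y | K y -> P (f y)]) by exact: cg x _ H.
by apply: filterS gH => y h Ay; exact: h (AK y Ay).
Qed.

(** * Classical solutions *)

Section bounded_linear.
Context (R : realType) (E E' : normedModType R) (L : {linear E -> E'}) (M : R).
Hypothesis LM : forall x, `|L x| <= M * `|x|.

Lemma bounded_linear_cont : continuous L.
Proof.
move=> x; apply/cvgrPdist_le => e e0; pose M' := `|M| + 1.
have M0 : 0 < M' by rewrite ltr_wpDl.
apply/nbhs_ballP; exists (e / M'); first by rewrite /= divr_gt0.
move=> y; rewrite -ball_normE /= => xy; rewrite -linearB.
apply: le_trans (LM _) _; apply: (@le_trans _ _ (M' * `|x - y|)).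
  by rewrite ler_wpM2r// (le_trans (ler_norm _))// lerDl.
by rewrite mulrC -ler_pdivlMr// ltW.
Qed.

Lemma is_derive_linear (f : R -> E) (t : R) (y : E) : is_derive t 1 f y ->
  is_derive t 1 (fun s => L (f s)) (L y).
Proof.
move=> /is_deriveP H; apply/is_deriveP => e e0; pose M' := `|M| + 1.
have M0 : 0 < M' by rewrite ltr_wpDl.
have [dl dl0 Hd] := H _ (divr_gt0 e0 M0); exists dl => // h hh.
rewrite -linearB -linearZ -linearB; apply: le_trans (LM _) _.
apply: (@le_trans _ _ (M' * `|h^-1 *: (f (t + h) - f t) - y|)).
  by rewrite ler_wpM2r// (le_trans (ler_norm _))// lerDl.
by rewrite mulrC -ler_pdivlMr//; exact: Hd.
Qed.

End bounded_linear.

(** * The contribution of the delayed input *)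

Section delayed_input.
Context (R : realType) (E : completeNormedModType R).
Variables (S : R -> E -> E) (dom : set E) (A : E -> E) (ip : E -> E -> R).
Hypothesis S_C0 : C0_semigroup S.
Hypothesis S_gen : generator S dom A.
Hypothesis ipP : inner_product ip.
Hypothesis A_sym : forall x y, dom x -> dom y -> ip (A x) y = ip x (A y).
Variables (D : R) (z zs : R -> R -> E).
Hypothesis D0 : 0 < D.
Local Notation K := ([set` `[0, D]] `*` [set` `]0, +oo[]).
Hypothesis z_cont : {within K, continuous (fun q : R * R => z q.1 q.2)}.
Hypothesis zs_cont : {within K, continuous (fun q : R * R => zs q.1 q.2)}.
Hypothesis z_s : forall s t : R, 0 < s < D -> 0 < t -> is_derive s 1 (fun r => z r t) (zs s t).
Hypothesis z_t : forall s t : R, 0 < s < D -> 0 < t -> is_derive t 1 (fun r => z s r) (zs s t).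

Lemma slice_cont (f : R -> R -> E) (t : R) : {within K, continuous (fun q : R * R => f q.1 q.2)} ->
  0 < t -> {within `[0, D], continuous (fun s => f s t)}.
Proof.
move=> fc t0; apply: (@within_comp R (R * R)%type E K [set` `[0, D]] _ (fun s => (s, t)) fc).
  by move=> s; exact: (cvg_pair (f := fun x : R => x) (g := fun=> t) cvg_id (cvg_cst t)).
by move=> s hs; split => //=; rewrite in_itv/= t0.
Qed.

Lemma delay_isB (f : R -> R -> E) (t : R) : {within K, continuous (fun q : R * R => f q.1 q.2)} ->
  0 < t -> exists w, isB (leb `]0, D[) (fun s => S (D - s) (f s t)) w.
Proof.
move=> fc t0; have fA := continuous_AL1 (slice_cont fc t0).
by have H := AL1_isB (leb_fin 0 D) (AL1_sg_conv S_C0 fA); exact: H.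
Qed.

Variable j : R -> E.
Hypothesis jP : forall t : R, 0 < t -> isB (leb `]0, D[) (fun s => S (D - s) (z s t)) (j t).

(** Differentiation under the integral: by the mean value inequality and uniform continuity on a
    compact rectangle, the time quotient of [z] is within [e / (M D)] of [zs], uniformly in [s]; the
    semigroup costs [M] and the integration [D]. *)
Lemma delay_derive (t : R) k : 0 < t ->
  isB (leb `]0, D[) (fun s => S (D - s) (zs s t)) k -> is_derive t 1 j k.
Proof.
move=> t0 Ik; apply/is_deriveP => e e0.
have [M M1 HM] := sg_bounded S_C0 D; have M0 : 0 < M by exact: lt_le_trans M1.
pose e' := e / (M * D).
have e'0 : 0 < e' by rewrite divr_gt0// mulr_gt0.
(* A compact neighbourhood of time [t] in the domain of continuity, which excludes time 0. *)
pose K' : set (R * R) := [set` `[0, D]] `*` [set` `[t / 2, t + t / 2]].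
have t20 : 0 < t / 2 by rewrite divr_gt0.
have zc' : {within K', continuous (fun q : R * R => zs q.1 q.2)}.
  apply: continuous_subspaceW zs_cont => q [/= h1]; rewrite in_itv/= => /andP[h2 _].
  by split => //=; rewrite in_itv/= andbT; exact: lt_le_trans h2.
have K'c : compact K' by apply: compact_setX; exact: segment_compact.
have [dl dl0 Hd] := compact_unif_continuous K'c zc' e'0.
exists (Num.min dl (t / 2)); first by rewrite lt_min dl0.
move=> h; rewrite lt_min => /and3P[hn hd ht].
have h0 : h != 0 by rewrite -normr_gt0.
have th : 0 < t + h by move: ht; rewrite ltr_norml => /andP[h1 _]; lra.
have near s r : 0 < s < D -> `|r - t| <= `|h| -> `|zs s r - zs s t| <= e'.
  move=> /andP[s0 sD] rt; have := le_lt_trans rt ht; rewrite ltr_norml => /andP[r1 r2].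
  apply: (Hd (s, r) (s, t)).
  - by split => /=; rewrite in_itv/=; apply/andP; split; lra.
  - by split => /=; rewrite in_itv/=; apply/andP; split; lra.
  - split => /=; rewrite -ball_normE /=; first by rewrite subrr normr0.
    exact: le_lt_trans rt hd.
have key s : 0 < s < D -> `|h^-1 *: (z s (t + h) - z s t) - zs s t| <= e'.
  move=> sD.
  have mvt a b : 0 < a -> a <= b -> (forall r, r \in `]a, b[ -> `|zs s r - zs s t| <= e') ->
      `|z s b - z s a - (b - a) *: zs s t| <= e' * (b - a).
    move=> a0 ab H; apply: (mvt_inner ipP (f' := zs s) ab) => //.
      apply/subspace_continuousP => r; rewrite /= in_itv/= => /andP[ar _].
      have r0 : 0 < r by exact: lt_le_trans ar.
      by apply: cvg_within_filter; exact: is_derive_cont (z_t sD r0).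
    by move=> r; rewrite in_itv/= => /andP[ar _]; apply: z_t => //; exact: lt_trans ar.
  have [hp|hm] := ltP 0 h.
    have := mvt t (t + h) t0; rewrite lerDl (ltW hp) [t + h - t]addrAC subrr add0r => /(_ isT) H.
    have -> : h^-1 *: (z s (t + h) - z s t) - zs s t =
        h^-1 *: (z s (t + h) - z s t - h *: zs s t).
      by rewrite [in RHS]scalerBr scalerA mulVf// scale1r.
    rewrite normrZ normfV (gtr0_norm hp) ler_pdivrMl// mulrC; apply: H => r.
    rewrite in_itv/= => /andP[h1 h2]; apply: near => //.
    by rewrite (gtr0_norm hp) gtr0_norm ?subr_gt0//; lra.
  have hneg : h < 0 by rewrite lt_neqAle h0.
  have := mvt (t + h) t th; rewrite gerDl (ltW hneg) opprD addrA subrr add0r => /(_ isT) H.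
  have -> : h^-1 *: (z s (t + h) - z s t) - zs s t =
      (- h)^-1 *: (z s t - z s (t + h) - (- h) *: zs s t).
    by rewrite [in RHS]scalerBr scalerA mulVf ?oppr_eq0// scale1r invrN scaleNr -scalerN opprB.
  have hp : 0 < - h by rewrite oppr_gt0.
  rewrite normrZ normfV (gtr0_norm hp) ler_pdivrMl// mulrC; apply: H => r.
  rewrite in_itv/= => /andP[h1 h2]; apply: near => //.
  by rewrite (ltr0_norm hneg) ltr0_norm ?subr_lt0//; lra.
have I1 := isBB (jP th) (jP t0).
pose L : {linear E -> E} := GRing.scale h^-1.
have LM x : `|L x| <= `|h^-1| * `|x| by rewrite /L /= normrZ.
have I := isBB (isB_linear LM I1) Ik.
have := isB_leb_norm (ltW D0) I (mulr_ge0 (ltW M0) (ltW e'0)).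
have -> : M * e' * (D - 0) = e.
  by rewrite subr0 mulrAC /e' mulrC divfK// gt_eqF// mulr_gt0.
apply => s /andP[s0 sD]; have Ds : 0 <= D - s by rewrite subr_ge0 ltW.
rewrite /L /= -(sgB S_C0)// -(sgZ S_C0)// -(sgB S_C0)//.
apply: le_trans (HM _ _ _) _; first by rewrite Ds gerBl ltW.
by rewrite ler_pM2l//; apply: key; rewrite s0.
Qed.

Lemma delay_dom (t : R) k : 0 < t -> isB (leb `]0, D[) (fun s => S (D - s) (zs s t)) k ->
  dom (j t) /\ A (j t) = k - z D t + S D (z 0 t).
Proof.
move=> t0 Ik; apply: (dom_adjoint S_C0 S_gen ipP A_sym) => phi dphi.
have sa s x y : 0 < s < D -> ip (S (D - s) x) y = ip x (S (D - s) y).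
  by move=> /andP[_ h]; apply: (sg_selfadjoint S_C0 S_gen ipP A_sym); rewrite subr_ge0 ltW.
have cS x : {within `[0, D], continuous (fun s => S (D - s) x)}.
  apply: (sg_within S_C0).
  - by apply: continuous_subspaceT => s; apply: cvgB; [exact: cvg_cst|exact: cvg_id].
  - by apply: continuous_subspaceT => s; exact: cvg_cst.
  - by move=> s /=; rewrite in_itv/= subr_ge0 => /andP[].
have zc := slice_cont z_cont t0; have zsc := slice_cont zs_cont t0.
have I1 : isB (leb `]0, D[) (fun s => ip (zs s t) (S (D - s) phi) - ip (z s t) (S (D - s) (A phi)))
    (ip (z D t) phi - ip (z 0 t) (S D phi)).
  have := @isB_FTC R (fun s => ip (z s t) (S (D - s) phi))
    (fun s => ip (zs s t) (S (D - s) phi) - ip (z s t) (S (D - s) (A phi))) 0 D (ltW D0).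
  rewrite subrr subr0 (C0_id S_C0); apply.
  - by move=> s; apply: (cvg_inner ipP); [exact: zc|exact: cS].
  - by move=> s; apply: cvgB; apply: (cvg_inner ipP); [exact: zsc|exact: cS|exact: zc|exact: cS].
  - move=> s; rewrite in_itv/= => sD; have Ds : 0 < D - s by case/andP: sD; rewrite subr_gt0.
    have := is_derive_inner ipP (z_s sD t0) (is_derive_reflect (sg_derive S_C0 S_gen Ds dphi)).
    by rewrite (innerNr ipP).
have I2 := isB_inner ipP phi Ik.
have I3 := isB_inner ipP (A phi) (jP t0).
have I4 : isB (leb `]0, D[) (fun s => ip (zs s t) (S (D - s) phi) - ip (z s t) (S (D - s) (A phi)))
    (ip k phi - ip (j t) (A phi)).
  by apply: isB_ae (isBB I2 I3); apply: leb_aeW => s; rewrite in_itv/= => h; rewrite !sa.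
have H := isB_unique (leb_fin 0 D) I1 I4.
rewrite (innerDl ipP) (innerBl ipP) (sg_selfadjoint S_C0 S_gen ipP A_sym _ _ (ltW D0)).
lra.
Qed.

End delayed_input.

Section classical_part.
Context (R : realType) (ell d D eps1 : R).
Context (alpha1 : R * R -> R) (lambda1 : R * R * R -> R) (g alpha1' : R -> R).
Hypothesis ell_gt0 : 0 < ell.
Hypothesis D_gt0 : 0 < D.
Hypothesis g_Loo : g \in Lfun (muI ell) +oo%E.
Hypothesis alpha1'_Loo : alpha1' \in Lfun (muI ell) +oo%E.
Local Notation X := (L2 (muI ell)).
Variable S : R -> X -> X.
Hypothesis S_C0 : C0_semigroup S.
Hypothesis S_gen : generator S (@domAn R ell) (An eps1 alpha1').

Lemma predictor_classical (u U : R -> X) (v : R -> L2 (muO ell d)) (z : R -> R -> X) :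
  classical_transport D z U ->
  classical_shoreline eps1 alpha1 lambda1 g alpha1' u v z ->
  forall t, 0 < t ->
    [/\ bochner_integrable (leb `]0, D[) (predictor_integrand D g S z t),
        domAn (predictor D g S u z t) &
        is_derive t 1 (predictor D g S u z)
          (An eps1 alpha1' (predictor D g S u z t) + Bop g (U t)
           + S D (dterm alpha1 lambda1 alpha1' u v t))].
Proof.
move=> [[zs [zt [zc zsc _ dz]]] zU _] sh t t0.
have ipP := ip_inner (muI ell).
have A_sym := An_sym ell_gt0 eps1 alpha1'_Loo.
have [_ [M HM]] := @Bop_bounded R ell g g_Loo.
pose B := @Bmap R ell g g_Loo; have BM x : `|B x| <= M * `|x| by exact: HM.
pose K : set (R * R) := [set` `[0, D]] `*` [set` `]0, +oo[].
have Bc (f : R -> R -> X) : {within K, continuous (fun q : R * R => f q.1 q.2)} ->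
    {within K, continuous (fun q : R * R => B (f q.1 q.2))}.
  by move=> fc q; apply: continuous_comp; [exact: fc|exact: bounded_linear_cont BM _].
have bc := Bc _ zc; have bsc := Bc _ zsc.
have b_s (s r : R) : 0 < s < D -> 0 < r -> is_derive s 1 (fun x => B (z x r)) (B (zs s r)).
  by move=> sD r0; have [h _ _] := dz s r sD r0; exact: is_derive_linear BM _ _ _ h.
(* The transport equation enters here: the time derivative is replaced by [zs], so that the same [k]
   serves [delay_derive] and [delay_dom]. *)
have b_t (s r : R) : 0 < s < D -> 0 < r -> is_derive r 1 (fun x => B (z s x)) (B (zs s r)).
  by move=> sD r0; have [_ h e] := dz s r sD r0; rewrite e in h; exact: is_derive_linear BM _ _ _ h.
pose j r := bochner (leb `]0, D[) (predictor_integrand D g S z r).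
have jP (r : R) : 0 < r -> isB (leb `]0, D[) (fun s => S (D - s) (B (z s r))) (j r).
  move=> r0; have [w Iw] := delay_isB S_C0 (f := fun s t => B (z s t)) bc r0.
  by have -> : j r = w by exact: isB_bochner (leb_fin 0 D) Iw.
have [k Ik] := delay_isB S_C0 (f := fun s t => B (zs s t)) bsc t0.
have dj := delay_derive S_C0 ipP (z := fun s t => B (z s t))
  (zs := fun s t => B (zs s t)) D_gt0 bsc b_t jP t0 Ik.
have [jd jA] := delay_dom S_C0 S_gen ipP A_sym (z := fun s t => B (z s t))
  (zs := fun s t => B (zs s t)) D_gt0 bc bsc b_s jP t0 Ik.
have [ud _ du] := sh t t0.
have D0 := ltW D_gt0.
have [SM _ HSM] := sg_bounded1 S_C0 D0.
have [Sud SuA] := sg_dom S_C0 S_gen D0 ud.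
have [Yd YA] := dom_linear S_C0 S_gen 1 Sud jd.
rewrite !scale1r in Yd YA.
split; [by exists (j t); apply: isB_is_bochner; exact: jP|exact: Yd|].
have dSu := is_derive_linear (L := sg_map S_C0 D0) HSM du.
have dY := is_deriveD dSu dj.
apply: (is_derive_eq dY).
rewrite [predictor _ _ _ _ _ _]/(S D (u t) + j t) YA SuA jA /=.
rewrite (zU t t0) (sgD S_C0 _ (dterm alpha1 lambda1 alpha1' u v t) D0).
rewrite (sgD S_C0 (An eps1 alpha1' (u t)) _ D0).
(* [b] is the delayed input propagated by [S D]: it comes from the shoreline equation on the left
   and from [A_n J] on the right. [y] is [B (U t)], subtracted in [A_n J] as the boundary value at
   [s = D] and added back as the input. *)
have alg (a b c y : X) : a + b + c + k = a + (k - y + b) + y + c.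
  rewrite -!addrA; congr (a + _).
  by rewrite [b + (y + c)]addrCA addKr [RHS]addrCA [k + c]addrC.
exact: alg.
Qed.

End classical_part.

Unset Implicit Arguments.

Theorem proposition5 (R : realType) (ell d D eps1 eps2 eps2' : R)
  (alpha1 lambda2 : R * R -> R) (alpha2 lambda1 : R * R * R -> R)
  (g alpha1' : R -> R)
  (ell_gt0 : 0 < ell) (d_gt0 : 0 < d) (D_gt0 : 0 < D)
  (eps1_gt0 : 0 < eps1) (eps2_gt0 : 0 < eps2) (eps2'_gt0 : 0 < eps2')
  (alpha1_Loo : alpha1 \in Lfun (muI ell \x leb `]0%R, +oo[)%E +oo%E)
  (lambda2_Loo : lambda2 \in Lfun (muI ell \x leb `]0%R, +oo[)%E +oo%E)
  (alpha2_Loo : alpha2 \in Lfun (muO ell d \x leb `]0%R, +oo[)%E +oo%E)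
  (lambda1_Loo : lambda1 \in Lfun (muO ell d \x leb `]0%R, +oo[)%E +oo%E)
  (g_Loo : g \in Lfun (muI ell) +oo%E)
  (g_neq0 : (0 < muI ell [set x | g x != 0%R])%E)
  (alpha1'_Loo : alpha1' \in Lfun (muI ell) +oo%E)
  (S : R -> L2 (muI ell) -> L2 (muI ell))
  (S_C0 : C0_semigroup S)
  (S_gen : generator S (@domAn R ell) (An eps1 alpha1')) :
  (forall (u U : R -> L2 (muI ell)) (v : R -> L2 (muO ell d))
      (z : R -> R -> L2 (muI ell)),
    classical_transport D z U ->
    classical_shoreline eps1 alpha1 lambda1 g alpha1' u v z ->
    forall t, 0 < t ->
      [/\ bochner_integrable (leb `]0, D[) (predictor_integrand D g S z t),
          domAn (predictor D g S u z t) &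
          is_derive t 1 (predictor D g S u z)
            (An eps1 alpha1' (predictor D g S u z t) + Bop g (U t)
             + S D (dterm alpha1 lambda1 alpha1' u v t))])
  /\
  (forall (u0 : L2 (muI ell)) (v0 : L2 (muO ell d)) (U0 : R -> L2 (muI ell))
      (u U : R -> L2 (muI ell)) (v : R -> L2 (muO ell d))
      (z : R -> R -> L2 (muI ell)),
    bochner_L2 (leb `](- D), 0[) U0 ->
    energy_solution D eps1 eps2 eps2' alpha1 lambda2 alpha2 lambda1 g
      u0 v0 U0 u v U ->
    (forall t, 0 <= t -> \forall s \ae leb `]0, D[, z s t = U (t - D + s)) ->
    let f t s :=
      S (t - s) (Bop g (U s) + S D (dterm alpha1 lambda1 alpha1' u v s)) in
    forall t, 0 <= t ->
      [/\ bochner_integrable (leb `]0, D[) (predictor_integrand D g S z t),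
          bochner_integrable (leb `]0, t[) (f t) &
          predictor D g S u z t =
            S t (predictor D g S u z 0) + bochner (leb `]0, t[) (f t)]).
Proof.
split.
- move=> u U v z; exact: predictor_classical.
- by move=> u0 v0 U0 u U v z _; exact: predictor_mild.
Qed.
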